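(* Let $(\mathcal{X},d,\mu)$ be a metric measure space with the volume doubling property, let $T\in(0,\infty]$, and let $\{\varphi_t\}_{0<t<T}$ be a heat kernel on $\mathcal{X}$ such that for all $x\in\mathcal X$ and $t\in(0,T)$ the function $y\mapsto[\varphi_t(x,y)]^{-1}$ is bounded on compact sets. Assume: (A1) For every $f\in C_c(\mathcal{X})$ and every $x\in\mathcal{X}$, $\lim_{t\to0}\int_{\mathcal X}\varphi_t(x,y)f(y)\,d\mu(y)=f(x)$. (A2) There is $\eta\in(0,1]$ such that for all $R\in(0,T)$ and $x_1,x_2\in\mathcal{X}$ there is a constant $C=C(R,x_1,x_2)$ with $\varphi_{\eta R}(x_1,y)\le C\,\varphi_R(x_2,y)$ for all $y\in\mathcal{X}$. Moreover, for every $x\in\mathcal X$, $R\in(0,T)$ and every ball $B_R$ of radius $R$ there is a positive constant $C$ (depending on $x$, $R$ and the ball) with $\varphi_R(x,y)\ge C$ for all $y\in B_R$. (A3) There exist $\gamma\ge1$, functions $\xi_1,\xi_2:\mathcal{X}\times(0,\infty)\to(1,\infty)$ such that $\xi_i(\cdot,t)$ is bounded on every bounded set for each $t$ ($i=1,2$), and a function $\Gamma:(0,\infty)\to(0,\infty)$, such that for every $R\in(0,T/\gamma)$, every measurable $f\ge0$ and every $x\in\mathcal{X}$, $$H^*_Rf(x)\le \xi_1(x,R)\,\mathcal{M}_{\Gamma(R)}f(x)+\xi_2(x,R)\int_{\mathcal X}\varphi_{\gamma R}(x,y)f(y)\,d\mu(y).$$ Let $v$ be a positive weight on $\mathcal{X}$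 and $1\le p<\infty$. Then the following statements are equivalent: (1) There exist $R\in(0,T)$ and a weight $u$ such that $H^*_R$ maps $L^p_v(\mathcal X)$ into $L^p_u(\mathcal X)$ if $p>1$, and maps $L^1_v(\mathcal X)$ into weak $L^1_u(\mathcal X)$ if $p=1$. (2) There exists $R\in(0,T)$ such that for all $f\in L^p_v(\mathcal X)$ the integral $\int_{\mathcal X}\varphi_R(x,y)f(y)\,d\mu(y)$ is finite for all $x$, and $\lim_{t\to0}\int_{\mathcal X}\varphi_t(x,y)f(y)\,d\mu(y)=f(x)$ for $\mu$-almost every $x$. (3) There exist $R\in(0,T)$ and $x\in\mathcal X$ such that $\int_{\mathcal X}\varphi_R(x,y)f(y)\,d\mu(y)$ is finite for all $f\in L^p_v(\mathcal X)$. (4) $v\in D_p$.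
   Context: Metric measure space with volume doubling: $(\mathcal X,d)$ is a locally compact separable metric space, $\mu$ a Radon measure with $0<\mu(B(x,r))<\infty$ for all balls $B(x,r)=\{y:d(x,y)<r\}$, and there is $C>0$ with $\mu(B(x,2r))\le C\mu(B(x,r))$ for all $x\in\mathcal X$, $r>0$. Heat kernel on $(0,T)$: a family $\{\varphi_t\}_{0<t<T}$ of non-negative measurable functions on $\mathcal X\times\mathcal X$ with (a) $\int_{\mathcal X}\varphi_t(x,y)\,d\mu(y)=1$; (b) $\varphi_{s+t}(x,y)=\int_{\mathcal X}\varphi_s(x,z)\varphi_t(z,y)\,d\mu(z)$ (for $s,t>0$, $s+t<T$); (c) for $f\in L^2(\mathcal X)$, $\int_{\mathcal X}\varphi_t(\cdot,y)f(y)\,d\mu(y)\to f$ in $L^2(\mathcal X)$ as $t\to0$. A weight is a measurable function $v:\mathcal X\to(0,\infty)$ such that $v\,d\mu$ is a Radon measure. $\|f\|_{L^p_v(\mathcal X)}=(\int_{\mathcal X}|f|^pv\,d\mu)^{1/p}$. Weak $L^1_u$ is given by the quasinorm $\sup_{\lambda>0}\lambda\int_{\{|f|>\lambda\}}u\,d\mu$. ''Maps $A$ into $B$'' means that there is a constant $C$ with $\|\cdot\|_B$ of the image at most $C\|f\|_A$ for all $f\in A$. Weight class $D_p$ ($1\le p<\infty$, $\frac1p+\frac1{p'}=1$): $v\in D_p$ iff there is $t_0\in(0,T)$ with $\|v^{-1/p}\varphi_{t_0}(x,\cdot)\|_{L^{p'}(\mathcal X)}<\infty$ for some $x\in\mathcal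 X$. Local (time) maximal operator: $H^*_Rf(x)=\sup_{0<t<R}\left|\int_{\mathcal X}\varphi_t(x,y)f(y)\,d\mu(y)\right|$. An integral is called finite if it converges absolutely; $H^*_Rf(x)$ is taken to be $+\infty$ if one of the integrals does not converge absolutely. Local Hardy–Littlewood maximal function: $\mathcal M_Rf(x)=\sup_{0<s<R}\frac1{\mu(B(x,s))}\int_{B(x,s)}|f(y)|\,d\mu(y)$. *)

(* Defs.v *)
From HB Require Import structures.
From mathcomp Require Import all_boot all_order all_algebra.
From mathcomp Require Import all_classical all_reals all_analysis.

Set Implicit Arguments.
Unset Strict Implicit.
Unset Printing Implicit Defensive.

Import Order.TTheory GRing.Theory Num.Theory.
Import numFieldNormedType.Exports.

Local Open Scope classical_set_scope.
Local Open Scope ring_scope.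
Local Open Scope ereal_scope.

HB.mixin Record Measurable_isBorel (d : measure_display) X
    & Measurable d X & Topological X := {
  measurable_borel : @measurable d X = <<s @open X >>
}.

(* A metric space together with its Borel sigma-algebra. Measurable types are
   pointed, so such a space is nonempty. *)
#[short(type="borelMetricType")]
HB.structure Definition BorelMetric (d : measure_display) (R : numDomainType) :=
  {X of Measurable d X & Metric R X & Measurable_isBorel d X}.

Section metric_measure_space.
Context {d : measure_display} {R : realType} {X : borelMetricType d R}.

Definition separable := exists2 S : set X, countable S & dense S.

Definition metric_bounded (A : set X) :=
  exists (x : X) (r : R), A `<=` ball x r.

(* Finite on compact sets, outer regular on Borel sets and inner regular on
   open sets. *)
Definition radon (nu : set X -> \bar R) :=
  [/\ forall K, compact K -> nu K < +oo,
      forall A, measurable A ->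
        nu A = ereal_inf [set nu U | U in [set U | open U /\ A `<=` U]] &
      forall U, open U ->
        nu U = ereal_sup [set nu K | K in [set K | compact K /\ K `<=` U]]].

Record doubling_space (mu : {measure set X -> \bar R}) : Prop :=
  DoublingSpace {
    doubling_locally_compact : locally_compact [set: X] ;
    doubling_separable : separable ;
    doubling_radon : radon mu ;
    doubling_ball : forall (x : X) (r : R), (0 < r)%R ->
      0 < mu (ball x r) < +oo ;
    doubling_volume : exists2 C : R, (0 < C)%R &
      forall (x : X) (r : R), (0 < r)%R ->
        mu (ball x (2 * r)%R) <= C%:E * mu (ball x r)
  }.

Definition weight (mu : {measure set X -> \bar R}) (v : X -> R) :=
  [/\ measurable_fun [set: X] v, forall x, (0 < v x)%R &
      radon (fun A => \int[mu]_(x in A) (v x)%:E)].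

Definition wLnorm (mu : {measure set X -> \bar R}) (v : X -> R) (p : R)
    (g : X -> \bar R) : \bar R :=
  (\int[mu]_x (`|g x| `^ p * (v x)%:E)) `^ p^-1.

Definition wLfun (mu : {measure set X -> \bar R}) (v : X -> R) (p : R)
    (f : X -> R) :=
  measurable_fun [set: X] f /\ wLnorm mu v p (EFin \o f) < +oo.

Definition weakL1norm (mu : {measure set X -> \bar R}) (u : X -> R)
    (g : X -> \bar R) : \bar R :=
  ereal_sup [set l%:E * \int[mu]_(x in [set x | l%:E < `|g x|]) (u x)%:E
            | l in [set l : R | (0 < l)%R]].

Definition Cc (f : X -> R) :=
  continuous f /\ compact (closure [set x | f x != 0%R]).

Definition local_HL_maximal (mu : {measure set X -> \bar R}) (r : R)
    (f : X -> R) (x : X) : \bar R :=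
  ereal_sup [set (mu (ball x s))^-1 * \int[mu]_(y in ball x s) `|(f y)%:E|
            | s in [set s : R | (0 < s < r)%R]].

Section heat.
Variables (mu : {measure set X -> \bar R}) (phi : R -> X -> X -> R).

(* An extended-real integral: for measurable f it is a real number exactly when
   it converges absolutely, and it is +oo or -oo otherwise. Hence convergence
   of heat_op t f x to a real number as t tends to 0 includes absolute
   convergence of the integrals for small t. *)
Definition heat_op (t : R) (f : X -> R) (x : X) : \bar R :=
  \int[mu]_y (phi t x y * f y)%:E.

Definition heat_finite (t : R) (f : X -> R) (x : X) :=
  mu.-integrable [set: X] (fun y => (phi t x y * f y)%:E).

Definition local_heat_maximal (r : R) (f : X -> R) (x : X) : \bar R :=
  if `[< forall t : R, (0 < t < r)%R -> heat_finite t f x >]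
  then ereal_sup [set (`|heat_op t f x|) | t in [set t : R | (0 < t < r)%R]]
  else +oo.

Record heat_kernel (T : \bar R) : Prop := HeatKernel {
  heat_kernel_ge0 : forall t : R, 0 < t%:E < T ->
    forall x y, (0 <= phi t x y)%R ;
  heat_kernel_measurable : forall t : R, 0 < t%:E < T ->
    measurable_fun [set: X * X] (fun z => phi t z.1 z.2) ;
  heat_kernel_mass : forall t : R, 0 < t%:E < T ->
    forall x, \int[mu]_y (phi t x y)%:E = 1 ;
  heat_kernel_semigroup : forall s t : R, (0 < s)%R -> (0 < t)%R ->
    (s + t)%:E < T -> forall x y,
    (phi (s + t)%R x y)%:E = \int[mu]_z (phi s x z * phi t z y)%:E ;
  heat_kernel_L2 : forall f : X -> R, f \in Lfun mu 2%:E ->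
    Lnorm mu 2%:E (fun x => heat_op t f x - (f x)%:E) @[t --> 0%R^'+] --> 0
}.

(* The inverse is taken in \bar R, where the inverse of 0 is +oo. *)
Definition inv_locally_bounded (T : \bar R) :=
  forall (x : X) (t : R), 0 < t%:E < T ->
  forall K : set X, compact K ->
  exists M : R, forall y, K y -> (phi t x y)%:E^-1 <= M%:E.

Definition initial_condition :=
  forall (f : X -> R), Cc f ->
  forall x, heat_op t f x @[t --> 0%R^'+] --> (f x)%:E.

Definition comparison_condition (T : \bar R) :=
  (exists2 eta : R, (0 < eta <= 1)%R &
     forall r : R, 0 < r%:E < T -> forall x1 x2 : X,
     exists C : R, forall y, (phi (eta * r) x1 y <= C * phi r x2 y)%R) /\
  (forall (x : X) (r : R), 0 < r%:E < T -> forall x0 : X,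
     exists2 C : R, (0 < C)%R & forall y, ball x0 r y -> (C <= phi r x y)%R).

Definition maximal_condition (T : \bar R) :=
  exists (gamma : R) (xi1 xi2 : X -> R -> R) (Gamma : R -> R),
  [/\ (1 <= gamma)%R,
      forall x (t : R), (0 < t)%R -> (1 < xi1 x t)%R /\ (1 < xi2 x t)%R,
      forall (t : R) (B : set X), (0 < t)%R -> metric_bounded B ->
        exists M : R, forall x, B x -> (xi1 x t <= M)%R /\ (xi2 x t <= M)%R,
      forall t : R, (0 < t)%R -> (0 < Gamma t)%R &
      forall r : R, 0 < r%:E < T / gamma%:E ->
      forall f : X -> R, measurable_fun [set: X] f ->
        (forall y, (0 <= f y)%R) ->
      forall x, local_heat_maximal r f x <=
        (xi1 x r)%:E * local_HL_maximal mu (Gamma r) f x +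
        (xi2 x r)%:E * heat_op (gamma * r) f x].

Definition weight_class (T : \bar R) (p : R) (v : X -> R) :=
  exists2 t0 : R, 0 < t0%:E < T & exists x : X,
    Lnorm mu (hoelder_conjugate p%:E)
      (fun y => (v y `^ (- p^-1) * phi t0 x y)%:E) < +oo.

Definition maximal_strong_type (p : R) (v u : X -> R) (r : R) :=
  exists C : R, forall f, wLfun mu v p f ->
    wLnorm mu u p (local_heat_maximal r f) <= C%:E * wLnorm mu v p (EFin \o f).

Definition maximal_weak_type (v u : X -> R) (r : R) :=
  exists C : R, forall f, wLfun mu v 1 f ->
    weakL1norm mu u (local_heat_maximal r f) <=
      C%:E * wLnorm mu v 1 (EFin \o f).

End heat.
End metric_measure_space.

(* Main.v *)
(* (1) => (3): if the maximal function were infinite almost everywhere, its norm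
   would be infinite; so it is finite somewhere, and (A2) moves the finiteness of
   the integral to a fixed point for a smaller time.  (3) => (4): by a gliding
   hump, integrability of phi_R(x, .) f for all f in L^p_v forces a norm bound,
   and testing it on extremal functions bounds the dual norm.

   Let v be in D_p with psi = phi_t0(x0, .).  By Hoelder, f in L^p_v implies that
   psi |f| is integrable.  By (A3) and (A2), H^*_r f <= W (M(psi |f|) + int psi |f|)
   for a small r and a finite measurable W, where M is the maximal operator over
   countably many balls.  As M is of weak type (1,1) by Vitali's covering lemma,
   approximating f by functions of C_c for the measure psi mu gives the
   convergence almost everywhere in (2), and, up to a damping factor,
   u = min(1, psi) / W works in (1) for p = 1.  For p > 1 put
   tau = (v^(-1/p) psi)^p', an integrable function, and g = psi |f| / tau, so that
   the norm of g in L^p(tau) is that of f in L^p_v.  Then M(psi |f|) <= S M_tau g,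
   where M_tau g is the maximal function of tau-averages over tripled balls,
   S = sup tau(3B) / mu(B) is finite almost everywhere, and M_tau is bounded on
   L^p(tau) by interpolation; dividing min(1, psi, tau) by powers of W and 1 + S
   then gives u. *)

Require Import Defs.
From HB Require Import structures.
From mathcomp Require Import finmap.
From mathcomp Require Import all_boot all_order all_algebra.
From mathcomp Require Import all_classical all_reals all_analysis.
From mathcomp Require Import measurable_realfun ess_sup_inf ring lra.

Set Implicit Arguments.
Unset Strict Implicit.
Unset Printing Implicit Defensive.

Import Order.TTheory GRing.Theory Num.Theory.
Import numFieldNormedType.Exports.

Local Open Scope classical_set_scope.
Local Open Scope ring_scope.
Local Open Scope ereal_scope.

(** * Vitali coverings *)

(** The weight [v] is arbitrary, so the measure [tau] mu need not be doubling. The averages with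
    respect to [tau] are therefore integrals over a ball divided by the mass of the tripled ball:
    the tripled balls of Vitali's lemma are then paid for at once, and the whole loss sits in the
    ratio tau(3B) / mu(B), which is controlled by the doubling of mu and the integrability of [tau].
    The choice of [tau] is forced by the wish that (psi |f| / tau)^p tau be |f|^p v. The reference
    kernel psi plays two roles. Being bounded below on each ball, it turns local averages of |f|
    into averages of the integrable function psi |f|; being integrable itself, it cuts the final
    weights down to finite mass. All weights [u] are kept below 1, so that they inherit regularity
    from mu. The maximal function is a supremum over uncountably many times and may fail to be
    measurable. It is compared pointwise with a measurable majorant, and measure theory is applied
    to the majorant alone. *)

Section integration.
Context d (T : measurableType d) (R : realType) (mu : {measure set T -> \bar R}).

(* No measurability is assumed: the integral of a nonnegative function is a
   supremum over the simple functions below it. *)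
Lemma le_ge0_integral_pointwise (f g : T -> \bar R) :
  (forall x, 0 <= f x) -> (forall x, f x <= g x) ->
  \int[mu]_x f x <= \int[mu]_x g x.
Proof.
move=> f0 fg; have g0 x : 0 <= g x := le_trans (f0 x) (fg x).
rewrite !ge0_integralTE//; apply: le_ereal_sup => _ [h /= hf <-].
by exists h => //= x; exact: le_trans (hf x) (fg x).
Qed.

Lemma measurable_natr_pred (P : pred T) : measurable [set x | P x] ->
  measurable_fun [set: T] (fun x => (P x)%:R : R).
Proof.
move=> mP; rewrite (_ : (fun x => _) = \1_[set x | P x] :> (T -> R)).
  exact: measurable_indic.
apply/funext => x; rewrite indicE; have [Px|Px] := boolP (P x).
  by rewrite mem_set.
by rewrite memNset//=; exact/negP.
Qed.

Lemma measurable_set_ltr (f g : T -> R) : measurable_fun [set: T] f ->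
  measurable_fun [set: T] g -> measurable [set x | (f x < g x)%R].
Proof.
move=> mf mg; have := measurable_fun_ltr mf mg.
by move=> /(_ measurableT [set true]); rewrite setTI; exact.
Qed.

Section density.
Variables (f : T -> \bar R) (f0 : forall x, 0 <= f x).
Hypothesis mf : measurable_fun [set: T] f.

(** Nonnegativity and measurability are arguments of the function, so that the measure structure
    declared below can be inferred from the term itself. *)
Definition density of (forall x, 0 <= f x) & measurable_fun [set: T] f :=
  fun A : set T => \int[mu]_(x in A) f x.

Local Notation nu := (density f0 mf).

Let nu_set0 : nu set0 = 0. Proof. exact: integral_set0. Qed.

Let nu_ge0 A : 0 <= nu A. Proof. exact: integral_ge0. Qed.

Let nu_sigma_additive : semi_sigma_additive nu.
Proof. exact: semi_sigma_additive_nng_induced. Qed.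

HB.instance Definition _ := isMeasure.Build _ _ _ nu
  nu_set0 nu_ge0 nu_sigma_additive.

Lemma densityE A : nu A = \int[mu]_(x in A) f x. Proof. by []. Qed.

End density.
End integration.

(** * Borel sets, balls and the covering lemma *)

Section borel_metric.
Context d (R : realType) (X : borelMetricType d R).

Lemma open_borel (A : set X) : open A -> measurable A.
Proof. by move=> oA; rewrite measurable_borel; exact: sub_sigma_algebra. Qed.

Lemma open_metric_ball (x : X) (r : R) : open (ball x r).
Proof.
rewrite openE => y; rewrite ballEmdist/= => xy; rewrite /interior.
apply/nbhs_ballP; exists (r - mdist x y)%R => /=; first by rewrite subr_gt0.
move=> z; rewrite !ballEmdist/= ltrBrDl; apply: le_lt_trans.
exact: metric_triangle.
Qed.

Lemma measurable_metric_ball (x : X) (r : R) : measurable (ball x r).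
Proof. exact/open_borel/open_metric_ball. Qed.

Lemma metric_ballxx (x : X) (r : R) : (0 < r)%R -> ball x r x.
Proof. by move=> r0; exact: ballxx. Qed.

Lemma continuous_borel (f : X -> R) : continuous f -> measurable_fun [set: X] f.
Proof.
move=> /continuousP cf.
apply: (measurability _ (RGenOpens.measurableE R)) => _ [_ [a [b ->] <-]].
by rewrite setTI; apply: open_borel; apply: cf; exact: interval_open.
Qed.

(* Keep a largest ball, discard every ball it meets, and recurse. *)
Lemma vitali_seq (c : nat -> X) (rho : nat -> R) (s : seq nat) :
  (forall n, 0 < rho n)%R ->
  exists s' : seq nat, [/\ uniq s', {subset s' <= s},
    trivIset [set` s'] (fun n => ball (c n) (rho n)) &
    forall n, n \in s -> exists2 m, m \in s' &
      ball (c n) (rho n) `<=` ball (c m) (3 * rho m)%R].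
Proof.
move=> rho0; have [k] := ubnP (size s); elim: k s => // k IH s sk.
have [->|s0] := eqVneq s [::].
  by exists [::]; split => // i j; rewrite /= in_nil.
have [m ms mmax] : exists2 m, m \in s & forall n, n \in s -> (rho n <= rho m)%R.
  elim: s s0 {sk IH} => // a s IH _.
  have [->|/IH[m ms mmax]] := eqVneq s [::].
    by exists a; rewrite ?inE// => n; rewrite inE => /eqP->.
  have [am|ma] := leP (rho a) (rho m).
    by exists m; rewrite ?inE ?ms ?orbT// => n; rewrite inE => /predU1P[->//|/mmax].
  exists a; rewrite ?inE ?eqxx// => n; rewrite inE => /predU1P[->//|/mmax nm].
  exact: le_trans nm (ltW ma).
pose B n := ball (c n) (rho n).
pose t := [seq n <- s | `[< B n `&` B m = set0 >]].
have mt : m \notin t.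
  rewrite mem_filter negb_and; apply/orP; left; apply/asboolPn; rewrite setIid.
  by apply/eqP/set0P; exists (c m); exact: metric_ballxx.
have /IH[s' [us' s't tris' covs']] : (size t < k)%N.
  rewrite -ltnS (leq_trans _ sk)// ltnS size_filter.
  rewrite -(count_predC (fun n => `[< B n `&` B m = set0 >]) s).
  rewrite -[ltnLHS]addn0 ltn_add2l -has_count.
  by apply/hasP; exists m => //=; move: mt; rewrite mem_filter ms andbT.
have Bm n : n \in s' -> B n `&` B m = set0.
  by move=> /s't; rewrite mem_filter => /andP[/asboolP].
exists (m :: s'); split => /=.
- by rewrite us' andbT; apply/negP => /s't; rewrite (negbTE mt).
- move=> n; rewrite inE => /predU1P[->//|/s't].
  by rewrite mem_filter => /andP[].
- apply/trivIsetP => i j /=; rewrite !inE.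
  move=> /predU1P[->|is'] /predU1P[->|js'] ij.
  + by rewrite eqxx in ij.
  + by rewrite setIC; exact: Bm.
  + exact: Bm.
  + by move/trivIsetP : tris' => /(_ i j is' js' ij).
- move=> n ns; have [nm|/eqP/set0P[z [nz mz]]] := pselect (B n `&` B m = set0).
    have [|l ls' nl] := covs' n; first by rewrite mem_filter ns andbT; apply/asboolP.
    by exists l => //; rewrite inE ls' orbT.
  exists m; rewrite ?inE ?eqxx// => y ny.
  (* One radius of the large ball reaches the common point [z], then at most one diameter of the
     small ball reaches [y]. *)
  have -> : (3 * rho m = rho m + (rho m + rho m))%R by lra.
  apply: ball_triangle mz _; apply: (le_ball (lerD (mmax _ ns) (mmax _ ns))).
  by apply: ball_triangle ny; exact: ball_sym.
Qed.

(** The common core of the weak type inequalities: [nu] measures a superlevel set and [kap] carries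
    the right-hand side as a density. For finitely many balls, the triples of a disjoint subfamily
    cover, and [kap] is additive on that subfamily; the countable union follows by continuity from
    below. Going through finite families also copes with unbounded radii. *)
Lemma vitali_measure (nu kap : {measure set X -> \bar R})
    (c : nat -> X) (rho : nat -> R) (I : set nat) :
  (forall n, 0 < rho n)%R ->
  (forall n, I n -> nu (ball (c n) (3 * rho n)%R) <= kap (ball (c n) (rho n))) ->
  nu (\bigcup_(n in I) ball (c n) (rho n)) <= kap [set: X].
Proof.
move=> rho0 H; pose B n := ball (c n) (rho n).
have mB n : measurable (B n) by exact: measurable_metric_ball.
have fin (s : seq nat) : (forall n, n \in s -> I n) ->
    nu (\big[setU/set0]_(n <- s) B n) <= kap [set: X].
  move=> sI; have [s' [us' s's tris' covs']] := vitali_seq c s rho0.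
  have mD (A : nat -> set X) : (forall n, measurable (A n)) ->
      forall r : seq nat, measurable (\big[setU/set0]_(n <- r) A n).
    by move=> mA r; exact: bigsetU_measurable.
  have m3 n : measurable (ball (c n) (3 * rho n)%R) by exact: measurable_metric_ball.
  apply: (@le_trans _ _ (nu (\big[setU/set0]_(n <- s') ball (c n) (3 * rho n)%R))).
    apply: le_measure; rewrite ?inE; [exact: mD|exact: mD|].
    rewrite -!bigcup_seq => x [n /= ns nx]; have [m ms' nm] := covs' _ ns.
    by exists m => //; exact: nm.
  apply: (@le_trans _ _ (\sum_(n <- s') nu (ball (c n) (3 * rho n)%R))).
    elim: (s') => [|a r IH]; first by rewrite !big_nil measure0.
    rewrite !big_cons (le_trans (measureU2 _ _ _))//; first exact: mD.
    exact: leeD2l.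
  apply: (@le_trans _ _ (\sum_(n <- s') kap (B n))).
    by rewrite big_seq [leRHS]big_seq; apply: lee_sum => n /s's /sI /H.
  have -> : \sum_(n <- s') kap (B n) = kap (\big[setU/set0]_(n <- s') B n).
    elim: s' us' tris' {s's covs'} => [|a r IH] /=; first by rewrite !big_nil measure0.
    move=> /andP[ar ur] tri; rewrite !big_cons measureU//; last 2 first.
      exact: mD.
      rewrite -bigcup_seq setI_bigcupr; apply: bigcup0 => i /= ir.
      move/trivIsetP : tri => /(_ a i); rewrite /= !inE eqxx ir orbT; apply => //.
      by apply: contraNneq ar => ->.
    rewrite IH//; apply: sub_trivIset tri => i /= ir.
    by rewrite inE ir orbT.
  by apply: le_measure; rewrite ?inE//; exact: mD.
pose F k := \big[setU/set0]_(n <- [seq n <- iota 0 k | `[< I n >]]) B n.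
have FE k : F k = \bigcup_(n in [set n | (n < k)%N /\ I n]) B n.
  rewrite /F -bigcup_seq; apply: eq_bigcupl; split => n /=;
    rewrite mem_filter mem_iota /= add0n.
    by move=> /andP[/asboolP].
  by move=> [-> /asboolP ->].
have -> : \bigcup_(n in I) B n = \bigcup_k F k.
  apply/seteqP; split => x.
    by move=> [n In nx]; exists n.+1 => //; rewrite FE; exists n.
  by move=> [k _]; rewrite FE => -[n [_ In] nx]; exists n.
have mF k : measurable (F k) by exact: bigsetU_measurable.
have cv : nu \o F @ \oo --> nu (\bigcup_k F k).
  apply: nondecreasing_cvg_mu => //; first exact: bigcup_measurable.
  move=> i j ij; apply/subsetPset; rewrite !FE => x [n [ni In] nx].
  by exists n => //; split => //; exact: leq_trans ij.
rewrite -(cvg_lim _ cv)//; apply: lime_le; first by apply/cvg_ex; eexists; exact: cv.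
apply: nearW => k; apply: fin => n.
by rewrite mem_filter => /andP[/asboolP].
Qed.

End borel_metric.

(** * Doubling measures *)

Section doubling_geometry.
Context d (R : realType) (X : borelMetricType d R).
Variable mu : {measure set X -> \bar R}.
Hypothesis hX : doubling_space mu.

Lemma ball_measure_gt0 (x : X) (r : R) : (0 < r)%R -> 0 < mu (ball x r).
Proof. by move=> /(doubling_ball hX x) /andP[]. Qed.

Lemma ball_measure_fin (x : X) (r : R) : (0 < r)%R -> mu (ball x r) \is a fin_num.
Proof.
by move=> /(doubling_ball hX x) /andP[m0 moo]; rewrite ge0_fin_numE// ltW.
Qed.

Lemma doubling_iter : exists2 C : R, (1 <= C)%R & forall (k : nat) (x : X) (r : R),
  (0 < r)%R -> mu (ball x (2 ^+ k * r)%R) <= (C ^+ k)%:E * mu (ball x r).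
Proof.
have [C C0 HC] := doubling_volume hX.
exists (Num.max 1%R C); first by rewrite le_max lexx.
elim=> [|k IH] x r r0; first by rewrite !expr0 mul1r mul1e.
rewrite exprS -mulrA (le_trans (HC _ _ _))//; first by rewrite mulr_gt0// exprn_gt0.
rewrite exprS EFinM -muleA lee_pmul//; first by rewrite lee_fin ltW.
  by rewrite lee_fin le_max lexx orbT.
exact: IH.
Qed.

(** The factor 4 is the one between the two balls of [countable_balls]; it also dominates the factor
    3 of the covering lemma. *)
Lemma doubling_times4 : exists2 C : R, (1 <= C)%R & forall (x : X) (r : R),
  (0 < r)%R -> mu (ball x (4 * r)%R) <= C%:E * mu (ball x r).
Proof.
have [C C1 HC] := doubling_iter; exists (C ^+ 2)%R; first exact: exprn_ege1.
by move=> x r r0; have := HC 2%N x r r0; rewrite -natrX.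
Qed.

(** Centres [y] run through a dense set and radii [q] through the rationals. With d(x,y) < s and 2s
    < q < 3s, one has B(x,s) in B(y,2s) in B(y,q) in B(x,4s). A countable family keeps the maximal
    functions measurable. *)
Lemma countable_balls : exists (c : nat -> X) (rho : nat -> R),
  (forall n, 0 < rho n)%R /\
  forall x s, (0 < s)%R -> exists n,
    ball x s `<=` ball (c n) (rho n) /\ ball (c n) (rho n) `<=` ball x (4 * s)%R.
Proof.
have [S cS dS] := doubling_separable hX.
pose D := S `*` [set q : rat | (0 < q)%R].
have /countable_injP[g ginj] : countable D by apply: countableX.
(* The default pair gives a positive radius to the indices outside the image of [g]. *)
pose e n := xget (point, 1%R) [set y | D y /\ g y = n].
exists (fun n => (e n).1), (fun n => ratr (e n).2); split.
  move=> n; rewrite ltr0q /e.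
  by case: xgetP => [y -> [[_ ]]|_] //=.
move=> x s s0.
have [y [xy Sy]] : ball x s `&` S !=set0.
  by apply: dS; [exists x; exact: metric_ballxx|exact: open_metric_ball].
have /rat_in_itvoo[q] : (2 * s < 3 * s)%R by rewrite ltr_pM2r// ltr_nat.
rewrite in_itv/= => /andP[q2 q3].
have q0 : (0 < q)%R by rewrite -(ltr0q R) (lt_trans _ q2)// mulr_gt0.
have Dyq : D (y, q) by [].
exists (g (y, q)).
have -> : e (g (y, q)) = (y, q).
  rewrite /e; case: xgetP => [z -> [Dz /ginj]|/(_ (y, q))[]//].
  by rewrite !inE => ->.
split => z /= xz.
  apply: (le_ball (ltW q2)); rewrite (_ : 2 * s = s + s)%R; last by lra.
  by apply: ball_triangle xz; exact: ball_sym.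
apply: (@le_ball _ _ _ (s + ratr q)%R); first by lra.
exact: ball_triangle xz.
Qed.

(** Volume count: the balls of radius t/2 around separated points are disjoint and lie in B(x,M+t),
    while by doubling each has at least the fraction C^-k of the measure of B(x,M+t). *)
Lemma separated_size_bound (x : X) (M t : R) : (0 < M)%R -> (0 < t)%R ->
  exists N : nat, forall s : seq X,
    (forall y, y \in s -> ball x M y) ->
    pairwise (fun y z => ~~ `[< ball y t z >]) s -> (size s <= N)%N.
Proof.
move=> M0 t0; have [C C1 HC] := doubling_iter.
have t20 : (0 < t / 2)%R by rewrite divr_gt0.
(* A ball of radius 2M + t around any point of B(x,M) contains B(x,M+t). *)
have [k kM] : exists k, (2 * M + t <= 2 ^+ k * (t / 2))%R.
  have [k _ /(_ k) /= kM] : \forall n \near \oo, ((2 * M + t) / (t / 2) <= 2 ^+ n)%R.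
    near=> n; rewrite (@le_trans _ _ n%:R)//.
      by near: n; exact: nbhs_infty_ger.
    by rewrite -natrX ler_nat ltnW// ltn_expl.
  by exists k; rewrite -ler_pdivrMr//; exact: kM.
have C0 : (0 < C)%R := lt_le_trans ltr01 C1.
pose V := fine (mu (ball x (M + t)%R)).
have Mt0 : (0 < M + t)%R by rewrite addr_gt0.
have VE : mu (ball x (M + t)%R) = V%:E by rewrite fineK// ball_measure_fin.
have V0 : (0 < V)%R by rewrite -lte_fin -VE ball_measure_gt0.
exists (Num.truncn (C ^+ k)%R) => s sM ps.
have H y : ball x M y -> V%:E <= (C ^+ k)%:E * mu (ball y (t / 2)%R).
  move=> xy; rewrite -VE; apply: le_trans (HC k y _ t20).
  apply: le_measure; rewrite ?inE; [exact: measurable_metric_ball..|].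
  move=> z xz; apply: (le_ball kM); rewrite (_ : 2 * M + t = M + (M + t))%R; last by lra.
  by apply: ball_triangle xz; exact: ball_sym.
have big : \sum_(y <- s) mu (ball y (t / 2)%R) <= V%:E.
  have mU r : measurable (\big[setU/set0]_(y <- r) ball y (t / 2)%R).
    by apply: bigsetU_measurable => ? _; exact: measurable_metric_ball.
  suff -> : \sum_(y <- s) mu (ball y (t / 2)%R) =
      mu (\big[setU/set0]_(y <- s) ball y (t / 2)%R).
    rewrite -VE; apply: le_measure; rewrite ?inE//; first exact: measurable_metric_ball.
    rewrite -bigcup_seq => z [y /= /sM xy yz].
    apply: (@le_ball _ _ _ (M + t / 2)%R); first by lra.
    exact: ball_triangle yz.
  elim: s ps {sM} => [|a s IH] /=; first by rewrite !big_nil measure0.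
  move=> /andP[/allP as_ ps]; rewrite !big_cons measureU; last 3 first.
  - exact: measurable_metric_ball.
  - exact: mU.
  - rewrite -bigcup_seq setI_bigcupr; apply: bigcup0 => y /= /as_ /asboolPn aty.
    rewrite -subset0 => z [az yz]; apply: aty.
    by rewrite [t]splitr; apply: ball_triangle az _; exact: ball_sym.
  by rewrite IH.
rewrite truncn_ge_nat; last by rewrite exprn_ge0 ?ltW.
rewrite -(ler_pM2r V0) -lee_fin !EFinM.
apply: (@le_trans _ _ (\sum_(y <- s) V%:E)).
  elim: (s) => [|a r IH]; first by rewrite big_nil mul0e.
  rewrite big_cons /= -natr1 EFinD muleDl// mul1e addeC; exact: leeD2l.
apply: (@le_trans _ _ (\sum_(y <- s) (C ^+ k)%:E * mu (ball y (t / 2)%R))).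
  by rewrite big_seq [leRHS]big_seq; apply: lee_sum => y /sM; exact: H.
rewrite -ge0_sume_distrr//.
by apply: lee_wpmul2l big; rewrite lee_fin exprn_ge0// ltW.
Unshelve. all: by end_near. Qed.

(* A maximal t-separated subset of the ball. *)
Lemma ball_totally_bounded (x : X) (M t : R) : (0 < t)%R ->
  exists s : seq X, forall z, ball x M z -> exists2 y, y \in s & ball y t z.
Proof.
move=> t0; have [M0|M0] := leP M 0%R.
  exists [::] => z; rewrite ballEmdist/= => /lt_le_trans/(_ M0).
  by rewrite ltNge mdist_ge0.
have [N HN] := separated_size_bound x M0 t0.
pose P n := `[< exists s : seq X, [/\ size s = n, (forall y, y \in s -> ball x M y) &
  pairwise (fun y z => ~~ `[< ball y t z >]) s] >].
have exP : exists n, P n by exists 0%N; apply/asboolP; exists [::].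
have ubP n : P n -> (n <= N)%N.
  by move=> /asboolP[s [<- sM ps]]; exact: HN.
have [n /asboolP[s [sn sM ps]] nmax] := ex_maxnP exP ubP.
exists s => z xz; apply: contrapT => nz.
have /nmax : P n.+1.
  apply/asboolP; exists (z :: s); split => [|y|] /=; first by rewrite sn.
    by rewrite inE => /predU1P[->//|/sM].
  rewrite ps andbT; apply/allP => y ys; apply/asboolPn => zy.
  by apply: nz; exists y => //; exact: ball_sym.
by rewrite ltnn.
Qed.

Lemma bigcup_metric_balls (x : X) : \bigcup_n ball x n.+1%:R = [set: X].
Proof.
apply/seteqP; split => // y _; exists (Num.truncn (mdist x y)) => //.
by rewrite ballEmdist/= truncnS_gt.
Qed.

Lemma doubling_sigma_finite : sigma_finite [set: X] mu.
Proof.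
exists (fun n => ball point n.+1%:R); first by rewrite bigcup_metric_balls.
move=> n; split; first exact: measurable_metric_ball.
by have /andP[] := doubling_ball hX point (ltr0Sn R n).
Qed.

(** Outer regularity is an equality of measures, which says nothing about U \ A when A has infinite
    measure. Hence A is cut by balls and the n-th piece is approximated up to e / 2^(n+1). *)
Lemma outer_regular_diff (A : set X) (e : R) : measurable A -> (0 < e)%R ->
  exists U, [/\ open U, A `<=` U & mu (U `\` A) <= e%:E].
Proof.
move=> mA e0; have [_ outer _] := doubling_radon hX.
pose An n := A `&` ball point n.+1%:R.
have mAn n : measurable (An n).
  by apply: measurableI => //; exact: measurable_metric_ball.
have Anfin n : mu (An n) \is a fin_num.
  rewrite ge0_fin_numE//; apply: le_lt_trans (measureIr mu mA _) _.
    exact: measurable_metric_ball.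
  by rewrite -ge0_fin_numE// ball_measure_fin.
have /choice[U HU] : forall n, exists U, [/\ open U, An n `<=` U &
    mu (U `\` An n) <= (e / (2 ^ n.+1)%:R)%:E].
  move=> n; have en0 : (0 < e / (2 ^ n.+1)%:R)%R by rewrite divr_gt0// ltr0n expn_gt0.
  have := outer _ (mAn n); set S := (X in ereal_inf X) => E.
  have [|_ [U /= [oU AU] <-]] := @lb_ereal_inf_adherent R S _ en0.
    by rewrite -E.
  rewrite -E => lt; exists U; split => //.
  rewrite measureD; [|exact: open_borel|exact: mAn|].
    by rewrite setIidr// leeBlDl ?Anfin//; exact: ltW.
  by apply: lt_trans lt _; rewrite ltey_eq fin_numD Anfin.
exists (\bigcup_n U n); split.
- by apply: bigcup_open => n _; have [] := HU n.
- move=> x Ax; have : (\bigcup_n ball point n.+1%:R) x by rewrite bigcup_metric_balls.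
  by move=> [n _ nx]; exists n => //; have [_ + _] := HU n; apply; split.
- apply: (@le_trans _ _ (\sum_(n <oo) mu (U n `\` An n))).
    apply: measure_sigma_subadditive => //.
    + by move=> n; apply: measurableD => //; apply: open_borel; have [] := HU n.
    + apply: measurableD => //; apply: open_borel.
      by apply: bigcup_open => n _; have [] := HU n.
    + move=> x [[n _ nx] Ax]; exists n => //; split => // -[].
      by move=> /Ax.
  apply: le_trans (_ : \sum_(n <oo) (e / (2 ^ n.+1)%:R)%:E <= _).
    by apply: lee_nneseries => // n _; have [] := HU n.
  exact: epsilon_trick0 (ltW e0).
Qed.

(** Supplies the Radon condition for the weights [u] constructed below. Since u mu is at most mu,
    the error sets of the approximation for mu have no larger mass. For inner regularity the open
    set is first cut by balls, so that its mu-measure is finite. *)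
Lemma radon_density_le1 (u : X -> R) : measurable_fun [set: X] u ->
  (forall x, 0 < u x <= 1)%R -> radon (fun A => \int[mu]_(x in A) (u x)%:E).
Proof.
move=> meas_u u01; have [muK outer inner] := doubling_radon hX.
have u0 x : 0 <= (u x)%:E by rewrite lee_fin ltW//; have /andP[] := u01 x.
have mue : measurable_fun [set: X] (EFin \o u) by exact/measurable_EFinP.
pose nu : {measure set X -> \bar R} := density mu u0 mue.
have numu A : measurable A -> nu A <= mu A.
  move=> mA; rewrite /nu /= densityE -[leRHS]mul1e -integral_cst//.
  apply: ge0_le_integral => //; first exact: measurable_funTS.
  by move=> x _; rewrite lee_fin; have /andP[] := u01 x.
have nuD A B : measurable A -> measurable B -> A `<=` B -> nu B <= nu A + mu (B `\` A).
  move=> mA mB AB; rewrite -{1}(setDUK AB) measureU//.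
  + by apply: leeD2l; apply: numu; exact: measurableD.
  + exact: measurableD.
  + by apply/disjoints_subset => x Ax [].
rewrite (_ : (fun A => _) = nu)//; split.
- move=> K cK; apply: le_lt_trans (muK _ cK); apply: numu.
  rewrite -(setCK K); apply: measurableC; apply: open_borel; apply: closed_openC.
  exact: compact_closed (@metric_hausdorff _ X) cK.
- move=> A mA; apply/eqP; rewrite eq_le; apply/andP; split.
    apply: le_ereal_inf_tmp => _ [U [oU AU] <-].
    by apply: le_measure => //; rewrite inE//; exact: open_borel.
  apply/lee_addgt0Pr => e e0.
  have [U [oU AU Ue]] := outer_regular_diff mA e0.
  apply: (@le_trans _ _ (nu U)); first by apply: ereal_inf_lbound; exists U.
  apply: le_trans (nuD _ _ mA (open_borel oU) AU) _.
  exact: leeD2l.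
- move=> U oU; apply/eqP; rewrite eq_le; apply/andP; split; last first.
    apply: ge_ereal_sup => _ [K [cK KU] <-].
    apply: le_measure => //; rewrite inE; last exact: open_borel.
    rewrite -(setCK K); apply: measurableC; apply: open_borel; apply: closed_openC.
    exact: compact_closed (@metric_hausdorff _ X) cK.
  pose Un n := U `&` ball point n.+1%:R.
  have oUn n : open (Un n) by apply: openI => //; exact: open_metric_ball.
  have UE : U = \bigcup_n Un n.
    by rewrite /Un -setI_bigcupr bigcup_metric_balls setIT.
  have cv : nu \o Un @ \oo --> nu (\bigcup_n Un n).
    apply: nondecreasing_cvg_mu => //; first by move=> n; exact: open_borel.
      by rewrite -UE; exact: open_borel.
    move=> i j ij; apply/subsetPset; apply: setIS; apply: le_ball.
    by rewrite ler_nat.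
  rewrite {1}UE -(cvg_lim _ cv)//; apply: lime_le; first by apply/cvg_ex; eexists; exact: cv.
  apply: nearW => n; apply/lee_addgt0Pr => e e0.
  have fin : mu (Un n) \is a fin_num.
    rewrite ge0_fin_numE//; apply: le_lt_trans (measureIr mu _ _) _; [exact: open_borel|..].
      exact: measurable_metric_ball.
    by rewrite -ge0_fin_numE// ball_measure_fin.
  have := inner _ (oUn n); set S := (X in ereal_sup X) => E.
  have [|_ [K /= [cK KU] <-]] := @ub_ereal_sup_adherent R S _ e0; first by rewrite -E.
  rewrite -E => lt.
  have mK : measurable K.
    rewrite -(setCK K); apply: measurableC; apply: open_borel; apply: closed_openC.
    exact: compact_closed (@metric_hausdorff _ X) cK.
  apply: (@le_trans _ _ (nu K + e%:E)); last first.
    rewrite leeD2r//; apply: ereal_sup_ubound; exists K => //; split => //.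
    by apply: subset_trans KU _; exact: subIsetl.
  apply: le_trans (nuD _ _ mK (open_borel (oUn n)) KU) _.
  apply: leeD2l; rewrite measureD//; [|exact: open_borel|].
    rewrite setIidr// leeBlDr//; last first.
      by rewrite ge0_fin_numE//; exact: muK.
    rewrite addeC -leeBlDr//; exact: ltW.
  by rewrite -ge0_fin_numE.
Qed.

End doubling_geometry.

(** * Maximal operators over a countable family of balls *)

Section maximal_operators.
Context d (R : realType) (X : borelMetricType d R).
Variable mu : {measure set X -> \bar R}.
Hypothesis hX : doubling_space mu.
Variables (c : nat -> X) (rho : nat -> R) (C : R).
Hypothesis rho0 : forall n, (0 < rho n)%R.
Hypothesis C1 : (1 <= C)%R.
Hypothesis hC : forall (x : X) (r : R), (0 < r)%R -> mu (ball x (4 * r)%R) <= C%:E * mu (ball x r).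

Local Notation B n := (ball (c n) (rho n)).
Local Notation B3 n := (ball (c n) (3 * rho n)%R).
Local Notation m n := (fine (mu (B n))).

(** The coefficients are arbitrary, so that plain averages, averages with respect to [tau] and
    ratios of masses are all covered. A superlevel set at a nonnegative level is a union of balls of
    the family, the input of the covering lemma. *)
Definition sup_balls (a : nat -> \bar R) (x : X) : \bar R :=
  ereal_sup [set a n * (\1_(B n) x)%:E | n in [set: nat]].

Lemma measurable_B n : measurable (B n).
Proof. exact: measurable_metric_ball. Qed.

Lemma sup_balls_gtP a (l : R) x : (0 <= l)%R ->
  l%:E < sup_balls a x <-> exists n, B n x /\ l%:E < a n.
Proof.
move=> l0; split.
  move=> /ereal_sup_gt[_ [n _ <-]]; rewrite indicE.
  have [nx|nx] := pselect (B n x); last by rewrite memNset// mule0 lte_fin ltNge l0.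
  by rewrite mem_set// mule1 => la; exists n.
move=> [n [nx la]]; apply: lt_le_trans la _; apply: ereal_sup_ubound; exists n => //.
by rewrite indicE mem_set// mule1.
Qed.

Lemma sup_balls_superlevel a (l : R) : (0 <= l)%R ->
  [set x | l%:E < sup_balls a x] = \bigcup_(n in [set n | l%:E < a n]) B n.
Proof.
move=> l0; apply/seteqP; split => x /=.
  by move=> /(sup_balls_gtP _ _ l0)[n [nx la]]; exists n.
by move=> [n /= la nx]; apply/(sup_balls_gtP _ _ l0); exists n.
Qed.

Lemma sup_balls_ub a n x : B n x -> a n <= sup_balls a x.
Proof.
move=> nx; apply: ereal_sup_ubound; exists n => //.
by rewrite indicE mem_set// mule1.
Qed.

Lemma sup_balls_ge0 a x : (forall n, 0 <= a n) -> 0 <= sup_balls a x.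
Proof.
move=> a0; apply: le_trans (ereal_sup_ubound _); last by exists 0%N.
by rewrite mule_ge0// lee_fin.
Qed.

Lemma measurable_sup_balls a : (forall n, 0 <= a n) ->
  measurable_fun [set: X] (sup_balls a).
Proof.
move=> a0; apply: (measurability _ (ErealGenOInfty.measurableE R)).
move=> _ [_ [r ->] <-]; rewrite setTI.
rewrite (_ : _ @^-1` _ = [set x | r%:E < sup_balls a x]); last first.
  by apply/seteqP; split => x /=; rewrite in_itv/= andbT.
have [r0|r0] := leP 0%R r.
  by rewrite sup_balls_superlevel//; apply: bigcup_measurable => n _; exact: measurable_B.
rewrite (_ : [set x | _] = setT)//; apply/seteqP; split => // x _ /=.
by apply: lt_le_trans (sup_balls_ge0 x a0); rewrite lte_fin.
Qed.

Lemma ball_mass n : mu (B n) = (m n)%:E /\ (0 < m n)%R.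
Proof.
have E : mu (B n) = (m n)%:E by rewrite fineK// (ball_measure_fin hX).
by split => //; rewrite -lte_fin -E (ball_measure_gt0 hX).
Qed.

Definition average (F : X -> \bar R) (n : nat) : \bar R :=
  ((m n)^-1)%:E * \int[mu]_(y in B n) F y.

Lemma average_ge0 F n : (forall x, 0 <= F x) -> 0 <= average F n.
Proof.
move=> F0; by rewrite mule_ge0//; exact: integral_ge0.
Qed.

(** A ball that contributes to the superlevel set satisfies l mu(B) < int_B F, and mu(3B) <= mu(4B)
    <= C mu(B), so the covering lemma applies with [kap] of density (C / l) F. *)
Lemma weak_type_maximal (F : X -> \bar R) (l : R) :
  measurable_fun [set: X] F -> (forall x, 0 <= F x) -> (0 < l)%R ->
  mu [set x | l%:E < sup_balls (average F) x] <= (C / l)%:E * \int[mu]_x F x.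
Proof.
move=> mF F0 l0; have Cl0 : (0 <= C / l)%R.
  by rewrite divr_ge0// ?(ltW l0)// (le_trans ler01 C1).
rewrite sup_balls_superlevel; last exact: ltW.
have F'0 x : 0 <= (C / l)%:E * F x by rewrite mule_ge0.
have mF' : measurable_fun [set: X] (fun x => (C / l)%:E * F x).
  exact: measurable_funeM.
rewrite -ge0_integralZl//.
pose kap : {measure set X -> \bar R} := density mu F'0 mF'.
apply: (vitali_measure (nu := mu) (kap := kap)) => // n /=.
rewrite /average lte_pdivlMl; last by have [] := ball_mass n.
move=> H; rewrite /kap densityE ge0_integralZl//; [|exact: measurable_B|exact: measurable_funTS].
apply: (@le_trans _ _ (C%:E * mu (B n))).
  apply: le_trans (hC (c n) (rho0 n)); apply: le_measure; rewrite ?inE.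
  - exact: measurable_metric_ball.
  - exact: measurable_metric_ball.
  - by apply: le_ball; rewrite ler_pM2r// ler_nat.
rewrite EFinM -muleA lee_pmul//; first by rewrite lee_fin (le_trans ler01 C1).
by rewrite lee_pdivlMl// (ball_mass n).1 muleC ltW.
Qed.

(** B(x,s) is replaced by a ball B of the family between B(x,s) and B(x,4s). Doubling bounds mu(B)
    by C mu(B(x,s)); the lower bound [b] of [psi] is spent on B(x,s), which lies in B(x,r), before
    the domain of integration grows to B. *)
Lemma local_HL_le_sup_balls (psi f : X -> R) (b r : R) (x : X) :
  (forall x s, (0 < s)%R -> exists n, ball x s `<=` B n /\ B n `<=` ball x (4 * s)%R) ->
  measurable_fun [set: X] psi -> measurable_fun [set: X] f ->
  (forall y, 0 <= psi y)%R -> (0 < b)%R -> (forall y, ball x r y -> b <= psi y)%R ->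
  local_HL_maximal mu r f x <=
    (C / b)%:E * sup_balls (average (fun y => (psi y * `|f y|)%:E)) x.
Proof.
move=> cover mpsi mf psi0 b0 bpsi; apply: ge_ereal_sup => _ [s /andP[s0 sr] <-].
have F0 y : 0 <= (psi y * `|f y|)%:E by rewrite lee_fin mulr_ge0.
have mF : measurable_fun [set: X] (fun y => (psi y * `|f y|)%:E).
  by apply/measurable_EFinP; apply: measurable_funM => //; exact: measurableT_comp.
have mabsf : measurable_fun [set: X] (fun y => `|(f y)%:E|).
  by apply: measurableT_comp => //; exact/measurable_EFinP.
have C0 : (0 < C)%R := lt_le_trans ltr01 C1.
have [n [xn nx]] := cover x s s0.
apply: le_trans (lee_wpmul2l _ (sup_balls_ub _ (xn _ (metric_ballxx x s0)))); last first.
  by rewrite lee_fin divr_ge0// ltW.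
have [E m0] := ball_mass n.
have xs0 := ball_measure_gt0 hX x s0; have xsfin := ball_measure_fin hX x s0.
have V0 : (0 < fine (mu (ball x s)))%R by rewrite -lte_fin fineK.
rewrite -(fineK xsfin) inver gt_eqF// lee_pdivrMl//.
apply: (@le_trans _ _ (b^-1%:E * \int[mu]_(y in B n) (psi y * `|f y|)%:E)).
  rewrite lee_pdivlMl// -ge0_integralZl//; last 3 first.
  - exact: measurable_metric_ball.
  - exact: measurable_funTS.
  - exact: ltW.
  apply: (@le_trans _ _ (\int[mu]_(y in ball x s) (psi y * `|f y|)%:E)).
    apply: ge0_le_integral => //.
    - exact: measurable_metric_ball.
    - by move=> y _; rewrite mule_ge0// lee_fin ltW.
    - by apply: measurable_funTS; exact: measurable_funeM.
    - exact: measurable_funTS.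
    - move=> y xy; rewrite -EFinM lee_fin ler_wpM2r//.
      by apply: bpsi; apply: (le_ball (ltW sr)).
  apply: ge0_subset_integral => //; [exact: measurable_metric_ball|exact: measurable_B|].
  exact: measurable_funTS.
rewrite /average !muleA; apply: lee_wpmul2r; first exact: integral_ge0.
rewrite -!EFinM lee_fin [leRHS](_ : _ = b^-1 * (fine (mu (ball x s)) * C / m n))%R; last by field; lra.
rewrite ler_pMr ?invr_gt0// ler_pdivlMr// mul1r [leRHS]mulrC -lee_fin -E EFinM (fineK xsfin).
apply: le_trans (hC x s0); apply: le_measure; rewrite ?inE//.
- exact: measurable_B.
- exact: measurable_metric_ball.
Qed.

(** * Averages with respect to a finite measure that need not be doubling *)

Section weighted.
Variable tau : X -> R.
Hypotheses (mtau : measurable_fun [set: X] tau) (tau0 : forall x, (0 < tau x)%R).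
Hypothesis itau : \int[mu]_x (tau x)%:E < +oo.

Let tau_ge0 x : 0 <= (tau x)%:E. Proof. by rewrite lee_fin ltW. Qed.
Let mtauE : measurable_fun [set: X] (fun x => (tau x)%:E).
Proof. exact/measurable_EFinP. Qed.

Let mB3 n : measurable (B3 n). Proof. exact: measurable_metric_ball. Qed.

Definition wmass n : R := fine (\int[mu]_(y in B3 n) (tau y)%:E).

Lemma wmassE n : \int[mu]_(y in B3 n) (tau y)%:E = (wmass n)%:E /\ (0 < wmass n)%R.
Proof.
have fin : \int[mu]_(y in B3 n) (tau y)%:E \is a fin_num.
  rewrite ge0_fin_numE; last exact: integral_ge0.
  by apply: le_lt_trans itau; exact: ge0_subset_integral.
split; first by rewrite fineK.
rewrite -lte_fin fineK// lt0e integral_ge0// andbT; apply/negP => /eqP I0.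
have mtauB : measurable_fun (B3 n) (fun x => (tau x)%:E) by exact: measurable_funTS.
have /(ae_eq_integral_abs mu (mB3 n) mtauB)[N [mN N0 sub]] :
    \int[mu]_(y in B3 n) `|(tau y)%:E| = 0.
  by rewrite -[RHS]I0; apply: eq_integral => y _; rewrite gee0_abs.
have : mu (B3 n) <= mu N.
  apply: le_measure; rewrite ?inE// => y By; apply: sub => /(_ By) /eqP.
  by rewrite eqe gt_eqF.
by rewrite N0 leNgt (ball_measure_gt0 hX)// mulr_gt0.
Qed.

Definition wratio n : \bar R := (wmass n / m n)%:E.

(** The integral is over B but the mass is that of 3B: this normalisation makes the covering lemma
    applicable to the measure [tau] mu. *)
Definition waverage (g : X -> R) n : \bar R :=
  (wmass n)^-1%:E * \int[mu]_(y in B n) (g y * tau y)%:E.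

Lemma wratio_ge0 n : 0 <= wratio n.
Proof.
have [_ w0] := wmassE n; have [_ m0] := ball_mass n.
by rewrite lee_fin divr_ge0// ltW.
Qed.

Lemma waverage_ge0 g n : (forall y, 0 <= g y)%R -> 0 <= waverage g n.
Proof.
move=> g0; rewrite mule_ge0//.
  by rewrite lee_fin invr_ge0 ltW//; have [] := wmassE n.
by apply: integral_ge0 => y _; rewrite lee_fin mulr_ge0// ltW.
Qed.

(** On each ball tau(3B) cancels between the two factors, and a supremum of products is at most the
    product of the suprema. *)
Lemma sup_balls_factor (g : X -> R) x : (forall y, 0 <= g y)%R ->
  sup_balls (average (fun y => (g y * tau y)%:E)) x <=
  sup_balls (waverage g) x * sup_balls wratio x.
Proof.
move=> g0; apply: ge_ereal_sup => _ [n _ <-]; rewrite indicE.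
have ge0 := mule_ge0 (sup_balls_ge0 x (fun n => waverage_ge0 n g0)) (sup_balls_ge0 x wratio_ge0).
have [nx|nx] := pselect (B n x); last by rewrite memNset// mule0; exact: ge0.
rewrite mem_set// mule1.
apply: le_trans (lee_pmul (waverage_ge0 n g0) (wratio_ge0 n)
  (sup_balls_ub _ nx) (sup_balls_ub _ nx)).
have [_ w0] := wmassE n; have [_ m0] := ball_mass n.
rewrite /average /waverage /wratio muleAC -EFinM.
have e : ((wmass n)^-1 * (wmass n / m n) = (m n)^-1)%R by field; rewrite !gt_eqF.
by rewrite e.
Qed.

(** The covering lemma is applied to the tripled balls, on which l mu(B) < tau(3B). Tripling once
    more gives mu(9B) <= mu(16B) <= C^2 mu(B), whence the square. *)
Lemma weak_type_wratio (l : R) : (0 < l)%R ->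
  mu [set x | l%:E < sup_balls wratio x] <= (C ^+ 2 / l)%:E * \int[mu]_x (tau x)%:E.
Proof.
move=> l0; have Cl0 : (0 <= C ^+ 2 / l)%R.
  by rewrite divr_ge0// ?(ltW l0)// exprn_ge0// (le_trans ler01 C1).
have F'0 x : 0 <= (C ^+ 2 / l)%:E * (tau x)%:E by rewrite mule_ge0.
have mF' : measurable_fun [set: X] (fun x => (C ^+ 2 / l)%:E * (tau x)%:E).
  exact: measurable_funeM.
rewrite sup_balls_superlevel; last exact: ltW.
rewrite -ge0_integralZl//.
pose kap : {measure set X -> \bar R} := density mu F'0 mF'.
apply: (@le_trans _ _ (mu (\bigcup_(n in [set n | l%:E < wratio n]) B3 n))).
  apply: le_measure; rewrite ?inE; [by apply: bigcup_measurable => n _; exact: measurable_B|exact: bigcup_measurable|].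
  move=> x [n Hn nx]; exists n => //; apply: le_ball nx.
  by rewrite ler_peMl ?ltW// ltr1n.
apply: (vitali_measure (nu := mu) (kap := kap) (rho := fun n => 3 * rho n)%R) => [n|n /=].
  by rewrite mulr_gt0.
have [W w0] := wmassE n; have [E m0] := ball_mass n.
rewrite /wratio lte_fin ltr_pdivlMr// => H.
rewrite /kap densityE ge0_integralZl//; last exact: measurable_funTS.
rewrite W; apply: (@le_trans _ _ ((C ^+ 2)%:E * mu (B n))).
  apply: (@le_trans _ _ (mu (ball (c n) (4 * (4 * rho n))%R))).
    apply: le_measure; rewrite ?inE; [exact: measurable_metric_ball..|].
    by apply: le_ball; rewrite !mulrA ler_pM2r// -!natrM ler_nat.
  rewrite (le_trans (hC _ _))//; first by rewrite mulr_gt0.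
  rewrite expr2 EFinM -muleA lee_pmul//; first by rewrite lee_fin (le_trans ler01 C1).
  exact: hC.
rewrite E -!EFinM lee_fin -[leRHS]mulrA ler_wpM2l ?exprn_ge0 ?(le_trans ler01 C1)//.
by rewrite ler_pdivlMl// ltW.
Qed.

(** Where g <= l/2 the integrand adds at most (l/2) tau(B) <= (l/2) tau(3B), half of what the
    superlevel condition demands; the part with g > l/2 must supply the other half. The covering
    lemma for [tau] mu then costs no further constant. Interpolation relies on the truncation of the
    right-hand side. *)
Lemma weak_type_waverage (g : X -> R) (l : R) :
  measurable_fun [set: X] g -> (forall y, 0 <= g y)%R -> (0 < l)%R ->
  \int[mu]_(x in [set x | l%:E < sup_balls (waverage g) x]) (tau x)%:E <=
  (2 / l)%:E * \int[mu]_x ((g x * tau x) * (l / 2 < g x)%R%:R)%:E.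
Proof.
move=> mg g0 l0.
pose h x := ((g x * tau x) * (l / 2 < g x)%R%:R)%:E.
have l20 : (0 <= 2 / l)%R by rewrite divr_ge0// ltW.
have h0 x : 0 <= h x by rewrite lee_fin !mulr_ge0// ltW.
have mgt : measurable_fun [set: X] (fun x => (g x * tau x)%R) by exact: measurable_funM.
have mh : measurable_fun [set: X] h.
  apply/measurable_EFinP; apply: measurable_funM => //.
  by apply: measurable_natr_pred; exact: measurable_set_ltr.
rewrite sup_balls_superlevel; last exact: ltW.
have h'0 x : 0 <= (2 / l)%:E * h x by rewrite mule_ge0.
have mh' : measurable_fun [set: X] (fun x => (2 / l)%:E * h x).
  exact: measurable_funeM.
rewrite -ge0_integralZl//; last by move=> x _; exact: h0.
pose kap : {measure set X -> \bar R} := density mu h'0 mh'.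
pose nu : {measure set X -> \bar R} := density mu tau_ge0 mtauE.
apply: (vitali_measure (nu := nu) (kap := kap)) => // n /=.
have [W w0] := wmassE n.
rewrite /waverage lte_pdivlMl// /nu /kap !densityE W => H.
rewrite ge0_integralZl//; [|exact: measurable_B|exact: measurable_funTS].
have : (wmass n * l)%:E < \int[mu]_(x in B n) h x + (l / 2 * wmass n)%:E.
  apply: lt_le_trans H _.
  apply: (@le_trans _ _ (\int[mu]_(x in B n) (h x + (l / 2)%:E * (tau x)%:E))).
    apply: ge0_le_integral => //.
    - exact: measurable_B.
    - by move=> x _; rewrite lee_fin mulr_ge0// ltW.
    - by apply: measurable_funTS; exact/measurable_EFinP.
    - apply: measurable_funTS; apply: emeasurable_funD => //.
      exact: measurable_funeM.
    - move=> x _; rewrite /h -EFinM -EFinD lee_fin; case: ltP => gl /=.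
        by rewrite mulr1 lerDl mulr_ge0// ?ltW// divr_gt0.
      by rewrite mulr0 add0r ler_wpM2r// ltW.
  have mB := measurable_B n.
  have mhB : measurable_fun (B n) h by exact: measurable_funTS.
  have mtB : measurable_fun (B n) (fun x => (l / 2)%:E * (tau x)%:E).
    by apply: measurable_funTS; exact: measurable_funeM.
  have t0 x : B n x -> 0 <= (l / 2)%:E * (tau x)%:E.
    by move=> _; rewrite mule_ge0// lee_fin divr_ge0// ltW.
  rewrite ge0_integralD//.
  apply: leeD2l; rewrite ge0_integralZl//; last 2 first.
  - exact: measurable_funTS.
  - by rewrite lee_fin divr_ge0// ltW.
  rewrite [leRHS]EFinM; apply: lee_wpmul2l; first by rewrite lee_fin divr_ge0// ltW.
  rewrite -W; apply: ge0_subset_integral => //; first exact: measurable_funTS.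
  by apply: le_ball; rewrite ler_peMl ?ltW// ltr1n.
have -> : (wmass n * l = l / 2 * wmass n + l / 2 * wmass n)%R by field.
rewrite EFinD lteD2rE// => /ltW H2.
by rewrite -[(2 / l)%R]invf_div lee_pdivlMl ?divr_gt0// -EFinM.
Qed.

End weighted.
End maximal_operators.

(** * Marcinkiewicz interpolation *)

Section dyadic_sums.
Context (R : realType).

(** The nonzero terms form a geometric progression of ratio 2^(p-1) > 1, so the sum is at most a
    multiple of its last term. The induction hypothesis serves only when the new term vanishes;
    otherwise all terms are present and the progression is summed directly. *)
Lemma dyadic_geometric_sum (N p y : R) (K : nat) :
  (0 < N)%R -> (1 < p)%R -> (0 <= y)%R ->
  (\sum_(k < K) (N * 2 ^+ k) `^ (p - 1) * (N * 2 ^+ k < y)%R%:R <=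
   2 `^ (p - 1) / (2 `^ (p - 1) - 1) * y `^ (p - 1))%R.
Proof.
move=> N0 p1 y0; set q := (p - 1)%R; have q0 : (0 < q)%R by rewrite subr_gt0.
set b := (2 `^ q)%R; have b1 : (1 < b)%R.
  by rewrite -(powRr0 2) /b /powR !gt_eqF// ltr_expR ltr_pM2r ?ln_gt0 ?ltr1n.
have b0 : (0 < b)%R := lt_trans ltr01 b1.
have bb1 : (0 < b - 1)%R by rewrite subr_gt0.
have E k : ((N * 2 ^+ k) `^ q = N `^ q * b ^+ k)%R.
  rewrite powRM ?ltW ?exprn_gt0// -powR_mulrn// powRAC.
  by rewrite powR_mulrn ?powR_ge0.
elim: K => [|K IH].
  by rewrite big_ord0 mulr_ge0 ?powR_ge0// divr_ge0 ?ltW.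
rewrite big_ord_recr/=; have [Ky|yK] := ltP (N * 2 ^+ K)%R y; last by rewrite mulr0 addr0.
rewrite mulr1 E.
apply: (@le_trans _ _ (b / (b - 1) * (N `^ q * b ^+ K))%R); last first.
  rewrite ler_wpM2l ?divr_ge0 ?(ltW b0) ?(ltW bb1)// -E.
  apply: ge0_ler_powR; rewrite ?nnegrE ?(ltW q0) ?(ltW Ky)//.
  by rewrite mulr_ge0 ?(ltW N0)// exprn_ge0.
have -> : (b / (b - 1) * (N `^ q * b ^+ K) =
   N `^ q * b ^+ K / (b - 1) + N `^ q * b ^+ K)%R by field; rewrite gt_eqF.
rewrite lerD2r.
have : forall L : nat, (\sum_(i < L) N `^ q * b ^+ i <= N `^ q * b ^+ L / (b - 1))%R.
  elim=> [|L IHL]; first by rewrite big_ord0 !mulr_ge0 ?powR_ge0 ?exprn_ge0 ?(ltW b0)// invr_ge0 ltW.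
  rewrite big_ord_recr/= (le_trans (lerD IHL (lexx _)))// exprS.
  by rewrite le_eqVlt; apply/orP; left; apply/eqP; field; rewrite gt_eqF.
move=> /(_ K); apply: le_trans; apply: ler_sum => i _; rewrite E.
by case: ltP => _; rewrite ?mulr1// mulr0 mulr_ge0 ?powR_ge0// exprn_ge0// ltW.
Qed.

(** A finite y > N lies in one interval (N 2^k, N 2^(k+1)], and that single term bounds y^p; for y =
    +oo the terms are unbounded. *)
Lemma dyadic_poweR_le (N p : R) (y : \bar R) : (0 < N)%R -> (1 < p)%R -> 0 <= y ->
  y `^ p <= (N `^ p)%:E +
    \sum_(k <oo) ((N * 2 ^+ k.+1) `^ p * ((N * 2 ^+ k)%:E < y)%E%:R)%:E.
Proof.
move=> N0 p1 y0; have p0 : (0 < p)%R := lt_trans ltr01 p1.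
set a := fun k : nat => ((N * 2 ^+ k.+1) `^ p * ((N * 2 ^+ k)%:E < y)%E%:R)%:E.
have a0 k : 0 <= a k by rewrite lee_fin mulr_ge0// powR_ge0.
have single k : a k <= \sum_(k <oo) a k.
  apply: (@le_trans _ _ (\sum_(0 <= i < k.+1) a i)); last first.
    by apply: nneseries_lim_ge => i *; exact: a0.
  rewrite big_nat_recr//= leeDr//; exact: sume_ge0.
have N2 (k : nat) : (0 < N * 2 ^+ k)%R by rewrite mulr_gt0// exprn_gt0.
have big (A : R) : exists k : nat, (A <= N * 2 ^+ k)%R.
  exists (Num.truncn (A / N)).+1; rewrite mulrC -ler_pdivrMr//.
  apply/ltW; apply: lt_trans (truncnS_gt _) _.
  by rewrite -natrX ltr_nat ltn_expl.
have [yN|Ny] := leP y N%:E.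
  apply: (@le_trans _ _ (N `^ p)%:E); last first.
    by rewrite leeDl//; apply: nneseries_ge0 => *; exact: a0.
  case: y y0 yN {a a0 single} => // y; rewrite !lee_fin => y0 yN.
  by apply: ge0_ler_powR; rewrite ?nnegrE ?(ltW p0) ?(ltW N0).
apply: le_trans (leeDr _ _); last by rewrite lee_fin powR_ge0.
case: y y0 Ny @a a0 single => [y| |]// y0 Ny a a0 single; last first.
  rewrite poweRyr ?gt_eqF// leye_eq; apply/eqP/eqyP => A A0.
  have [k kA] := big A.
  (* The second index makes N 2^(m+1) at least 1, so that it is at most its p-th power. *)
  apply: le_trans (single (maxn k (Num.truncn N^-1).+1)); rewrite /a ltry mulr1 lee_fin.
  set m := maxn _ _.
  apply: (@le_trans _ _ (N * 2 ^+ m)%R).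
    by rewrite (le_trans kA)// ler_pM2l// ler_weXn2l ?ler1n// leq_maxl.
  apply: (@le_trans _ _ (N * 2 ^+ m.+1)%R).
    by rewrite ler_pM2l// ler_weXn2l ?ler1n.
  apply: le1r_powR; last exact: ltW.
  rewrite mulrC -ler_pdivrMr// mul1r.
  apply/ltW; apply: lt_le_trans (truncnS_gt _) _.
  rewrite -natrX ler_nat (leq_trans (leq_maxr k _))// -/m.
  by rewrite (leq_trans (ltnW (ltn_expl m (ltnSn 1))))// leq_exp2l.
rewrite lte_fin in Ny.
have ex : exists k : nat, (y <= N * 2 ^+ k)%R by exact: big.
have [m ym mmin] := ex_minnP ex.
case: m ym mmin => [|m] ym mmin; first by move: ym; rewrite expr0 mulr1 leNgt Ny.
apply: le_trans (single m); rewrite /a lte_fin.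
have -> : (N * 2 ^+ m < y)%R by rewrite ltNge; apply/negP => /mmin; rewrite ltnn.
rewrite mulr1 lee_fin; apply: ge0_ler_powR; rewrite ?nnegrE ?(ltW p0) ?(ltW (N2 _))//.
Qed.

End dyadic_sums.

Section strong_type.
Context d (R : realType) (X : borelMetricType d R).
Variable mu : {measure set X -> \bar R}.
Hypothesis hX : doubling_space mu.
Variables (c : nat -> X) (rho : nat -> R).
Hypothesis rho0 : forall n, (0 < rho n)%R.
Variable tau : X -> R.
Hypotheses (mtau : measurable_fun [set: X] tau) (tau0 : forall x, (0 < tau x)%R).
Hypothesis itau : \int[mu]_x (tau x)%:E < +oo.

Local Notation M g := (sup_balls c rho (waverage mu c rho tau g)).

(* The scale N of the dyadic levels is arbitrary, and is sent to 0. *)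
Lemma strong_type_waverage (p : R) : (1 < p)%R -> exists2 K : R, (0 <= K)%R &
  forall g : X -> R, measurable_fun [set: X] g -> (forall y, 0 <= g y)%R ->
  \int[mu]_x ((M g x) `^ p * (tau x)%:E) <=
  K%:E * \int[mu]_x (g x `^ p * tau x)%:E.
Proof.
move=> p1; have p0 : (0 < p)%R := lt_trans ltr01 p1.
set K0 := (2 `^ (p - 1) / (2 `^ (p - 1) - 1))%R.
have K00 : (0 <= K0)%R.
  have : (2 `^ 0 <= 2 `^ (p - 1) :> R)%R by rewrite ler_powR ?ler1n// subr_ge0 ltW.
  by rewrite powRr0 => b1; rewrite divr_ge0 ?powR_ge0// subr_ge0.
(* With q_k = N 2^k, the factor 2^(p+1) comes from q_(k+1)^p (2 / q_k), [K0] from summing q_k^(p-1)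
   over q_k < 2 g, and the last factor from (2 g)^(p-1). *)
pose K := (2 `^ (p + 1) * K0 * 2 `^ (p - 1))%R.
have K_ge0 : (0 <= K)%R by rewrite mulr_ge0 ?powR_ge0// mulr_ge0 ?powR_ge0.
exists K => //.
move=> g mg g0.
have M0 x : 0 <= M g x.
  by apply: sup_balls_ge0 => n; exact: waverage_ge0.
have mM : measurable_fun [set: X] (M g).
  by apply: measurable_sup_balls => // n; exact: waverage_ge0.
have mtauE : measurable_fun [set: X] (fun x => (tau x)%:E) by exact/measurable_EFinP.
have tau_ge0 x : 0 <= (tau x)%:E by rewrite lee_fin ltW.
have mMp : measurable_fun [set: X] (fun x => (M g x) `^ p).
  exact: (measurableT_comp (measurable_poweR _)).
have mMpt : measurable_fun [set: X] (fun x => (M g x) `^ p * (tau x)%:E).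
  exact: emeasurable_funM.
have mlev (l : R) : measurable [set x | l%:E < M g x].
  by have := emeasurable_fun_o_infty measurableT mM l%:E; rewrite setTI.
pose I := \int[mu]_x (tau x)%:E.
have Ifin : I \is a fin_num by rewrite ge0_fin_numE//; exact: integral_ge0.
suff main (N : R) : (0 < N)%R ->
    \int[mu]_x ((M g x) `^ p * (tau x)%:E) <=
    (N `^ p)%:E * I + K%:E * \int[mu]_x (g x `^ p * tau x)%:E.
  apply/lee_addgt0Pr => e e0; rewrite addeC.
  have I0 : (0 <= fine I)%R by rewrite fine_ge0//; exact: integral_ge0.
  (* At this scale N^p times the total mass of [tau] is less than [e]. *)
  pose N := ((e / (fine I + 1)) `^ p^-1)%R.
  have I1 : (0 < fine I + 1)%R by rewrite ltr_wpDl.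
  have N0 : (0 < N)%R by rewrite powR_gt0// divr_gt0.
  apply: le_trans (main N N0) _; apply: leeD2r.
  rewrite -powRrM mulVf ?gt_eqF// powRr1 ?divr_ge0 ?ltW//.
  rewrite -[X in _ * X < _](fineK Ifin) -EFinM lte_fin mulrAC ltr_pdivrMr//.
  by rewrite ltr_pM2l// ltrDl.
move=> N0.
pose q (k : nat) := (N * 2 ^+ k)%R.
have q0 k : (0 < q k)%R by rewrite mulr_gt0// exprn_gt0.
pose ind (k : nat) x : R := ((q k)%:E < M g x)%E%:R.
pose a k x : \bar R := (q k.+1 `^ p)%:E * ((ind k x)%:E * (tau x)%:E).
pose h k x : \bar R := ((g x * tau x) * (q k / 2 < g x)%R%:R)%:E.
pose b k : R := (q k.+1 `^ p * (2 / q k))%R.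
have mind k : measurable_fun [set: X] (fun x => (ind k x)%:E).
  by apply/measurable_EFinP; apply: measurable_natr_pred; exact: mlev.
have a0 k x : 0 <= a k x by rewrite !mule_ge0// lee_fin ?powR_ge0.
have ma k : measurable_fun [set: X] (a k).
  by apply: measurable_funeM; exact: emeasurable_funM.
have h0 k x : 0 <= h k x by rewrite lee_fin !mulr_ge0// ltW.
have mh k : measurable_fun [set: X] (h k).
  apply/measurable_EFinP; apply: measurable_funM; first exact: measurable_funM.
  by apply: measurable_natr_pred; exact: measurable_set_ltr.
have b0 k : (0 <= b k)%R by rewrite mulr_ge0 ?powR_ge0// divr_ge0// ltW.
have mbh k : measurable_fun [set: X] (fun x => (b k)%:E * h k x) by exact: measurable_funeM.
have bh0 k x : 0 <= (b k)%:E * h k x by apply: mule_ge0; [rewrite lee_fin; exact: b0|exact: h0].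
apply: (@le_trans _ _ (\int[mu]_x ((N `^ p)%:E * (tau x)%:E + \sum_(k <oo) a k x))).
  apply: ge0_le_integral => //.
  - by move=> x _; rewrite mule_ge0// poweR_ge0.
  - apply: emeasurable_funD; first exact: measurable_funeM.
    exact: ge0_emeasurable_sum.
  - move=> x _; apply: le_trans (lee_wpmul2r (tau_ge0 x) (dyadic_poweR_le N0 p1 (M0 x))) _.
    rewrite ge0_muleDl ?lee_fin ?powR_ge0//; last first.
      by apply: nneseries_ge0 => k _ _; rewrite lee_fin mulr_ge0// powR_ge0.
    apply: leeD2l; rewrite muleC -nneseriesZl//; last first.
      by move=> k _; rewrite lee_fin mulr_ge0// powR_ge0.
    apply: lee_nneseries => [k _ _|k _].
      by rewrite mule_ge0// lee_fin mulr_ge0// powR_ge0.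
    by rewrite muleC EFinM -muleA.
rewrite ge0_integralD//; last 4 first.
- by move=> x _; rewrite mule_ge0// lee_fin powR_ge0.
- exact: measurable_funeM.
- by move=> x _; exact: nneseries_ge0.
- exact: ge0_emeasurable_sum.
rewrite ge0_integralZl//; last by rewrite lee_fin powR_ge0.
apply: leeD2l; rewrite integral_nneseries//.
apply: (@le_trans _ _ (\sum_(k <oo) \int[mu]_x ((b k)%:E * h k x))).
  apply: lee_nneseries => [k _ _|k _].
    by apply: integral_ge0 => x _; exact: a0.
  rewrite /a ge0_integralZl//; last 3 first.
  - exact: emeasurable_funM.
  - by move=> x _; rewrite mule_ge0// lee_fin.
  - by rewrite lee_fin powR_ge0.
  rewrite [leRHS]ge0_integralZl//; last by rewrite lee_fin; exact: b0.
  rewrite /b EFinM -[leRHS]muleA; apply: lee_wpmul2l.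
    by rewrite lee_fin powR_ge0.
  have := weak_type_waverage hX c rho0 mtau tau0 itau mg g0 (q0 k).
  rewrite -/(h k _); apply: le_trans.
  rewrite [leRHS]integral_mkcond; apply: ge0_le_integral => //.
  - by move=> x _; rewrite mule_ge0// lee_fin.
  - exact: emeasurable_funM.
  - by apply/(measurable_restrictT _ _).1 => //; exact: measurable_funTS.
  - move=> x _; rewrite /ind patchE; case: ltP => H.
      by rewrite mul1e mem_set.
    by rewrite mul0e memNset//= ltNge H.
have mgp : measurable_fun [set: X] (fun x => (g x `^ p * tau x)%:E).
  apply/measurable_EFinP; apply: measurable_funM => //.
  exact: (measurableT_comp (measurable_powR _)).
have gp0 x : [set: X] x -> 0 <= (g x `^ p * tau x)%:E.
  by move=> _; rewrite lee_fin mulr_ge0 ?powR_ge0// ltW.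
rewrite -integral_nneseries// -ge0_integralZl//.
apply: ge0_le_integral => //.
- by move=> x _; exact: nneseries_ge0.
- exact: ge0_emeasurable_sum.
- exact: measurable_funeM.
move=> x _; apply: lime_le; first exact: is_cvg_nneseries.
apply: nearW => L; rewrite big_mkord.
have -> : \sum_(k < L) (b k)%:E * h k x =
   (2 `^ (p + 1) * (g x * tau x) * \sum_(k < L) (q k) `^ (p - 1) * (q k < 2 * g x)%R%:R)%:E.
  rewrite mulr_sumr -sumEFin; apply: eq_bigr => k _; rewrite /h -EFinM; congr EFin.
  rewrite /b (_ : q k.+1 = 2 * q k)%R; last by rewrite /q exprS; ring.
  rewrite powRM ?(ltW (q0 k))// -(mulr_powRB1 (ltW (q0 k)) p0).
  rewrite ltr_pdivrMr// [(g x * 2)%R]mulrC.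
  rewrite powRD ?(pnatr_eq0 _ 2) ?implybT// powRr1//.
  by field; rewrite gt_eqF// (q0 k).
rewrite -EFinM lee_fin.
have := dyadic_geometric_sum L N0 p1 (mulr_ge0 (ler0n R 2) (g0 x)).
move=> /(ler_wpM2l (_ : 0 <= 2 `^ (p + 1) * (g x * tau x))%R) H.
apply: le_trans (H _) _; first by rewrite !mulr_ge0 ?powR_ge0// ltW.
rewrite -/K0 powRM// -(mulr_powRB1 (g0 x) p0) /K le_eqVlt; apply/orP; left; apply/eqP; ring.
Qed.

End strong_type.

(** * Pointwise bounds for the heat maximal operator *)

Section sigma_finite_structure.
Context d (T : measurableType d) (R : realType) (mu : {measure set T -> \bar R}).
Variable smu : sigma_finite [set: T] mu.

(* Fubini's theorem wants sigma-finiteness as a structure on the measure. *)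
Definition as_sigma_finite of sigma_finite [set: T] mu : set T -> \bar R := mu.

HB.instance Definition _ := Measure.on (as_sigma_finite smu).

HB.instance Definition _ :=
  Measure_isSigmaFinite.Build _ _ _ (as_sigma_finite smu) smu.

End sigma_finite_structure.

Section measurable_partition.
Context d (T : measurableType d) (R : realType).

(** The index is the first [n] with x in [E n], and its fibres are the disjointed sets [seqDU E n].
    It turns a cover into a partition on whose pieces a prefactor may be constant. *)
Lemma measurable_first_index (E : nat -> set T) :
  (forall n, measurable (E n)) -> \bigcup_n E n = [set: T] ->
  exists e : T -> nat, (forall x, E (e x) x) /\
    (forall n, measurable [set x | e x = n]).
Proof.
move=> mE EU; pose e x := xget 0%N [set n | seqDU E n x].
have eE x : seqDU E (e x) x.
  rewrite /e; case: xgetP => // H.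
  have : (\bigcup_n seqDU E n) x by rewrite -seqDU_bigcup_eq EU.
  by move=> [n _ nx]; have := H n.
exists e; split => [x|n]; first by have [] := eE x.
rewrite (_ : [set x | _] = seqDU E n).
  by apply: measurableD => //; exact: bigsetU_measurable.
apply/seteqP; split => x /= => [<-//|nx].
by have /trivIsetP := @trivIset_seqDU _ E => H; apply: contrapT => /eqP en;
  have : (seqDU E (e x) `&` seqDU E n) x by []; rewrite (H _ _ I I en).
Qed.

Lemma measurable_comp_index (e : T -> nat) (w : nat -> R) :
  (forall n, measurable [set x | e x = n]) ->
  measurable_fun [set: T] (fun x => w (e x)).
Proof.
move=> me _ A mA; rewrite setTI.
rewrite (_ : _ @^-1` A = \bigcup_(n in [set n | A (w n)]) [set x | e x = n]).
  exact: bigcup_measurable.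
by apply/seteqP; split => x /= => [Ax|[n /= An ->]//]; exists (e x).
Qed.

End measurable_partition.

Section heat_estimates.
Context d (R : realType) (X : borelMetricType d R).
Variable mu : {measure set X -> \bar R}.
Hypothesis hX : doubling_space mu.
Variables (T : \bar R) (phi : R -> X -> X -> R).
Hypothesis hphi : heat_kernel mu phi T.

Lemma measurable_heat_slice (t : R) (x : X) : 0 < t%:E < T ->
  measurable_fun [set: X] (phi t x).
Proof.
move=> tT; have mphi := heat_kernel_measurable hphi tT.
exact: (measurableT_comp mphi (pair1_measurable x)).
Qed.

Lemma heat_slice_ge0 (t : R) (x y : X) : 0 < t%:E < T -> (0 <= phi t x y)%R.
Proof. by move=> tT; exact: (heat_kernel_ge0 hphi tT). Qed.

Lemma measurable_heat_section (t : R) (psi : X -> R) : 0 < t%:E < T ->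
  measurable_fun [set: X] psi ->
  measurable [set x | mu [set y | (psi y < phi t x y)%R] = 0].
Proof.
move=> tT mpsi.
pose ms : {sigma_finite_measure set X -> \bar R} :=
  as_sigma_finite (doubling_sigma_finite hX).
pose A := [set z : X * X | (psi z.2 < phi t z.1 z.2)%R].
have mA : measurable A.
  have mphi := heat_kernel_measurable hphi tT.
  have mpsi2 : measurable_fun [set: X * X] (fun z : X * X => psi z.2).
    exact: measurableT_comp.
  exact: measurable_set_ltr.
have := @measurable_fun_xsection _ _ X X R ms A mA measurableT [set 0].
rewrite setTI => /(_ _); rewrite (_ : _ @^-1` _ = [set x | mu [set y | (psi y < phi t x y)%R] = 0]).
  by apply; exact: emeasurable_set1.
apply/seteqP; split => x /=; rewrite /xsection/= => <-; congr (mu _);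
  by apply/seteqP; split => y /=; rewrite inE.
Qed.

(** (A3) speaks of nonnegative functions only, so it will be applied to |f|. The conventional value
    +oo causes no trouble: the integrals for f and |f| converge absolutely together. *)
Lemma local_heat_maximal_le_norm (r : R) (f : X -> R) (x : X) : r%:E <= T ->
  measurable_fun [set: X] f ->
  local_heat_maximal mu phi r f x <=
  local_heat_maximal mu phi r (fun y => `|f y|%R) x.
Proof.
move=> rT mf; rewrite /local_heat_maximal; case: asboolP => H1; case: asboolP => H2.
- apply: ge_ereal_sup => _ [t /= t0r <-].
  apply: le_trans (ereal_sup_ubound _); last by exists t.
  have tT : 0 < t%:E < T.
    have /andP[t0 tr] := t0r; rewrite lte_fin t0/=.
    by apply: lt_le_trans rT; rewrite lte_fin.
  have mphi := measurable_heat_slice x tT.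
  have mpf : measurable_fun [set: X] (fun y => (phi t x y * f y)%:E).
    by apply/measurable_EFinP; exact: measurable_funM.
  rewrite /heat_op; apply: le_trans (le_abse_integral _ _ _) _ => //.
  rewrite gee0_abs; last first.
    by apply: integral_ge0 => y _; rewrite lee_fin mulr_ge0// heat_slice_ge0.
  rewrite le_eqVlt; apply/orP; left; apply/eqP; apply: eq_integral => y _ /=.
  by rewrite normrM ger0_norm// heat_slice_ge0.
- by rewrite leey.
- exfalso; apply: H1 => t t0r; have /integrableP[_ Hf] := H2 t t0r.
  have tT : 0 < t%:E < T.
    have /andP[t0 tr] := t0r; rewrite lte_fin t0/=.
    by apply: lt_le_trans rT; rewrite lte_fin.
  have mphi := measurable_heat_slice x tT.
  apply/integrableP; split; first by apply/measurable_EFinP; exact: measurable_funM.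
  apply: le_lt_trans Hf; rewrite le_eqVlt; apply/orP; left; apply/eqP.
  by apply: eq_integral => y _ /=; rewrite !normrM normr_id.
- by [].
Qed.

Section reference_kernel.
Hypothesis A2 : comparison_condition phi T.
Variables (t0 : R) (x0 : X).
Hypothesis t0T : 0 < t0%:E < T.

Local Notation psi := (phi t0 x0).

(** (A2) bounds psi below only on balls of radius [t0]; finitely many of them cover a ball of any
    radius, and the smallest of their bounds serves. *)
Lemma heat_lower_bound (y : X) (M : R) :
  exists2 b : R, (0 < b)%R & forall z, ball y M z -> (b <= psi z)%R.
Proof.
have t00 : (0 < t0)%R by have /andP[] := t0T.
have [s cov] := ball_totally_bounded hX y M t00.
suff [b b0 Hb] : exists2 b : R, (0 < b)%R &
    forall w, w \in s -> forall z, ball w t0 z -> (b <= psi z)%R.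
  by exists b => // z /cov[w ws wz]; exact: Hb wz.
elim: (s) => [|a r [b b0 IH]]; first by exists 1%R.
have [b' b'0 Hb'] := A2.2 x0 t0 t0T a.
exists (Num.min b b')%R; first by rewrite lt_min b0.
move=> w; rewrite inE => /predU1P[->|wr] z wz; rewrite ge_min.
  by rewrite Hb' ?orbT.
by rewrite (IH w).
Qed.

Lemma heat_slice_gt0 y : (0 < psi y)%R.
Proof.
have [b b0 Hb] := heat_lower_bound y 1.
by apply: lt_le_trans b0 (Hb _ _); exact: metric_ballxx.
Qed.

Variables (c : nat -> X) (rho : nat -> R) (C : R).
Hypothesis rho0 : forall n, (0 < rho n)%R.
Hypothesis C1 : (1 <= C)%R.
Hypothesis hC : forall (x : X) (r : R), (0 < r)%R ->
  mu (ball x (4 * r)%R) <= C%:E * mu (ball x r).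
Hypothesis cover : forall (x : X) (s : R), (0 < s)%R -> exists n,
  ball x s `<=` ball (c n) (rho n) /\ ball (c n) (rho n) `<=` ball x (4 * s)%R.

Definition refprod (f : X -> R) (y : X) : \bar R := (psi y * `|f y|)%:E.

(** Modelled on the right-hand side of (A3): the supremum dominates the Hardy-Littlewood term, the
    integral the heat operator at time gamma R. *)
Definition control (f : X -> R) (x : X) : \bar R :=
  sup_balls c rho (average mu c rho (refprod f)) x + \int[mu]_y refprod f y.

Lemma refprod_ge0 f y : 0 <= refprod f y.
Proof. by rewrite lee_fin mulr_ge0// ltW// heat_slice_gt0. Qed.

Lemma measurable_refprod f : measurable_fun [set: X] f ->
  measurable_fun [set: X] (refprod f).
Proof.
move=> mf; apply/measurable_EFinP; apply: measurable_funM.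
  exact: measurable_heat_slice.
exact: measurableT_comp.
Qed.

Lemma control_ge0 f x : 0 <= control f x.
Proof.
rewrite adde_ge0//; last by apply: integral_ge0 => y _; exact: refprod_ge0.
by apply: sup_balls_ge0 => n; apply: average_ge0; exact: refprod_ge0.
Qed.

Lemma measurable_control f : measurable_fun [set: X] f ->
  measurable_fun [set: X] (control f).
Proof.
move=> mf; apply: emeasurable_funD => //.
by apply: measurable_sup_balls => n; apply: average_ge0; exact: refprod_ge0.
Qed.

(* The constant in (A2) need not be measurable in x; the set of x for which a
   given integer works for almost every y is, by Fubini. *)
Lemma maximal_le_control : maximal_condition mu phi T ->
  exists (r : R) (e : X -> nat) (w : nat -> R),
  [/\ 0 < r%:E < T, forall n, measurable [set x | e x = n],
      forall n, (1 <= w n)%R &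
      forall f, measurable_fun [set: X] f -> forall x,
        local_heat_maximal mu phi r f x <= (w (e x))%:E * control f x].
Proof.
move=> [gamma [xi1 [xi2 [Gam [gamma1 xi_gt1 xi_bd Gam0 A3]]]]].
have [[eta /andP[eta0 eta1] Heta] _] := A2.
have /andP[t00 t0T'] := t0T; rewrite lte_fin in t00.
have gamma0 : (0 < gamma)%R := lt_le_trans ltr01 gamma1.
(* Chosen so that gamma r = eta t0, the time at which (A2) compares phi with psi. *)
pose r := (eta * t0 / gamma)%R.
have r0 : (0 < r)%R by rewrite divr_gt0// mulr_gt0.
have gr : (gamma * r = eta * t0)%R by rewrite /r mulrC divfK// gt_eqF.
have etat0 : (eta * t0 <= t0)%R by rewrite ler_piMl// ltW.
have etaT : 0 < (eta * t0)%:E < T.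
  by rewrite lte_fin mulr_gt0//=; apply: le_lt_trans t0T'; rewrite lee_fin.
have rt0 : (r <= t0)%R.
  by rewrite /r ler_pdivrMr// (le_trans etat0)// ler_peMr// ltW.
have rT : 0 < r%:E < T.
  by rewrite lte_fin r0/=; apply: le_lt_trans t0T'; rewrite lee_fin.
have rTg : 0 < r%:E < T / gamma%:E.
  rewrite lte_fin r0/= inver gt_eqF// lte_pdivlMr// -EFinM mulrC gr.
  by have /andP[] := etaT.
pose D n := [set x | mu [set y | (n%:R * psi y < phi (eta * t0)%R x y)%R] = 0].
have mD n : measurable (D n).
  apply: (@measurable_heat_section _ (fun y => n%:R * psi y)%R) => //.
  by apply: measurable_funM => //; exact: measurable_heat_slice.
(* The ball keeps [xi1] and [xi2] bounded on [E n]. *)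
pose E n := D n `&` ball x0 n.+1%:R.
have mE n : measurable (E n).
  by apply: measurableI => //; exact: measurable_metric_ball.
have EU : \bigcup_n E n = [set: X].
  apply/seteqP; split => // x _.
  have [K HK] := Heta t0 t0T x x0.
  pose n := maxn (Num.truncn K).+1 (Num.truncn (mdist x0 x)).
  exists n => //; split.
    rewrite /D/= (_ : [set y | _] = set0) ?measure0// -subset0 => y /=.
    rewrite ltNge => /negP; apply; apply: le_trans (HK y) _.
    rewrite ler_pM2r ?heat_slice_gt0//.
    apply/ltW; apply: lt_le_trans (truncnS_gt _) _.
    by rewrite ler_nat leq_maxl.
  rewrite ballEmdist/=; apply: lt_le_trans (truncnS_gt _) _.
  by rewrite ler_nat ltnS leq_maxr.
have [e [eE me]] := measurable_first_index mE EU.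
have /choice[w Hw] : forall n, exists w : R, (1 <= w)%R /\
    forall f, measurable_fun [set: X] f -> forall x, E n x ->
      local_heat_maximal mu phi r f x <= w%:E * control f x.
  move=> n.
  have [|Q HQ] := xi_bd r (ball x0 n.+1%:R) r0; first by exists x0, n.+1%:R.
  (* This radius makes the ball contain B(x, Gam r) for every x in B(x0, n+1). *)
  have [b b0 Hb] := heat_lower_bound x0 (n.+1%:R + Gam r).
  have Q0 : (0 < Q)%R.
    have [|H1 _] := HQ x0; first exact: metric_ballxx.
    by apply: lt_le_trans H1; apply: lt_trans ltr01 _; have [] := xi_gt1 x0 r r0.
  have C0 : (0 < C)%R := lt_le_trans ltr01 C1.
  pose w := (1 + Q * (C / b) + Q * n%:R)%R.
  have w1 : (Q * (C / b) <= w)%R.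
    by rewrite /w addrAC lerDr addr_ge0// mulr_ge0// ltW.
  have w2 : (Q * n%:R <= w)%R.
    by rewrite /w lerDr addr_ge0// mulr_ge0 ?divr_ge0// ltW.
  exists w; split.
    rewrite /w -addrA lerDl addr_ge0//; first by rewrite mulr_ge0 ?divr_ge0// ltW.
    by rewrite mulr_ge0// ltW.
  move=> f mf x [Dx x0x].
  have mabsf : measurable_fun [set: X] (fun y => `|f y|%R) by exact: measurableT_comp.
  have [xi1Q xi2Q] := HQ x x0x.
  have [xi11 xi21] := xi_gt1 x r r0.
  apply: le_trans (local_heat_maximal_le_norm x _ mf) _.
    by have /andP[_ /ltW] := rT.
  apply: le_trans (A3 r rTg _ mabsf (fun y => normr_ge0 _) x) _.
  have S0 : 0 <= sup_balls c rho (average mu c rho (refprod f)) x.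
    by apply: sup_balls_ge0 => k; apply: average_ge0; exact: refprod_ge0.
  have I0 : 0 <= \int[mu]_y refprod f y.
    by apply: integral_ge0 => y _; exact: refprod_ge0.
  rewrite gr /control [leRHS]ge0_muleDr//.
  apply: leeD.
    have HL := local_HL_le_sup_balls hX rho0 C1 hC cover
      (measurable_heat_slice x0 t0T) mabsf (fun y => ltW (heat_slice_gt0 y)) b0.
    have {}HL := HL (Gam r) x _.
    apply: (@le_trans _ _ (Q%:E * ((C / b)%:E * sup_balls c rho (average mu c rho (refprod f)) x))).
      apply: lee_pmul; rewrite ?lee_fin//.
      - by rewrite ltW// (lt_trans ltr01).
      - apply: le_trans (ereal_sup_ubound _); last first.
          exists (Gam r / 2)%R => //=.
          by rewrite divr_gt0 ?Gam0//= ltr_pdivrMr// ltr_pMr ?Gam0// ltr1n.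
        by rewrite mule_ge0 ?inve_ge0//; exact: integral_ge0.
      apply: le_trans (HL _) _.
        move=> y xy; apply: Hb; apply: ball_triangle x0x xy.
      rewrite le_eqVlt; apply/orP; left; apply/eqP; congr (_ * sup_balls _ _ (average _ _ _ _) _).
      by apply/funext => y; rewrite /refprod normr_id.
    by rewrite muleA -EFinM; apply: lee_wpmul2r => //; rewrite lee_fin.
  apply: (@le_trans _ _ (Q%:E * (n%:R%:E * \int[mu]_y refprod f y))); last first.
    by rewrite muleA -EFinM; apply: lee_wpmul2r => //; rewrite lee_fin.
  have mphi := measurable_heat_slice x etaT.
  have mref := measurable_refprod mf.
  apply: lee_pmul; rewrite ?lee_fin//.
  - by rewrite ltW// (lt_trans ltr01).
  - by apply: integral_ge0 => y _; rewrite lee_fin mulr_ge0// heat_slice_ge0.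
  rewrite -ge0_integralZl//; last by move=> y _; exact: refprod_ge0.
  apply: ae_ge0_le_integral => //.
  - by move=> y _; rewrite lee_fin mulr_ge0// heat_slice_ge0.
  - by apply/measurable_EFinP; exact: measurable_funM.
  - by move=> y _; rewrite mule_ge0// refprod_ge0.
  - exact: measurable_funeM.
  exists [set y | (n%:R * psi y < phi (eta * t0)%R x y)%R]; split.
  - have mnpsi : measurable_fun [set: X] (fun y => n%:R * psi y)%R.
      by apply: measurable_funM => //; exact: measurable_heat_slice.
    exact: measurable_set_ltr.
  - exact: Dx.
  - move=> y /= H; rewrite ltNge; apply/negP => H'; apply: H => _.
    by rewrite /refprod -EFinM lee_fin mulrA ler_wpM2r.
exists r, e, w; split => // [n|f mf x]; first by have [] := Hw n.
by have [_] := Hw (e x); apply.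
Qed.

End reference_kernel.
End heat_estimates.

(** * Weights for the maximal inequalities *)

Section ereal_powers.
Context (R : realType).

Lemma ge0_le_poweR (a b : \bar R) (p : R) : (0 <= p)%R -> 0 <= a -> a <= b ->
  a `^ p <= b `^ p.
Proof.
move=> p0 a0 ab; apply: (gt0_ler_poweR p0) => //.
  by rewrite in_itv/= a0 leey.
by rewrite in_itv/= leey andbT (le_trans a0).
Qed.

Lemma poweR_add_le (a b : \bar R) (p : R) : (0 < p)%R -> 0 <= a -> 0 <= b ->
  (a + b) `^ p <= (2 `^ p)%:E * (a `^ p + b `^ p).
Proof.
move=> p0; wlog ab : a b / a <= b.
  move=> H a0 b0; have [ab|/ltW ba] := leP a b; first exact: H.
  by rewrite addeC [X in _ * X]addeC; exact: H.
move=> a0 b0; apply: (@le_trans _ _ ((2%:E * b) `^ p)).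
  apply: ge0_le_poweR; [exact: ltW|exact: adde_ge0|].
  by rewrite mule_natl mule2n; exact: leeD2r.
rewrite poweRM// poweR_EFin; apply: lee_wpmul2l; first by rewrite lee_fin powR_ge0.
by apply: leeDr; exact: poweR_ge0.
Qed.

End ereal_powers.

Section weights.
Context d (R : realType) (X : borelMetricType d R).
Variable mu : {measure set X -> \bar R}.
Hypothesis hX : doubling_space mu.
Variables (T : \bar R) (phi : R -> X -> X -> R).
Hypothesis hphi : heat_kernel mu phi T.
Hypothesis A2 : comparison_condition phi T.
Variables (t0 : R) (x0 : X).
Hypothesis t0T : 0 < t0%:E < T.
Local Notation psi := (phi t0 x0).
Variables (c : nat -> X) (rho : nat -> R) (C : R).
Hypothesis rho0 : forall n, (0 < rho n)%R.
Hypothesis C1 : (1 <= C)%R.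
Hypothesis hC : forall (x : X) (r : R), (0 < r)%R ->
  mu (ball x (4 * r)%R) <= C%:E * mu (ball x r).

Local Notation F := (refprod phi t0 x0).
Local Notation control := (control mu phi t0 x0 c rho).

Let psi0 y : (0 < psi y)%R. Proof. exact: (heat_slice_gt0 hX A2). Qed.
Let mpsi : measurable_fun [set: X] psi.
Proof. exact: (measurable_heat_slice hphi). Qed.
Let F0 f y : 0 <= F f y. Proof. exact: (refprod_ge0 hX A2). Qed.
Let mF f : measurable_fun [set: X] f -> measurable_fun [set: X] (F f).
Proof. exact: (measurable_refprod hphi). Qed.
Let control0 f x : 0 <= control f x. Proof. exact: (control_ge0 hX A2). Qed.
Let mcontrol f : measurable_fun [set: X] f -> measurable_fun [set: X] (control f).
Proof. by move=> mf; exact: (measurable_control hX A2). Qed.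
Let average0 f n : 0 <= average mu c rho (F f) n.
Proof. by apply: average_ge0; exact: F0. Qed.

(** The bound by 1 makes its mass at most mu on every set; the bound by psi makes its total mass at
    most 1. *)
Definition truncated_heat (y : X) : R := Num.min 1%R (psi y).
Local Notation q := truncated_heat.

Lemma truncated_heat_bounds y : (0 < q y <= 1)%R.
Proof. by rewrite lt_min ltr01 psi0/= ge_min lexx. Qed.

Lemma measurable_truncated_heat : measurable_fun [set: X] q.
Proof. by apply: measurable_minr. Qed.

Let q_ge0 y : 0 <= (q y)%:E.
Proof. by rewrite lee_fin ltW//; have /andP[] := truncated_heat_bounds y. Qed.
Let mq : measurable_fun [set: X] (fun y => (q y)%:E).
Proof. by apply/measurable_EFinP; exact: measurable_truncated_heat. Qed.

Lemma integral_truncated_heat : \int[mu]_y (q y)%:E <= 1.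
Proof.
rewrite -(heat_kernel_mass hphi t0T x0); apply: ge0_le_integral => //.
  exact/measurable_EFinP.
by move=> y _; rewrite lee_fin ge_min lexx orbT.
Qed.

Let measurable_superlevel (g : X -> \bar R) (l : \bar R) :
  measurable_fun [set: X] g -> measurable [set x | l < g x].
Proof.
by move=> mg; have := emeasurable_fun_o_infty measurableT mg l; rewrite setTI.
Qed.

(** If int psi |f| exceeds l/2, the total mass of [q], at most 1, is already small enough. Otherwise
    the supremum alone exceeds l/2 on the set, and the weak type inequality for mu applies since [q]
    is at most 1. *)
Lemma weak_type_control (f : X -> R) (l : R) : measurable_fun [set: X] f -> (0 < l)%R ->
  \int[mu]_(y in [set y | l%:E < control f y]) (q y)%:E <=
  (2 * (C + 1) / l)%:E * \int[mu]_y F f y.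
Proof.
move=> mf l0; set N := \int[mu]_y F f y.
have N0 : 0 <= N by exact: integral_ge0.
have l20 : (0 < l / 2)%R by rewrite divr_gt0.
have C0 : (0 <= C)%R by rewrite (le_trans ler01).
pose S := sup_balls c rho (average mu c rho (F f)).
have mS : measurable_fun [set: X] S by exact: measurable_sup_balls.
pose A := [set y | (l / 2)%:E < S y].
have mA : measurable A by exact: measurable_superlevel.
have mL : measurable [set y | l%:E < control f y].
  by apply: measurable_superlevel; exact: mcontrol.
have [lN|Nl] := ltP (l / 2)%:E N.
  apply: (@le_trans _ _ 1).
    apply: le_trans integral_truncated_heat.
    exact: ge0_subset_integral.
  apply: (@le_trans _ _ ((2 / l)%:E * N)).
    rewrite -[(2 / l)%R]invf_div lee_pdivlMl// mule1; exact: ltW.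
  apply: lee_wpmul2r => //; rewrite lee_fin ler_pM2r ?invr_gt0//.
  by rewrite ler_peMr// lerDr.
apply: (@le_trans _ _ (\int[mu]_(y in A) (q y)%:E)).
  apply: ge0_subset_integral => //; first exact: measurable_funTS.
  move=> y /= ly; rewrite /A/= ltNge; apply/negP => Sl.
  move: ly; rewrite ltNge => /negP; apply.
  by rewrite [l]splitr EFinD; exact: leeD.
apply: (@le_trans _ _ (mu A)).
  rewrite -[leRHS]mul1e -integral_cst//; apply: ge0_le_integral => //.
    exact: measurable_funTS.
  by move=> y _; rewrite lee_fin; have /andP[] := truncated_heat_bounds y.
apply: le_trans (weak_type_maximal hX c rho0 C1 hC (mF mf) (F0 f) l20) _.
apply: lee_wpmul2r => //; rewrite lee_fin invf_div mulrA [(C * 2)%R]mulrC.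
by rewrite ler_pM2r ?invr_gt0// ler_pM2l// lerDl.
Qed.

Variables (e : X -> nat) (w : nat -> R).
Hypothesis me : forall n, measurable [set x | e x = n].
Hypothesis w1 : forall n, (1 <= w n)%R.

Let w0 n : (0 < w n)%R. Proof. exact: lt_le_trans (w1 n). Qed.

(* The weak bounds on the pieces {e = n}, where the prefactor is constant, are
   summed thanks to a factor 2^-(n+1) in u. *)
Lemma weak_type_weight : exists2 u : X -> R, weight mu u &
  forall f, measurable_fun [set: X] f -> forall l, (0 < l)%R ->
    l%:E * \int[mu]_(x in [set x | l%:E < (w (e x))%:E * control f x]) (u x)%:E <=
    (2 * (C + 1))%:E * \int[mu]_y F f y.
Proof.
(* On {e = n} the level becomes l / w n, and the factor 1 / w n compensates for it. *)
pose k n : R := ((2 ^+ n.+1)^-1 / w n)%R.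
have k0 n : (0 < k n)%R by rewrite divr_gt0// invr_gt0 exprn_gt0.
have k1 n : (k n <= 1)%R.
  by rewrite ler_pdivrMr// mul1r (le_trans _ (w1 n))// invf_le1 ?exprn_gt0// exprn_ege1// ler1n.
pose u x := (q x * k (e x))%R.
have meas_u : measurable_fun [set: X] u.
  apply: measurable_funM; first exact: measurable_truncated_heat.
  exact: measurable_comp_index.
have u01 x : (0 < u x <= 1)%R.
  have /andP[q0 q1] := truncated_heat_bounds x.
  by rewrite mulr_gt0//= mulr_ile1// ltW.
exists u.
  by split => // [x|]; [have /andP[] := u01 x|exact: radon_density_le1].
move=> f mf l l0; set N := \int[mu]_y F f y.
have N0 : 0 <= N by exact: integral_ge0.
have C0 : (0 <= C)%R by rewrite (le_trans ler01).
set A := [set x | _ < _].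
have muE : measurable_fun [set: X] (fun x => (u x)%:E) by exact/measurable_EFinP.
have u_ge0 x : 0 <= (u x)%:E by rewrite lee_fin ltW//; have /andP[] := u01 x.
pose L n := [set x | (l / w n)%:E < control f x].
have mL n : measurable (L n) by apply: measurable_superlevel; exact: mcontrol.
have mweA : measurable_fun [set: X] (fun x => (w (e x))%:E * control f x).
  apply: emeasurable_funM; last exact: mcontrol.
  by apply/measurable_EFinP; exact: measurable_comp_index.
have mA : measurable A by exact: measurable_superlevel.
pose G n := A `&` [set x | e x = n].
have mG n : measurable (G n) by exact: measurableI.
have AE : A = \bigcup_n G n.
  apply/seteqP; split => x; first by move=> Ax; exists (e x).
  by move=> [n _ []].
have tG : trivIset setT G.
  by apply/trivIsetP => i j _ _ ij; rewrite -subset0 => x [[_ /= xi] [_ /= xj]];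
    move: ij; rewrite -xi -xj eqxx.
have GL n : G n `<=` L n.
  move=> x [Ax /= ex]; move: Ax; rewrite /A /L /= ex => H.
  by rewrite mulrC EFinM lte_pdivrMl.
have main n : \int[mu]_(x in G n) (u x)%:E <= (2 * (C + 1) / l * (2 ^+ n.+1)^-1)%:E * N.
  apply: (@le_trans _ _ (\int[mu]_(x in G n) ((k n)%:E * (q x)%:E))).
    rewrite le_eqVlt; apply/orP; left; apply/eqP; apply: eq_integral => x.
    by rewrite inE => -[_ /= <-]; rewrite /u EFinM muleC.
  rewrite ge0_integralZl//; last 2 first.
  - exact: measurable_funTS.
  - by rewrite lee_fin ltW.
  apply: (@le_trans _ _ ((k n)%:E * ((2 * (C + 1) / (l / w n))%:E * N))).
    apply: lee_wpmul2l; first by rewrite lee_fin ltW.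
    apply: (@le_trans _ _ (\int[mu]_(x in L n) (q x)%:E)).
      by apply: ge0_subset_integral => //; exact: measurable_funTS.
    exact: (weak_type_control mf (divr_gt0 l0 (w0 n))).
  rewrite muleA -EFinM; apply: lee_wpmul2r => //; rewrite lee_fin le_eqVlt.
  by apply/orP; left; apply/eqP; rewrite /k; field; rewrite !gt_eqF// exprn_gt0.
rewrite muleC -lee_pdivlMr// AE ge0_integral_bigcup//; last exact: measurable_funTS.
apply: (@le_trans _ _ (\sum_(n <oo) (2 * (C + 1) / l * (2 ^+ n.+1)^-1)%:E * N)).
  by apply: lee_nneseries => // n _ _; exact: integral_ge0.
have K0 : (0 <= 2 * (C + 1) / l)%R by rewrite divr_ge0 ?mulr_ge0 ?addr_ge0// ltW.
have [Ny|Nfin] := eqVneq N +oo.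
  rewrite Ny gt0_muley ?mulyr; last first.
    by rewrite lte_fin mulr_gt0// ltr_wpDl.
  by rewrite gtr0_sg ?invr_gt0// mul1e leey.
have NE : N = (fine N)%:E by rewrite fineK// ge0_fin_numE// ltey.
rewrite NE.
have n0 : (0 <= fine N)%R by rewrite fine_ge0.
apply: (@le_trans _ _ (\sum_(n <oo) ((2 * (C + 1) / l * fine N) / (2 ^ n.+1)%:R)%:E)).
  apply: lee_nneseries => [n _ _|n _]; first by rewrite mule_ge0// lee_fin mulr_ge0// invr_ge0 exprn_ge0.
  by rewrite -EFinM lee_fin natrX mulrAC.
apply: le_trans (epsilon_trick0 xpredT (mulr_ge0 K0 n0)) _.
by rewrite -!EFinM lee_fin mulrAC.
Qed.

Section strong.
Variables (p : R) (tau : X -> R).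
Hypothesis p1 : (1 < p)%R.
Hypotheses (mtau : measurable_fun [set: X] tau) (tau0 : forall x, (0 < tau x)%R).
Hypothesis itau : \int[mu]_x (tau x)%:E < +oo.

Local Notation S := (sup_balls c rho (wratio mu c rho tau)).

(** The set where [S] is infinite lies in every superlevel set, whose measure is at most C^2 (int
    tau) / l by the weak type bound. *)
Lemma wratio_sup_finite : {ae mu, forall x, S x < +oo}.
Proof.
have mS : measurable_fun [set: X] S.
  by apply: measurable_sup_balls => n; exact: wratio_ge0.
exists [set x | ~ (S x < +oo)]; split => //.
  rewrite (_ : [set x | _] = ~` [set x | S x < +oo]) //.
  apply: measurableC.
  by have := emeasurable_fun_infty_o measurableT mS +oo; rewrite setTI.
set Z := [set x | _]; set I := \int[mu]_x (tau x)%:E.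
have Ifin : I \is a fin_num by rewrite ge0_fin_numE//; apply: integral_ge0 => x _; rewrite lee_fin ltW.
have I0 : (0 <= fine I)%R by rewrite fine_ge0//; apply: integral_ge0 => x _; rewrite lee_fin ltW.
have mZ : measurable Z.
  rewrite (_ : Z = ~` [set x | S x < +oo]) //; apply: measurableC.
  by have := emeasurable_fun_infty_o measurableT mS +oo; rewrite setTI.
have CC0 : (0 < C ^+ 2)%R by rewrite exprn_gt0// (lt_le_trans ltr01).
apply/eqP; rewrite eq_le measure_ge0 andbT; apply/lee_addgt0Pr => eps eps0; rewrite add0e.
pose l := (C ^+ 2 * (fine I + 1) / eps)%R.
have l0 : (0 < l)%R by rewrite divr_gt0// mulr_gt0// ltr_wpDl.
apply: (@le_trans _ _ (mu [set x | l%:E < S x])).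
  apply: le_measure; rewrite ?inE//; first exact: measurable_superlevel.
  by move=> x /= /negP; rewrite -leNgt leye_eq => /eqP->; rewrite ltry.
apply: le_trans (weak_type_wratio hX c rho0 C1 hC mtau tau0 itau l0) _.
rewrite -/I -(fineK Ifin) -EFinM lee_fin /l invf_div.
have -> : (C ^+ 2 * (eps / (C ^+ 2 * (fine I + 1))) * fine I =
    eps * (fine I / (fine I + 1)))%R.
  by field; rewrite !gt_eqF// ?ltr_wpDl// (lt_le_trans ltr01).
by rewrite ler_piMr ?(ltW eps0)// ler_pdivrMr ?ltr_wpDl// mul1r lerDl.
Qed.

(* With g = psi |f| / tau, the average of psi |f| over a ball B is at most
   tau(3B) / mu(B) times the average of g over 3B with respect to tau. *)
Lemma strong_type_weight : exists2 u : X -> R, weight mu u &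
  exists2 K : R, (0 <= K)%R & forall f, measurable_fun [set: X] f ->
    \int[mu]_x (((w (e x))%:E * control f x) `^ p * (u x)%:E) <=
    K%:E * (\int[mu]_x ((psi x * `|f x| / tau x) `^ p * tau x)%:E +
            (\int[mu]_y F f y) `^ p).
Proof.
have p0 : (0 < p)%R := lt_trans ltr01 p1.
have wr0 n : 0 <= wratio mu c rho tau n by exact: wratio_ge0.
have mS : measurable_fun [set: X] S by exact: measurable_sup_balls.
have S0 x : 0 <= S x by exact: sup_balls_ge0.
(* The first factor cancels the power of the prefactor, the second dominates S^p, and the 1 keeps
   [D] at least 1. [fine] sends +oo to 0, which matters on a null set only. *)
pose D x := (w (e x) `^ p * (1 + fine (S x)) `^ p)%R.
have fS0 x : (0 <= fine (S x))%R by rewrite fine_ge0.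
have w1p n : (1 <= w n `^ p)%R by rewrite (le_trans (w1 n))// le1r_powR// ltW.
have S1p x : (1 <= (1 + fine (S x)) `^ p)%R.
  have : (1 <= 1 + fine (S x))%R by rewrite lerDl.
  by move=> H; rewrite (le_trans H)// le1r_powR// ltW.
have D1 x : (1 <= D x)%R by rewrite -[leLHS]mulr1 ler_pM.
have D0 x : (0 < D x)%R := lt_le_trans ltr01 (D1 x).
pose u x := (Num.min (q x) (tau x) / D x)%R.
have mD : measurable_fun [set: X] D.
  apply: measurable_funM.
    exact: (@measurable_comp_index _ _ _ e (fun n => w n `^ p)%R).
  apply: (measurableT_comp (measurable_powR _)).
  by apply: measurable_funD => //; exact: (measurableT_comp (fine_measurable _)).
have meas_u : measurable_fun [set: X] u.
  apply: measurable_funM; first by apply: measurable_minr => //; exact: measurable_truncated_heat.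
  rewrite (_ : (fun x => _) = (fun x => D x `^ (-1))%R); last first.
    by apply/funext => x; rewrite powR_inv1// ltW.
  exact: (measurableT_comp (measurable_powR _)).
have u01 x : (0 < u x <= 1)%R.
  have /andP[q0 q1] := truncated_heat_bounds x.
  apply/andP; split; first by rewrite divr_gt0// lt_min q0 tau0.
  by rewrite ler_pdivrMr// mul1r (le_trans _ (D1 x))// ge_min q1.
exists u.
  by split => // [x|]; [have /andP[] := u01 x|exact: radon_density_le1].
have [K0 K00 HK0] := strong_type_waverage hX c rho0 mtau tau0 itau p1.
exists (2 `^ p * (1 + K0))%R; first by rewrite mulr_ge0 ?powR_ge0// addr_ge0.
move=> f mf.
pose g x := (psi x * `|f x| / tau x)%R.
have g0 x : (0 <= g x)%R by rewrite divr_ge0 ?mulr_ge0// ltW.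
have mg : measurable_fun [set: X] g.
  apply: measurable_funM.
    by apply: measurable_funM => //; exact: measurableT_comp.
  rewrite (_ : (fun x => _) = (fun x => tau x `^ (-1))%R); last first.
    by apply/funext => x; rewrite powR_inv1// ltW.
  exact: (measurableT_comp (measurable_powR _)).
have FE : F f = fun y => (g y * tau y)%:E.
  by apply/funext => y; rewrite /refprod /g divfK// gt_eqF.
pose M := sup_balls c rho (waverage mu c rho tau g).
have M0 x : 0 <= M x by apply: sup_balls_ge0 => n; exact: waverage_ge0.
have mM : measurable_fun [set: X] M.
  by apply: measurable_sup_balls => n; exact: waverage_ge0.
set N := \int[mu]_y F f y.
have N0 : 0 <= N by exact: integral_ge0.
have mwe : measurable_fun [set: X] (fun x => (w (e x))%:E * control f x).
  apply: emeasurable_funM; last exact: mcontrol.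
  by apply/measurable_EFinP; exact: measurable_comp_index.
have mpow (h : X -> \bar R) : measurable_fun [set: X] h -> measurable_fun [set: X] (fun x => h x `^ p).
  by move=> mh; exact: (measurableT_comp (measurable_poweR _)).
have muE : measurable_fun [set: X] (fun x => (u x)%:E) by exact/measurable_EFinP.
have mtauE : measurable_fun [set: X] (fun x => (tau x)%:E) by exact/measurable_EFinP.
have u_ge0 x : 0 <= (u x)%:E by rewrite lee_fin ltW//; have /andP[] := u01 x.
have tau_ge0 x : 0 <= (tau x)%:E by rewrite lee_fin ltW.
apply: (@le_trans _ _ (\int[mu]_x ((2 `^ p)%:E * ((M x) `^ p * (tau x)%:E + N `^ p * (q x)%:E)))).
  apply: ae_ge0_le_integral => //.
  - by move=> x _; rewrite mule_ge0// poweR_ge0.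
  - by apply: emeasurable_funM => //; exact: mpow.
  - move=> x _; apply: mule_ge0; first by rewrite lee_fin powR_ge0.
    by apply: adde_ge0; apply: mule_ge0 => //; exact: poweR_ge0.
  - apply: measurable_funeM; apply: emeasurable_funD; last exact: measurable_funeM.
    by apply: emeasurable_funM => //; exact: mpow.
  apply: filterS wratio_sup_finite => x Sx _.
  have Sfin : S x = (fine (S x))%:E by rewrite fineK// ge0_fin_numE.
  have cM : control f x <= M x * (fine (S x))%:E + N.
    rewrite /control -/N leeD2r// -Sfin FE.
    by apply: (sup_balls_factor hX) => //.
  have we0 : (0 <= w (e x))%R by exact: ltW.
  have s0 := fS0 x; set s := fine (S x) in Sfin cM s0.
  (* Since a (1 + s)^p = min(q, tau), the same factor pays for both terms: a s^p <= tau and a <=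
     q. *)
  pose a := (w (e x) `^ p * u x)%R.
  have P0 : (0 < w (e x) `^ p)%R by rewrite powR_gt0.
  have Q0 : (0 < (1 + s) `^ p)%R by rewrite powR_gt0// ltr_wpDr.
  have a0 : (0 <= a)%R by rewrite mulr_ge0 ?powR_ge0// ltW//; have /andP[] := u01 x.
  have aE : (a * (1 + s) `^ p = Num.min (q x) (tau x))%R.
    by rewrite /a /u /D -/s; field; rewrite !gt_eqF.
  have atau : (a * s `^ p <= tau x)%R.
    apply: (@le_trans _ _ (a * (1 + s) `^ p)%R); last by rewrite aE ge_min lexx orbT.
    by rewrite ler_wpM2l// ge0_ler_powR ?nnegrE ?addr_ge0 ?(ltW p0)// lerDr.
  have aq : (a <= q x)%R.
    apply: (@le_trans _ _ (a * (1 + s) `^ p)%R); last by rewrite aE ge_min lexx.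
    by rewrite ler_peMr// S1p.
  have cp : control f x `^ p <= (2 `^ p)%:E * (M x `^ p * (s `^ p)%:E + N `^ p).
    apply: le_trans (ge0_le_poweR (ltW p0) (control0 f x) cM) _.
    have Ms0 : 0 <= M x * s%:E by rewrite mule_ge0.
    by apply: le_trans (poweR_add_le p0 Ms0 N0) _; rewrite poweRM// lee_fin.
  rewrite poweRM// ?lee_fin// poweR_EFin muleAC -EFinM -/a.
  apply: le_trans (lee_wpmul2l _ cp) _; first by rewrite lee_fin.
  rewrite muleCA; apply: lee_wpmul2l; first by rewrite lee_fin powR_ge0.
  rewrite [leLHS]ge0_muleDr ?mule_ge0 ?poweR_ge0 ?lee_fin ?powR_ge0//.
  apply: leeD.
    rewrite muleCA -EFinM; apply: lee_wpmul2l; first exact: poweR_ge0.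
    by rewrite lee_fin.
  by rewrite muleC; apply: lee_wpmul2l; [exact: poweR_ge0|rewrite lee_fin].
have mA : measurable_fun [set: X] (fun x => M x `^ p * (tau x)%:E).
  by apply: emeasurable_funM => //; exact: mpow.
have mB : measurable_fun [set: X] (fun x => N `^ p * (q x)%:E) by exact: measurable_funeM.
have A0 x : 0 <= M x `^ p * (tau x)%:E by rewrite mule_ge0// poweR_ge0.
have B0 x : 0 <= N `^ p * (q x)%:E by rewrite mule_ge0// poweR_ge0.
have mAB : measurable_fun [set: X] (fun x => M x `^ p * (tau x)%:E + N `^ p * (q x)%:E).
  exact: emeasurable_funD.
have AB0 x : [set: X] x -> 0 <= M x `^ p * (tau x)%:E + N `^ p * (q x)%:E.
  by move=> _; exact: adde_ge0.
have pow0 : 0 <= (2 `^ p)%:E :> \bar R by rewrite lee_fin powR_ge0.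
rewrite ge0_integralZl//.
rewrite EFinM -[leRHS]muleA; apply: lee_wpmul2l; first by rewrite lee_fin powR_ge0.
rewrite ge0_integralD// ge0_integralZl//; last exact: poweR_ge0.
set I := \int[mu]_x ((psi x * `|f x| / tau x) `^ p * tau x)%:E.
have I0 : 0 <= I by apply: integral_ge0 => x _; rewrite lee_fin mulr_ge0 ?powR_ge0// ltW.
have Np0 : 0 <= N `^ p by exact: poweR_ge0.
rewrite EFinD [leRHS]ge0_muleDl//.
apply: (@le_trans _ _ (K0%:E * I + N `^ p * 1)).
  apply: leeD; first exact: HK0.
  exact: lee_wpmul2l integral_truncated_heat.
rewrite mule1 mul1e [leRHS]addeC; apply: leeD.
  by apply: lee_wpmul2l; rewrite ?lee_fin// leeDl.
by rewrite leeDr.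
Qed.

End strong.
End weights.

(** * Duality *)

Section conjugate_exponents.
Context (R : realType).

Lemma hoelder_conjugate_gt1 (p : R) : (1 < p)%R ->
  hoelder_conjugate p%:E = (p / (p - 1))%:E.
Proof.
move=> p1; have p0 : (p != 0)%R by rewrite gt_eqF// (lt_trans ltr01).
by rewrite /hoelder_conjugate/= eqe (negbTE p0) -EFinD inver subr_eq0 gt_eqF.
Qed.

(** With a = v^(-1/p) s and q = p / (p - 1), so that tau = a^q and s = a v^(1/p), the left-hand side
    is f^p v times a to the power p - q p + q = 0. *)
Lemma powR_dual_identity (p v s f : R) : (1 < p)%R -> (0 < v)%R -> (0 < s)%R ->
  (0 <= f)%R ->
  let tau := ((v `^ (- p^-1) * s) `^ (p / (p - 1)))%R in
  ((s * f / tau) `^ p * tau = f `^ p * v)%R.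
Proof.
move=> p1 v0 s0 f0 tau; have p0 : (0 < p)%R := lt_trans ltr01 p1.
have p10 : (0 < p - 1)%R by rewrite subr_gt0.
set a := (v `^ (- p^-1) * s)%R in tau *; set q := (p / (p - 1))%R in tau *.
have a0 : (0 < a)%R by rewrite mulr_gt0 ?powR_gt0.
have vn0 : v != 0%R by rewrite gt_eqF.
have an0 : a != 0%R by rewrite gt_eqF.
have sE : (s = a * v `^ p^-1)%R.
  by rewrite /a mulrAC -powRD ?vn0 ?implybT// addNr powRr0 mul1r.
have tauV : (tau^-1 = a `^ (- q))%R by rewrite powRN.
have pq : (p + - q * p + q = 0)%R by rewrite /q; field; rewrite gt_eqF.
have vp0 : (0 <= v `^ p^-1)%R by exact: powR_ge0.
have n1 : (0 <= a * v `^ p^-1)%R by rewrite mulr_ge0// ltW.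
have n2 : (0 <= a * v `^ p^-1 * f)%R by exact: mulr_ge0.
have n3 : (0 <= a `^ (- q))%R by exact: powR_ge0.
rewrite tauV {1}sE (powRM _ n2 n3) (powRM _ n1 f0) (powRM _ (ltW a0) vp0).
rewrite -!powRrM mulVf ?gt_eqF// powRr1 ?(ltW v0)//.
have H : (a `^ p * a `^ (- q * p) * tau = 1)%R.
  by rewrite /tau -!powRD ?an0 ?implybT// pq powRr0.
by rewrite -[RHS]mulr1 -H; ring.
Qed.

End conjugate_exponents.

Section hoelder_weighted.
Context d (R : realType) (T : borelMetricType d R) (mu : {measure set T -> \bar R}).
Variables (v s : T -> R) (p : R).
Hypotheses (mv : measurable_fun [set: T] v) (v0 : forall x, (0 < v x)%R).
Hypotheses (ms : measurable_fun [set: T] s) (s0 : forall x, (0 <= s x)%R).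
Hypothesis p1 : (1 <= p)%R.
Hypothesis muT : 0 < mu [set: T].

Let p0 : (0 < p)%R. Proof. exact: lt_le_trans p1. Qed.

Let mvp (r : R) : measurable_fun [set: T] (fun x => v x `^ r)%R.
Proof. exact: (measurableT_comp (measurable_powR _)). Qed.

Let mvs : measurable_fun [set: T] (fun y => v y `^ (- p^-1) * s y)%R.
Proof. exact: measurable_funM. Qed.

Local Notation D := (Lnorm mu (hoelder_conjugate p%:E)
  (fun y => (v y `^ (- p^-1) * s y)%:E)).

Lemma dual_weight_integrable : (1 < p)%R -> D < +oo ->
  \int[mu]_y ((v y `^ (- p^-1) * s y) `^ (p / (p - 1)))%:E < +oo.
Proof.
move=> p1'; rewrite hoelder_conjugate_gt1// unlock => H.
have q0 : (0 < p / (p - 1))%R by rewrite divr_gt0// subr_gt0.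
have {H} := lty_poweRy (_ : (p / (p - 1))^-1 != 0)%R H.
rewrite gt_eqF ?invr_gt0// => /(_ isT); apply: le_lt_trans.
rewrite le_eqVlt; apply/orP; left; apply/eqP; apply: eq_integral => y _ /=.
by rewrite ger0_norm// mulr_ge0// powR_ge0.
Qed.

(** Hoelder's inequality for the factors v^(-1/p) s and v^(1/p) |f|. For p = 1 the conjugate norm is
    an essential supremum, and the integrands are compared almost everywhere. *)
Lemma hoelder_weight : D < +oo -> exists2 K : R, (0 <= K)%R & forall f : T -> R,
  measurable_fun [set: T] f ->
  \int[mu]_y (s y * `|f y|)%:E <= K%:E * wLnorm mu v p (EFin \o f).
Proof.
move=> Dfin; have [p1'|pE] := ltP 1%R p; last first.
  have {}pE : p = 1%R by apply/eqP; rewrite eq_le pE.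
  move: Dfin; rewrite pE hoelder_conjugate1 unlock muT => Dfin.
  have [M HM] := ess_supr_bounded Dfin.
  have M'0 : (0 <= Num.max M 0)%R by rewrite le_max lexx orbT.
  exists (Num.max M 0%R) => // f mf.
  rewrite /wLnorm invr1 poweRe1; last first.
    by apply: integral_ge0 => x _; rewrite mule_ge0 ?poweR_ge0// lee_fin ltW.
  have mfv : measurable_fun [set: T] (fun x => `|f x| * v x)%R.
    by apply: measurable_funM => //; exact: measurableT_comp.
  have -> : \int[mu]_x (`|(EFin \o f) x| `^ 1 * (v x)%:E) = \int[mu]_x (`|f x| * v x)%:E.
    by apply: eq_integral => x _; rewrite poweRe1//= -EFinM.
  rewrite -ge0_integralZl//; last 2 first.
  - exact/measurable_EFinP.
  - by move=> x _; rewrite lee_fin mulr_ge0// ltW.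
  apply: ae_ge0_le_integral => //.
  - by move=> x _; rewrite lee_fin mulr_ge0.
  - by apply/measurable_EFinP; apply: measurable_funM => //; exact: measurableT_comp.
  - by move=> x _; rewrite mule_ge0// lee_fin ?mulr_ge0// ltW.
  - by apply: measurable_funeM; exact/measurable_EFinP.
  apply: filterS HM => x /= HM _.
  rewrite -EFinM lee_fin [leLHS]mulrC [leRHS]mulrCA ler_wpM2l//.
  have : (v x `^ (-1) * s x <= Num.max M 0)%R.
    rewrite le_max; apply/orP; left; apply: le_trans HM.
    by rewrite invr1 ler_norm.
  by rewrite powR_inv1 ?(ltW (v0 x))// ler_pdivrMl// mulrC.
move: (Dfin); rewrite hoelder_conjugate_gt1// => Dfin'.
set q := (p / (p - 1))%R in Dfin' *.
have q0 : (0 < q)%R by rewrite divr_gt0// subr_gt0.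
have pq : (p^-1 + q^-1 = 1)%R.
  by rewrite /q invf_div; field; rewrite !gt_eqF// subr_gt0.
set N := Lnorm _ _ _ in Dfin'.
have N0 : 0 <= N by exact: Lnorm_ge0.
have Nfin : N \is a fin_num by rewrite ge0_fin_numE.
exists (fine N); first exact: fine_ge0.
move=> f mf; rewrite fineK// muleC.
pose f1 x := (v x `^ p^-1 * `|f x|)%R.
have mf1 : measurable_fun [set: T] f1.
  by apply: measurable_funM => //; exact: measurableT_comp.
have := hoelder mu mf1 mvs p0 q0 pq.
rewrite Lnorm1.
have -> : \int[mu]_x `|((f1 \* (fun y => v y `^ (- p^-1) * s y)) x)%:E| =
    \int[mu]_y (s y * `|f y|)%:E.
  apply: eq_integral => x _ /=; congr EFin.
  rewrite ger0_norm; last by rewrite !mulr_ge0 ?powR_ge0.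
  rewrite /f1 powRN; have vp : (0 < v x `^ p^-1)%R by rewrite powR_gt0.
  by field; rewrite gt_eqF.
move=> H; apply: le_trans H _; apply: lee_wpmul2r => //.
rewrite unlock /wLnorm le_eqVlt; apply/orP; left; apply/eqP; congr (_ `^ _).
apply: eq_integral => x _ /=; congr EFin.
rewrite ger0_norm; last by rewrite mulr_ge0 ?powR_ge0.
rewrite /f1 powRM ?powR_ge0// -powRrM mulVf ?gt_eqF// powRr1 ?(ltW (v0 x))//.
by rewrite mulrC.
Qed.

End hoelder_weighted.

(** * Resonance: a uniform bound from mere finiteness *)

Section landau.
Context d (T : measurableType d) (R : realType) (mu : {measure set T -> \bar R}).
Variables (v g : T -> R) (p : R).
Hypotheses (mv : measurable_fun [set: T] v) (v0 : forall x, (0 < v x)%R).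
Hypotheses (mg : measurable_fun [set: T] g) (g0 : forall x, (0 <= g x)%R).
Hypothesis p1 : (1 <= p)%R.

Let p0 : (0 < p)%R. Proof. exact: lt_le_trans p1. Qed.

Let mfpv (f : T -> R) : measurable_fun [set: T] f ->
  measurable_fun [set: T] (fun x => (f x `^ p * v x)%:E).
Proof.
move=> mf; apply/measurable_EFinP; apply: measurable_funM => //.
exact: (measurableT_comp (measurable_powR _)).
Qed.

(* If the bound failed along f_n, then (sum_n (2^-n f_n)^p)^(1/p) would be in
   the weighted space and dominate every 2^-n f_n. *)
Lemma landau_bound :
  (forall f : T -> R, measurable_fun [set: T] f -> (forall x, 0 <= f x)%R ->
    \int[mu]_x (f x `^ p * v x)%:E < +oo -> \int[mu]_x (g x * f x)%:E < +oo) ->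
  exists2 K : R, (0 <= K)%R & forall f : T -> R, measurable_fun [set: T] f ->
    (forall x, 0 <= f x)%R -> forall t : R, (0 < t)%R ->
    \int[mu]_x (f x `^ p * v x)%:E <= (t `^ p)%:E ->
    \int[mu]_x (g x * f x)%:E <= (K * t)%:E.
Proof.
move=> H.
(* By homogeneity it suffices to treat t = 1. *)
suff [K K0 HK] : exists2 K : R, (0 <= K)%R & forall f : T -> R, measurable_fun [set: T] f ->
    (forall x, 0 <= f x)%R -> \int[mu]_x (f x `^ p * v x)%:E <= 1 ->
    \int[mu]_x (g x * f x)%:E <= K%:E.
  exists K => // f mf f0 t t0 Ht.
  pose f' x := (t^-1 * f x)%R.
  have mf' : measurable_fun [set: T] f' by exact: measurable_funM.
  have f'0 x : (0 <= f' x)%R by rewrite mulr_ge0// invr_ge0 ltW.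
  have fpv0 x : [set: T] x -> 0 <= (f x `^ p * v x)%:E.
    by move=> _; rewrite lee_fin mulr_ge0 ?powR_ge0// ltW.
  have t'0 : (0 <= t^-1)%R by rewrite invr_ge0 ltW.
  have := HK f' mf' f'0.
  have -> : \int[mu]_x (f' x `^ p * v x)%:E = (t `^ p)^-1%:E * \int[mu]_x (f x `^ p * v x)%:E.
    rewrite -ge0_integralZl//; last 2 first.
    - exact: mfpv.
    - by rewrite lee_fin invr_ge0 powR_ge0.
    apply: eq_integral => x _; rewrite /f' powRM// -EFinM mulrA.
    by rewrite -powR_inv1 ?(ltW t0)// -powRrM mulN1r powRN.
  have -> : \int[mu]_x (g x * f' x)%:E = t^-1%:E * \int[mu]_x (g x * f x)%:E.
    rewrite -ge0_integralZl//; last 2 first.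
    - by apply/measurable_EFinP; exact: measurable_funM.
    - by move=> x _; rewrite lee_fin mulr_ge0.
    by apply: eq_integral => x _; rewrite /f' -EFinM mulrCA.
  rewrite lee_pdivrMl ?powR_gt0// mule1 => /(_ Ht).
  by rewrite lee_pdivrMl// -EFinM mulrC.
apply: contrapT => nK.
have /choice[f Hf] : forall n : nat, exists f : T -> R, [/\ measurable_fun [set: T] f,
    forall x, (0 <= f x)%R, \int[mu]_x (f x `^ p * v x)%:E <= 1 &
    (4 ^+ n)%:E < \int[mu]_x (g x * f x)%:E].
  move=> n; apply: contrapT => nf; apply: nK; exists (4 ^+ n)%R; first exact: exprn_ge0.
  move=> f mf f0 f1; rewrite leNgt; apply/negP => fn; apply: nf.
  by exists f.
(* 2^-n is summable, yet 2^-n 4^n = 2^n is still unbounded. *)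
pose b n : R := ((2 ^+ n)^-1)%R.
have b0 n : (0 < b n)%R by rewrite invr_gt0 exprn_gt0.
pose a n x : \bar R := ((b n * f n x) `^ p)%:E.
have a0 n x : 0 <= a n x by rewrite lee_fin powR_ge0.
have ma n : measurable_fun [set: T] (a n).
  apply/measurable_EFinP; apply: (measurableT_comp (measurable_powR _)).
  by apply: measurable_funM => //; have [] := Hf n.
pose S x := \sum_(n <oo) a n x.
have S0 x : 0 <= S x by apply: nneseries_ge0 => *; exact: a0.
have mS : measurable_fun [set: T] S.
  by apply: ge0_emeasurable_sum => // n x _ _; exact: a0.
(* [fine] keeps [h] real-valued; [S] will be finite almost everywhere, and there h^p = S. *)
pose h x := (fine (S x) `^ p^-1)%R.
have mh : measurable_fun [set: T] h.
  apply: (measurableT_comp (measurable_powR _)).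
  exact: (measurableT_comp (fine_measurable _)).
have h0 x : (0 <= h x)%R by exact: powR_ge0.
have hp x : (h x `^ p = fine (S x))%R.
  by rewrite /h -powRrM mulVf ?gt_eqF// powRr1// fine_ge0.
have mvE : measurable_fun [set: T] (fun x => (v x)%:E) by exact/measurable_EFinP.
have v_ge0 x : 0 <= (v x)%:E by rewrite lee_fin ltW.
have SvI : \int[mu]_x (S x * (v x)%:E) <= 2%:E.
  have -> : \int[mu]_x (S x * (v x)%:E) = \int[mu]_x (\sum_(n <oo) (a n x * (v x)%:E)).
    apply: eq_integral => x _; rewrite /S muleC -nneseriesZl//.
    by apply: eq_eseriesr => n _; rewrite muleC.
  have mav n : measurable_fun [set: T] (fun x => a n x * (v x)%:E) by exact: emeasurable_funM.
  have av0 n x : [set: T] x -> 0 <= a n x * (v x)%:E by move=> _; exact: mule_ge0.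
  rewrite integral_nneseries//.
  apply: (@le_trans _ _ (\sum_(n <oo) (2 / (2 ^ n.+1)%:R)%:E)); last first.
    exact: epsilon_trick0.
  apply: lee_nneseries => [n _ _|n _]; first by apply: integral_ge0 => x; exact: av0.
  have [mf f0 f1 _] := Hf n.
  have fpv0 x : [set: T] x -> 0 <= (f n x `^ p * v x)%:E.
    by move=> _; rewrite lee_fin mulr_ge0 ?powR_ge0// ltW.
  have -> : \int[mu]_x (a n x * (v x)%:E) = (b n `^ p)%:E * \int[mu]_x (f n x `^ p * v x)%:E.
    rewrite -ge0_integralZl//; last 2 first.
    - exact: mfpv.
    - by rewrite lee_fin powR_ge0.
    apply: eq_integral => x _; rewrite /a -!EFinM powRM ?(ltW (b0 n))//.
    by rewrite mulrA.
  apply: (@le_trans _ _ ((b n `^ p)%:E * 1)).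
    by apply: lee_wpmul2l => //; rewrite lee_fin powR_ge0.
  rewrite mule1 lee_fin natrX exprS invfM mulrA divff ?mul1r// -/(b n).
  (* Here p >= 1 enters: b^p <= b for 0 < b <= 1. *)
  by apply: ge1r_powR => //; rewrite b0 /b invf_le1 ?exprn_gt0// exprn_ege1// ler1n.
have Sfin : {ae mu, forall x, S x < +oo}.
  have mSv : measurable_fun [set: T] (fun x => S x * (v x)%:E) by exact: emeasurable_funM.
  have iSv : mu.-integrable [set: T] (fun x => S x * (v x)%:E).
    apply/integrableP; split => //.
    apply: le_lt_trans (ltry 2); apply: le_trans SvI.
    rewrite le_eqVlt; apply/orP; left; apply/eqP; apply: eq_integral => x _.
    by rewrite gee0_abs// mule_ge0.
  have := integrable_ae measurableT iSv.
  apply: filterS => x /(_ I) Sv.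
  rewrite ltNge leye_eq; apply/negP => /eqP Sy; move: Sv.
  by rewrite Sy gt0_mulye// lte_fin.
have := H h mh h0.
have -> : \int[mu]_x (h x `^ p * v x)%:E < +oo.
  apply: le_lt_trans (ltry 2); apply: le_trans SvI; apply: ge0_le_integral => //.
  - by move=> x _; rewrite lee_fin mulr_ge0 ?powR_ge0// ltW.
  - exact: mfpv.
  - exact: emeasurable_funM.
  - move=> x _; rewrite hp EFinM; apply: lee_wpmul2r => //.
    by case: (S x) (S0 x) => //= _; exact: leey.
move=> /(_ isT); apply/negP; rewrite -leNgt leye_eq; apply/eqP/eqyP => A A0.
pose n := (Num.truncn A).+1.
have [mf f0 f1 f4] := Hf n.
apply: (@le_trans _ _ ((b n)%:E * \int[mu]_x (g x * f n x)%:E)).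
  apply: (@le_trans _ _ ((b n)%:E * (4 ^+ n)%:E)).
    rewrite -EFinM lee_fin /b (_ : 4 = 2 * 2 :> R)%R; last by rewrite -natrM.
    rewrite exprMn mulrA mulVf ?mul1r ?gt_eqF ?exprn_gt0//.
    apply/ltW; apply: lt_trans (truncnS_gt _) _; rewrite -/n.
    by rewrite -natrX ltr_nat ltn_expl.
  by apply: lee_wpmul2l; [rewrite lee_fin ltW|exact: ltW].
rewrite -ge0_integralZl//; last 3 first.
- by apply/measurable_EFinP; exact: measurable_funM.
- by move=> x _; rewrite lee_fin mulr_ge0.
- by rewrite lee_fin ltW.
apply: ae_ge0_le_integral => //.
- by move=> x _; rewrite mule_ge0// lee_fin ?mulr_ge0// ltW.
- by apply: measurable_funeM; apply/measurable_EFinP; exact: measurable_funM.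
- by move=> x _; rewrite lee_fin mulr_ge0.
- by apply/measurable_EFinP; exact: measurable_funM.
apply: filterS Sfin => x Sx _.
rewrite -EFinM lee_fin mulrCA ler_wpM2l//.
have bf0 : (0 <= b n * f n x)%R by rewrite mulr_ge0// ltW.
rewrite -(powRr1 bf0) -(mulfV (lt0r_neq0 p0)) powRrM /h.
apply: ge0_ler_powR; rewrite ?nnegrE ?invr_ge0 ?powR_ge0 ?fine_ge0 ?(ltW p0)//.
rewrite -lee_fin fineK; last by rewrite ge0_fin_numE.
apply: (@le_trans _ _ (\sum_(0 <= i < n.+1) a i x)); last first.
  by apply: nneseries_lim_ge => i *; exact: a0.
by rewrite big_nat_recr//= leeDr//; apply: sume_ge0 => i _; exact: a0.
Qed.

End landau.

(** * Test functions for the dual norm *)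

Section weight_class_from_bound.
Context d (R : realType) (X : borelMetricType d R).
Variable mu : {measure set X -> \bar R}.
Hypothesis hX : doubling_space mu.
Variables (v g : X -> R) (p : R).
Hypotheses (mv : measurable_fun [set: X] v) (v0 : forall x, (0 < v x)%R).
Hypotheses (mg : measurable_fun [set: X] g) (g0 : forall x, (0 <= g x)%R).
Hypothesis p1 : (1 <= p)%R.

Local Notation a := (fun y => (v y `^ (- p^-1) * g y)%R).

Let a0 x : (0 <= a x)%R. Proof. by rewrite mulr_ge0 ?powR_ge0. Qed.

Let mvp (r : R) : measurable_fun [set: X] (fun x => v x `^ r)%R.
Proof. exact: (measurableT_comp (measurable_powR _)). Qed.

Let ma : measurable_fun [set: X] a.
Proof. exact: measurable_funM. Qed.

(** For p = 1 the test function is v^-1 on a bounded set where a > K + 1, which is thereby seen to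
    be null. For p > 1 it is the equality case of Hoelder's inequality, v^(-1/p) a^(q-1), truncated
    so that m = int f^p v = int g f is finite; then m <= K m^(1/p) gives m^(1/q) <= K, uniformly in
    the truncation. *)
Lemma dual_norm_finite (K : R) : (0 <= K)%R ->
  (forall f : X -> R, measurable_fun [set: X] f ->
    (forall x, 0 <= f x)%R -> forall t : R, (0 < t)%R ->
    \int[mu]_x (f x `^ p * v x)%:E <= (t `^ p)%:E ->
    \int[mu]_x (g x * f x)%:E <= (K * t)%:E) ->
  Lnorm mu (hoelder_conjugate p%:E) (fun y => (a y)%:E) < +oo.
Proof.
move=> K0 HK; pose Bn n : set X := ball point n.+1%:R.
have mB n : measurable (Bn n) by exact: measurable_metric_ball.
have Bfin n : mu (Bn n) < +oo.
  by have /andP[] := doubling_ball hX point (ltr0Sn R n).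
have [p1'|pE] := ltP 1%R p; last first.
  have {}pE : p = 1%R by apply/eqP; rewrite eq_le pE.
  rewrite pE hoelder_conjugate1 unlock; case: ifPn => // _.
  apply: (@le_lt_trans _ _ (K + 1)%:E); last exact: ltry.
  apply/ess_supP.
  pose A n := [set x | (K + 1 < a x)%R] `&` Bn n.
  have mA n : measurable (A n).
    by apply: measurableI => //; exact: measurable_set_ltr.
  have A0 n : mu (A n) = 0.
    apply/eqP; rewrite -measure_le0 leNgt; apply/negP => Apos.
    have Afin : mu (A n) \is a fin_num.
      rewrite ge0_fin_numE//; apply: le_lt_trans (Bfin n).
      by apply: le_measure; rewrite ?inE//; exact: subIsetr.
    pose t := fine (mu (A n)).
    have tE : mu (A n) = t%:E by rewrite fineK.
    have t0 : (0 < t)%R by rewrite -lte_fin -tE.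
    pose f x := (v x `^ (-1) * \1_(A n) x)%R.
    have mf : measurable_fun [set: X] f.
      by apply: measurable_funM; [exact: mvp|exact: measurable_indic].
    have f0 x : (0 <= f x)%R by rewrite mulr_ge0 ?powR_ge0.
    have fv : \int[mu]_x (f x `^ p * v x)%:E = (t `^ p)%:E.
      rewrite pE powRr1 ?(ltW t0)// -tE -[in RHS](setIT (A n)) -integral_indic//.
      apply: eq_integral => x _; rewrite powRr1// /f mulrAC powR_inv1 ?(ltW (v0 x))//.
      by rewrite mulVf ?mul1r// gt_eqF.
    have := HK f mf f0 t t0; rewrite fv => /(_ (lexx _)); apply/negP; rewrite -ltNge.
    apply: (@lt_le_trans _ _ ((K + 1) * t)%:E).
      by rewrite lte_fin ltr_pM2r// ltrDl.
    rewrite EFinM -tE -[in leLHS](setIT (A n)) -integral_indic//.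
    have Kp : 0 <= (K + 1)%:E by rewrite lee_fin addr_ge0.
    have mi : measurable_fun [set: X] (fun x => (\1_(A n) x : R)%:E).
      by apply/measurable_EFinP; exact: measurable_indic.
    have i0 x : [set: X] x -> 0 <= (\1_(A n) x : R)%:E by rewrite lee_fin.
    rewrite -ge0_integralZl//.
    apply: ge0_le_integral => //.
    - by move=> x _; rewrite mule_ge0// lee_fin ?addr_ge0.
    - by apply: measurable_funeM; apply/measurable_EFinP; exact: measurable_indic.
    - by apply/measurable_EFinP; exact: measurable_funM.
    move=> x _; rewrite -EFinM lee_fin /f indicE.
    have [Anx|nA] := pselect (A n x); last by rewrite memNset// !mulr0.
    rewrite mem_set// !mulr1 [leRHS]mulrC.
    by have [/= + _] := Anx; rewrite pE invr1 => /ltW.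
  have Anull : mu.-negligible (\bigcup_n A n).
    by apply: negligible_bigcup => n; exists (A n); split.
  apply: negligibleS Anull => x /= Hx.
  have : (\bigcup_n Bn n) x by rewrite bigcup_metric_balls.
  move=> [n _ nx]; exists n => //; split => //=.
  rewrite ltNge; apply/negP => Hle; apply: Hx.
  rewrite lee_fin ger0_norm; first by move: Hle; rewrite pE.
  by have := a0 x; rewrite pE.
rewrite hoelder_conjugate_gt1// unlock.
set q := (p / (p - 1))%R.
have p0 : (0 < p)%R := lt_trans ltr01 p1'.
have p10 : (0 < p - 1)%R by rewrite subr_gt0.
have q0 : (0 < q)%R by rewrite divr_gt0.
have q1p : ((q - 1) * p = q)%R by rewrite /q; field; rewrite gt_eqF.
have pq : (p^-1 + q^-1 = 1)%R by rewrite /q invf_div; field; rewrite !gt_eqF.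
have maq : measurable_fun [set: X] (fun x => (a x `^ q)%:E).
  by apply/measurable_EFinP; exact: (measurableT_comp (measurable_powR _)).
have aq0 x : 0 <= (a x `^ q)%:E by rewrite lee_fin powR_ge0.
apply: poweR_lty.
have -> : \int[mu]_x `|(a x)%:E| `^ q = \int[mu]_x (a x `^ q)%:E.
  by apply: eq_integral => x _ /=; rewrite ger0_norm.
pose nu : {measure set X -> \bar R} := density mu aq0 maq.
pose A n := [set x | (a x < n.+1%:R)%R] `&` Bn n.
have mA n : measurable (A n).
  by apply: measurableI => //; exact: measurable_set_ltr.
have AT : \bigcup_n A n = [set: X].
  apply/seteqP; split => // x _.
  have : (\bigcup_n Bn n) x by rewrite bigcup_metric_balls.
  move=> [n _ nx]; exists (maxn n (Num.truncn (a x))) => //; split => /=.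
    apply: lt_le_trans (truncnS_gt _) _.
    by rewrite ler_nat ltnS leq_maxr.
  by apply: le_ball nx; rewrite ler_nat ltnS leq_maxl.
have cv : nu \o A @ \oo --> nu [set: X].
  rewrite -AT; apply: nondecreasing_cvg_mu => //; first by rewrite AT.
  move=> i j ij; apply/subsetPset => x [/= ax bx]; split => /=.
    by apply: lt_le_trans ax _; rewrite ler_nat.
  by apply: le_ball bx; rewrite ler_nat.
rewrite -[X in X < _]/(nu [set: X]) -(cvg_lim _ cv)//.
apply: (@le_lt_trans _ _ (K `^ q)%:E); last exact: ltry.
apply: lime_le; first by apply/cvg_ex; eexists; exact: cv.
apply: nearW => n; rewrite /= /nu densityE.
set m := \int[mu]_(x in A n) _.
have m_ge0 : 0 <= m by exact: integral_ge0.
have mfin : m \is a fin_num.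
  rewrite ge0_fin_numE//; apply: (@le_lt_trans _ _ ((n.+1%:R `^ q)%:E * mu (A n))).
    rewrite -integral_cst//; apply: ge0_le_integral => //; first exact: measurable_funTS.
    move=> x [/= ax _]; rewrite lee_fin.
    by apply: (ge0_ler_powR (ltW q0)); rewrite ?nnegrE//; exact: ltW.
  apply: lte_mul_pinfty => //.
  apply: le_lt_trans (Bfin n); apply: le_measure; rewrite ?inE//.
  exact: subIsetr.
pose s := fine m; have sE : m = s%:E by rewrite fineK.
have [s0|] := ltP 0%R s; last first.
  by move=> s0; rewrite sE lee_fin (le_trans s0)// powR_ge0.
pose t := (s `^ p^-1)%R; have t0 : (0 < t)%R by rewrite powR_gt0.
pose f x := (v x `^ (- p^-1) * a x `^ (q - 1) * \1_(A n) x)%R.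
have maq1 : measurable_fun [set: X] (fun x => a x `^ (q - 1))%R.
  exact: (measurableT_comp (measurable_powR _)).
have mf : measurable_fun [set: X] f.
  apply: measurable_funM; last exact: measurable_indic.
  exact: measurable_funM.
have f0 x : (0 <= f x)%R by rewrite !mulr_ge0 ?powR_ge0.
have fv : \int[mu]_x (f x `^ p * v x)%:E = m.
  rewrite /m [RHS]integral_mkcond; apply: eq_integral => x _; rewrite patchE /f indicE.
  case: ifPn => _; last by rewrite mulr0 powR0 ?mul0r// gt_eqF.
  rewrite mulr1 powRM ?powR_ge0// -!powRrM q1p mulNr mulVf ?gt_eqF//.
  by rewrite powR_inv1 ?(ltW (v0 x))// mulrAC mulVf ?mul1r// gt_eqF.
have gf : \int[mu]_x (g x * f x)%:E = m.
  rewrite /m [RHS]integral_mkcond; apply: eq_integral => x _; rewrite patchE /f indicE.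
  case: ifPn => _; last by rewrite !mulr0.
  by rewrite mulr1 mulrA [(g x * _)%R]mulrC mulr_powRB1.
have := HK f mf f0 t t0; rewrite fv gf /t -powRrM mulVf ?gt_eqF// powRr1 ?(ltW s0)// -sE.
move=> /(_ (lexx _)); rewrite sE !lee_fin => H.
have sq : (s `^ q^-1 <= K)%R.
  rewrite -(ler_pM2r t0) /t -powRD ?(gt_eqF s0) ?implybT//.
  by rewrite addrC pq powRr1 ?(ltW s0).
rewrite -[leLHS](powRr1 (ltW s0)) -(mulVf (lt0r_neq0 q0)) powRrM.
by apply: ge0_ler_powR; rewrite ?nnegrE ?powR_ge0 ?(ltW q0).
Qed.

End weight_class_from_bound.

(** * From the maximal inequality to one finite value *)

Section maximal_finite_somewhere.
Context d (R : realType) (X : borelMetricType d R).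
Variable mu : {measure set X -> \bar R}.
Hypothesis hX : doubling_space mu.
Variables (T : \bar R) (phi : R -> X -> X -> R).
Hypothesis hphi : heat_kernel mu phi T.

Lemma doubling_setT_gt0 : 0 < mu [set: X].
Proof.
apply: lt_le_trans (ball_measure_gt0 hX point (ltr01 : 0 < 1 :> R)%R) _.
by apply: le_measure; rewrite ?inE//; exact: measurable_metric_ball.
Qed.

(** The case to refute is a maximal function equal to +oo everywhere: it is constant, so no question
    of measurability arises. In the weak case every superlevel set is the whole space, whose
    [u]-mass is positive, and the level can be taken as large as desired. *)
Lemma maximal_finite_somewhere (v u f : X -> R) (p r : R) : (1 <= p)%R ->
  weight mu u -> wLfun mu v p f ->
  ((1 < p)%R -> maximal_strong_type mu phi p v u r) ->
  (p = 1%R -> maximal_weak_type mu phi v u r) ->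
  exists x, local_heat_maximal mu phi r f x < +oo.
Proof.
move=> p1 [meas_u u0 _] ff strong weak; apply: contrapT => nx.
have HE : local_heat_maximal mu phi r f = fun=> +oo.
  apply/funext => x; apply/eqP; rewrite -leye_eq leNgt; apply/negP => H.
  by apply: nx; exists x.
have muT := doubling_setT_gt0.
have [mf ffin] := ff.
have wfin (C q : R) : wLnorm mu v q (EFin \o f) < +oo -> C%:E * wLnorm mu v q (EFin \o f) < +oo.
  move=> H; have : wLnorm mu v q (EFin \o f) \is a fin_num.
    by rewrite ge0_fin_numE// poweR_ge0.
  by move=> /fineK <-; rewrite -EFinM ltry.
have [p1'|pE] := ltP 1%R p.
  have [C HC] := strong p1'; have := HC f ff; apply/negP; rewrite -ltNge.
  apply: lt_le_trans (wfin C p ffin) _; rewrite HE /wLnorm.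
  have -> : \int[mu]_x (`|+oo| `^ p * (u x)%:E) = +oo.
    rewrite (_ : (fun x => _) = cst +oo); first by rewrite integral_cst// gt0_mulye.
    apply/funext => x; rewrite /= gt_eqF ?(lt_trans ltr01)//.
    by rewrite gt0_mulye// lte_fin.
  by rewrite poweRyr// gt_eqF// invr_gt0 (lt_trans ltr01).
have {}pE : p = 1%R by apply/eqP; rewrite eq_le pE.
have [C HC] := weak pE; rewrite pE in ff ffin.
have := wfin C 1%R ffin; have := HC f ff; rewrite HE => H1 H2.
have := le_lt_trans H1 H2; apply/negP; rewrite -leNgt leye_eq; apply/eqP/eqyP => A A0.
pose J := \int[mu]_x (u x)%:E.
have J0 : 0 < J.
  rewrite lt0e integral_ge0 ?andbT; last by move=> x _; rewrite lee_fin ltW.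
  apply/negP => /eqP J0.
  have muE : measurable_fun [set: X] (fun x => (u x)%:E) by exact/measurable_EFinP.
  have /(ae_eq_integral_abs mu measurableT muE)[N [mN N0 sub]] :
      \int[mu]_x `|(u x)%:E| = 0.
    by rewrite -[RHS]J0; apply: eq_integral => y _; rewrite gee0_abs// lee_fin ltW.
  have : mu [set: X] <= mu N.
    apply: le_measure; rewrite ?inE// => y _; apply: sub => /(_ Logic.I) /eqP.
    by rewrite eqe gt_eqF.
  by rewrite N0 leNgt muT.
have [l l0 Hl] : exists2 l : R, (0 < l)%R & A%:E <= l%:E * J.
  case: J J0 => [j| |]// j0; last first.
    by exists 1%R => //; rewrite gt0_muley// leey.
  rewrite lte_fin in j0; exists (A / j)%R; first by rewrite divr_gt0.
  by rewrite -EFinM lee_fin divfK// gt_eqF.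
apply: le_trans Hl _; apply: ereal_sup_ubound; exists l => //.
by congr (_ * _); congr integral; apply/seteqP; split => x //= _; rewrite ltry.
Qed.

Lemma heat_finite_comparison (f : X -> R) (s t C : R) (x1 x2 : X) :
  0 < s%:E < T -> 0 < t%:E < T -> measurable_fun [set: X] f ->
  (forall y, phi s x1 y <= C * phi t x2 y)%R ->
  heat_finite mu phi t f x2 -> heat_finite mu phi s f x1.
Proof.
move=> sT tT mf H /integrableP[_ H2].
have ms := measurable_heat_slice hphi x1 sT.
have mt := measurable_heat_slice hphi x2 tT.
have phis0 y := heat_slice_ge0 hphi x1 y sT.
have phit0 y := heat_slice_ge0 hphi x2 y tT.
have mtf : measurable_fun [set: X] (fun y => `|(phi t x2 y * f y)%:E|).
  by apply: measurableT_comp => //; apply/measurable_EFinP; exact: measurable_funM.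
apply/integrableP; split; first by apply/measurable_EFinP; exact: measurable_funM.
apply: (@le_lt_trans _ _ (\int[mu]_y (`|C|%:E * `|(phi t x2 y * f y)%:E|))).
  apply: ge0_le_integral => //.
  - apply: measurableT_comp => //; apply/measurable_EFinP; exact: measurable_funM.
  - exact: measurable_funeM.
  - move=> y _; rewrite -EFinM lee_fin !normrM mulrA ler_wpM2r//.
    by rewrite ger0_norm// (le_trans (H y))// -normrM ler_norm.
rewrite ge0_integralZl//.
by apply: lte_mul_pinfty => //; rewrite lee_fin.
Qed.

End maximal_finite_somewhere.

(** * Density of the compactly supported continuous functions *)

Section compactly_supported_functions.
Context d (R : realType) (X : borelMetricType d R).

Lemma compact_borel (K : set X) : compact K -> measurable K.
Proof.
move=> cK; rewrite -(setCK K); apply: measurableC; apply: open_borel.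
by apply: closed_openC; apply: compact_closed cK; exact: metric_hausdorff.
Qed.

Lemma Cc_measurable (h : X -> R) : Cc h -> measurable_fun [set: X] h.
Proof. by move=> [ch _]; exact: continuous_borel. Qed.

Lemma Cc0 : Cc (fun _ : X => 0%R : R).
Proof.
split; first by move=> x; exact: cvg_cst.
rewrite (_ : [set _ | _] = set0); first by rewrite closure0; exact: compact0.
by rewrite -subset0 => x /=; rewrite eqxx.
Qed.

Lemma CcD (g h : X -> R) : Cc g -> Cc h -> Cc (fun x => g x + h x)%R.
Proof.
move=> [cg kg] [ch kh]; split; first by move=> x; apply: cvgD; [exact: cg|exact: ch].
apply: (subclosed_compact _ (compactU kg kh)); first exact: closed_closure.
rewrite -closureU; apply: closureS => x /=; apply: contra_neqP.
by move=> /not_orP[/negP/negPn/eqP -> /negP/negPn/eqP ->]; rewrite addr0.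
Qed.

Lemma CcZ (k : R) (h : X -> R) : Cc h -> Cc (fun x => k * h x)%R.
Proof.
move=> [ch kh]; split; first by move=> x; apply: cvgMr; exact: ch.
apply: (subclosed_compact _ kh); first exact: closed_closure.
by apply: closureS => x /=; apply: contra_neq => ->; rewrite mulr0.
Qed.

Lemma compact_neighborhood (K : set X) : locally_compact [set: X] -> compact K ->
  exists2 U, compact U & K `<=` U°.
Proof.
move=> lc cK.
have /choice[N HN] : forall x : X, exists N : set X, nbhs x N /\ compact N.
  move=> x; have [N Nx [cN _]] := lc x Logic.I; exists N; split => //.
  by move: Nx; rewrite /within/= => Nx; near=> y; apply: (near Nx y).
have cov := cK; rewrite compact_cover in cov.
have := cov X [set: X] (fun x => (N x)°); case=> [x _|x _|D _ KD]; first exact: open_interior.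
  by exists x => //; have [+ _] := HN x; rewrite /interior.
exists (\bigcup_(x in [set` D]) N x).
  rewrite bigcup_fset; apply: (big_ind (@compact X)); first exact: compact0.
    by move=> A B; exact: compactU.
  by move=> x _; have [] := HN x.
move=> x /KD[y yD yx]; apply: filterS yx => z Nz.
by exists y.
Unshelve. all: by end_near. Qed.

(** Urysohn's lemma, with [V] first shrunk to its intersection with the interior of a compact
    neighbourhood of [K], so that the support is compact. *)
Lemma Cc_between (K V : set X) : locally_compact [set: X] -> compact K -> open V ->
  K `<=` V -> exists h : X -> R, [/\ Cc h, forall x, (0 <= h x <= 1)%R,
    forall x, K x -> h x = 1%R & forall x, ~ V x -> h x = 0%R].
Proof.
move=> lc cK oV KV; have [U cU KU] := compact_neighborhood lc cK.
pose W := V `&` U°.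
have oW : open W by apply: openI => //; exact: open_interior.
have KW : K `<=` W by move=> x Kx; split; [exact: KV|exact: KU].
have clK : closed K by apply: compact_closed cK; exact: metric_hausdorff.
have clU : closed U by apply: compact_closed cU; exact: metric_hausdorff.
have dis : (~` W) `&` K = set0 by rewrite -subset0 => x [nW /KW].
have /(@uniform_separatorP _ R)[h [ch h01 h0 h1]] :=
  normal_uniform_separator (@pseudometric_normal R X) (open_closedC oW) clK dis.
have h0' x : ~ W x -> h x = 0%R by move=> nW; apply: h0; exists x.
exists h; split.
- split => //; apply: (subclosed_compact _ cU); first exact: closed_closure.
  rewrite (closure_id U).1//; apply: closureS => x /= hx.
  have [_ Ux] : W x by apply: contrapT => /h0' /eqP; rewrite (negbTE hx).
  exact: interior_subset Ux.
- by move=> x; have /= := h01 (h x); rewrite in_itv/=; apply; exists x.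
- by move=> x Kx; apply: h1; exists x.
- by move=> x nV; apply: h0' => -[].
Qed.

End compactly_supported_functions.

Section density_of_Cc.
Context d (R : realType) (X : borelMetricType d R).
Variable mu : {measure set X -> \bar R}.
Hypothesis hX : doubling_space mu.
Variable s : X -> R.
Hypotheses (ms : measurable_fun [set: X] s) (s0 : forall x, (0 <= s x)%R).
Hypothesis ints : \int[mu]_x (s x)%:E < +oo.

Let msE : measurable_fun [set: X] (fun x => (s x)%:E).
Proof. exact/measurable_EFinP. Qed.

Local Notation dist f g := (\int[mu]_x (s x * `|f x - g x|)%:E).

(** Membership in the closure of [Cc] in L^1 of the measure [s] mu. *)
Definition approximable (f : X -> R) := measurable_fun [set: X] f /\
  forall e : R, (0 < e)%R -> exists2 h : X -> R, Cc h & dist f h <= e%:E.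

Let measurable_distance (f g : X -> R) : measurable_fun [set: X] f -> measurable_fun [set: X] g ->
  measurable_fun [set: X] (fun x => (s x * `|f x - g x|)%:E).
Proof.
move=> mf mg; apply/measurable_EFinP; apply: measurable_funM => //.
by apply: measurableT_comp => //; exact: measurable_funB.
Qed.

Let dist0 (f g : X -> R) x : 0 <= (s x * `|f x - g x|)%:E.
Proof. by rewrite lee_fin mulr_ge0. Qed.

Lemma dist_triangle (f g h : X -> R) : measurable_fun [set: X] f ->
  measurable_fun [set: X] g -> measurable_fun [set: X] h ->
  dist f h <= dist f g + dist g h.
Proof.
move=> mf mg mh; rewrite -ge0_integralD//; [|exact: measurable_distance|exact: measurable_distance].
apply: ge0_le_integral => //; [exact: measurable_distance|by apply: emeasurable_funD; exact: measurable_distance|].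
move=> x _; rewrite -EFinD lee_fin -mulrDr ler_wpM2l//.
by rewrite (le_trans _ (ler_normD _ _))// addrA subrK.
Qed.

Lemma approximable_limit (f : X -> R) : measurable_fun [set: X] f ->
  (forall e : R, (0 < e)%R -> exists2 g, approximable g & dist f g <= e%:E) ->
  approximable f.
Proof.
move=> mf H; split => // e e0; have e20 : (0 < e / 2)%R by rewrite divr_gt0.
have [g [mg Hg] fg] := H _ e20; have [h ch gh] := Hg _ e20.
exists h => //; apply: le_trans (dist_triangle mf mg (Cc_measurable ch)) _.
by rewrite [e]splitr EFinD; exact: leeD.
Qed.

Lemma approximableD (f g : X -> R) : approximable f -> approximable g ->
  approximable (fun x => f x + g x)%R.
Proof.
move=> [mf Hf] [mg Hg]; split; first exact: measurable_funD.
move=> e e0; have e20 : (0 < e / 2)%R by rewrite divr_gt0.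
have [h ch fh] := Hf _ e20; have [k ck gk] := Hg _ e20.
have mh := Cc_measurable ch; have mk := Cc_measurable ck.
exists (fun x => h x + k x)%R; first exact: CcD.
apply: (@le_trans _ _ (dist f h + dist g k)); last first.
  by rewrite [e]splitr EFinD; exact: leeD.
rewrite -ge0_integralD//; [|exact: measurable_distance|exact: measurable_distance].
apply: ge0_le_integral => //.
- by move=> x _; rewrite lee_fin mulr_ge0.
- exact: (measurable_distance (measurable_funD mf mg) (measurable_funD mh mk)).
- by apply: emeasurable_funD; exact: measurable_distance.
move=> x _; rewrite -EFinD lee_fin -mulrDr ler_wpM2l//.
by rewrite opprD addrACA ler_normD.
Qed.

Lemma approximableZ (k : R) (f : X -> R) : approximable f ->
  approximable (fun x => k * f x)%R.
Proof.
move=> [mf Hf]; split; first exact: measurable_funM.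
move=> e e0; have k0 : (0 < `|k| + 1)%R by rewrite ltr_wpDl.
have [|h ch fh] := Hf (e / (`|k| + 1))%R; first by rewrite divr_gt0.
have mh := Cc_measurable ch; have mfh := measurable_distance mf mh.
exists (fun x => k * h x)%R; first exact: CcZ.
apply: (@le_trans _ _ ((`|k| + 1)%:E * dist f h)); last first.
  apply: le_trans (lee_wpmul2l _ fh) _; first by rewrite lee_fin ltW.
  by rewrite -EFinM lee_fin mulrC divfK// gt_eqF.
have mkf : measurable_fun [set: X] (fun x => k * f x)%R by exact: measurable_funM.
have mkh : measurable_fun [set: X] (fun x => k * h x)%R by exact: measurable_funM.
rewrite -ge0_integralZl//.
apply: ge0_le_integral => //.
- by move=> x _; rewrite lee_fin mulr_ge0.
- exact: (measurable_distance mkf mkh).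
- exact: measurable_funeM.
move=> x _; rewrite -EFinM lee_fin -mulrBr normrM mulrCA ler_wpM2r ?mulr_ge0//.
by rewrite lerDl.
Qed.

Let integrable_s : mu.-integrable [set: X] (EFin \o s).
Proof.
apply/integrableP; split => //; apply: le_lt_trans ints.
rewrite le_eqVlt; apply/orP; left; apply/eqP; apply: eq_integral => x _ /=.
by rewrite ger0_norm.
Qed.

(** Inner regularity is given for open sets, so the compact [K] is chosen inside an open [U]
    containing A rather than inside A. A bump between [K] and [V] differs from the indicator only on
    U \ A, U \ K and V \ K, of total measure below [dl]; absolute continuity of the integral of [s]
    converts this into a small distance. *)
Lemma approximable_indic_fin (A : set X) : measurable A -> mu A < +oo ->
  approximable (\1_A : X -> R).
Proof.
move=> mA Afin; split; first exact: measurable_indic.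
move=> e e0; have [dl [dl0 Hdl]] := integral_normr_continuous integrable_s e0.
have d40 : (0 < dl / 4)%R by rewrite divr_gt0.
have [U [oU AU Ud]] := outer_regular_diff hX mA d40.
have mU := open_borel oU.
have [_ _ inner] := doubling_radon hX.
have Ufin : mu U \is a fin_num.
  rewrite ge0_fin_numE// -(setDUK AU); apply: le_lt_trans (measureU2 _ _ _) _ => //.
    exact: measurableD.
  apply: lte_add_pinfty => //; exact: le_lt_trans Ud (ltry _).
have := inner _ oU; set S := (X in ereal_sup X) => E.
have [|_ [K /= [cK KU] <-] lt] := @ub_ereal_sup_adherent R S _ d40; first by rewrite -E.
rewrite -E in lt.
have mK := compact_borel cK.
have UK : mu (U `\` K) <= (dl / 4)%:E.
  rewrite measureD//; last by rewrite -ge0_fin_numE.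
  rewrite setIidr// leeBlDr//; last first.
    rewrite ge0_fin_numE//; apply: le_lt_trans (_ : mu K <= mu U) _.
      by apply: le_measure; rewrite ?inE.
    by rewrite -ge0_fin_numE.
  by rewrite addeC -leeBlDr//; exact: ltW.
have [V [oV KV Vd]] := outer_regular_diff hX mK d40.
have mV := open_borel oV.
have [h [ch h01 h1 h0]] := Cc_between (doubling_locally_compact hX) cK oV KV.
exists h => //.
pose B := (U `\` A) `|` (U `\` K) `|` (V `\` K).
have mB : measurable B.
  by apply: measurableU; [apply: measurableU|]; exact: measurableD.
have Bd : mu B < dl%:E.
  apply: (@le_lt_trans _ _ ((dl / 4)%:E + (dl / 4)%:E + (dl / 4)%:E)).
    apply: le_trans (measureU2 _ _ _) _ => //; [apply: measurableU; exact: measurableD|exact: measurableD|].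
    apply: leeD => //; apply: le_trans (measureU2 _ _ _) _ => //; [exact: measurableD|exact: measurableD|].
    exact: leeD.
  by rewrite -!EFinD lte_fin; lra.
have mh := Cc_measurable ch.
have m1 : measurable_fun [set: X] (\1_A : X -> R) by exact: measurable_indic.
apply: (@le_trans _ _ (\int[mu]_(x in B) (s x)%:E)).
  rewrite [leRHS]integral_mkcond; apply: ge0_le_integral => //.
  - exact: measurable_distance.
  - by apply/(measurable_restrictT _ _).1 => //; exact: measurable_funTS.
  move=> x _; rewrite patchE.
  have [Bx|nB] := pselect (B x).
    rewrite mem_set// lee_fin ler_piMr// indicE.
    have /andP[h0x h1x] := h01 x.
    rewrite ler_norml; apply/andP.
    by case: (x \in A) => /=; split; lra.
  rewrite memNset//= lee_fin.
  have [Ax|nA] := pselect (A x).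
    have Kx : K x by apply: contrapT => nK; apply: nB; left; right; split => //; exact: AU.
    by rewrite indicE mem_set// h1// subrr normr0 mulr0.
  have nU : ~ U x by move=> Ux; apply: nB; left; left.
  have nV : ~ V x by move=> Vx; apply: nB; right; split => // /KU.
  by rewrite indicE memNset// h0// subrr normr0 mulr0.
have := Hdl B mB Bd.
have -> : \int[mu]_(x in B) (s x)%:E = (\int[mu]_(x in B) `|s x|)%:E; last first.
  by move=> /ltW; rewrite lee_fin.
rewrite /Rintegral fineK; last first.
  rewrite ge0_fin_numE; last exact: integral_ge0.
  apply: le_lt_trans ints; apply: le_trans (_ : \int[mu]_x `|s x|%:E <= _); last first.
    by rewrite le_eqVlt; apply/orP; left; apply/eqP; apply: eq_integral => x _; rewrite ger0_norm.
  by apply: ge0_subset_integral => //; apply/measurable_EFinP; exact: measurableT_comp.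
by apply: eq_integral => x _; rewrite ger0_norm.
Qed.

(** The integral of [s] is finite, so its tail outside a large ball is small and A may be cut by
    that ball. *)
Lemma approximable_indic (A : set X) : measurable A -> approximable (\1_A : X -> R).
Proof.
move=> mA; apply: approximable_limit; first exact: measurable_indic.
move=> e e0.
have s0E x : 0 <= (s x)%:E by rewrite lee_fin.
pose nu : {measure set X -> \bar R} := density mu s0E msE.
pose Bn n : set X := ball point n.+1%:R.
have mB n : measurable (Bn n) by exact: measurable_metric_ball.
have nuT : nu [set: X] \is a fin_num.
  by rewrite ge0_fin_numE// /nu densityE.
have cv : nu \o Bn @ \oo --> nu [set: X].
  rewrite -(bigcup_metric_balls point); apply: nondecreasing_cvg_mu => //.
    by rewrite bigcup_metric_balls.
  move=> i j ij; apply/subsetPset; apply: le_ball; by rewrite ler_nat.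
have [n Hn] : exists n, nu (~` Bn n) <= e%:E.
  have /fine_cvgP[_] : nu \o Bn @ \oo --> (fine (nu [set: X]))%:E by rewrite fineK.
  move/cvgrPdist_le => /(_ _ e0)[n _ /(_ n (leqnn n)) /= Hn]; exists n.
  have Bfin : nu (Bn n) \is a fin_num.
    rewrite ge0_fin_numE//; apply: le_lt_trans (_ : nu (Bn n) <= nu setT) _.
      by apply: le_measure; rewrite ?inE.
    by rewrite -ge0_fin_numE.
  have -> : nu (~` Bn n) = nu [set: X] - nu (Bn n).
    by rewrite -setTD measureD ?setTI// -ge0_fin_numE.
  rewrite -(fineK nuT) -(fineK Bfin) -EFinB lee_fin.
  by apply: le_trans Hn; exact: ler_norm.
exists (\1_(A `&` Bn n) : X -> R).
  apply: approximable_indic_fin; first exact: measurableI.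
  apply: (@le_lt_trans _ _ (mu (Bn n))).
    by apply: le_measure; rewrite ?inE//; first [exact: measurableI|exact: subIsetr].
  by have /andP[] := doubling_ball hX point (ltr0Sn R n).
have nuE : nu (~` Bn n) = \int[mu]_(x in ~` Bn n) (s x)%:E by [].
apply: le_trans Hn; rewrite nuE [leRHS]integral_mkcond.
apply: ge0_le_integral => //.
- by apply: measurable_distance; [exact: measurable_indic|apply: measurable_indic; exact: measurableI].
- apply/(measurable_restrictT _ _).1; first exact: measurableC.
  exact: measurable_funTS.
move=> x _; rewrite patchE; have [Bx|nB] := pselect (Bn n x).
  have nBn : ~ (~` Bn n) x by move=> /(_ Bx).
  rewrite (memNset nBn)/=.
  by rewrite lee_fin !indicE in_setI (mem_set Bx) andbT subrr normr0 mulr0.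
rewrite mem_set// lee_fin ler_piMr// !indicE in_setI (memNset nB) andbF subr0.
by case: (x \in A); rewrite ?normr1 ?normr0.
Qed.

Import HBNNSimple.

Lemma approximable_nnsfun (f : {nnsfun X >-> R}) : approximable f.
Proof.
pose r := fset_set (range f).
have -> : (f : X -> R) = fun x => (\sum_(y <- r) y * \1_(f @^-1` [set y]) x)%R.
  by apply/funext => x; rewrite fimfunE fsbig_finite.
elim: (r : seq R) => [|y l IH].
  rewrite (_ : (fun x => _) = fun=> 0%R); last by apply/funext => x; rewrite big_nil.
  split => // e e0; exists (fun=> 0%R); first exact: Cc0.
  rewrite integral0_eq ?lee_fin ?(ltW e0)// => x _.
  by rewrite subrr normr0 mulr0.
rewrite (_ : (fun x => _) = fun x => (y * \1_(f @^-1` [set y]) x +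
    \sum_(y <- l) y * \1_(f @^-1` [set y]) x)%R); last first.
  by apply/funext => x; rewrite big_cons.
by apply: approximableD => //; apply: approximableZ; exact: approximable_indic.
Qed.

(** Simple functions increase to f and their weighted integrals converge monotonically; since they
    lie below f, the distance is the difference of the integrals. *)
Lemma approximable_ge0 (f : X -> R) : measurable_fun [set: X] f ->
  (forall x, 0 <= f x)%R -> \int[mu]_x (s x * f x)%:E < +oo -> approximable f.
Proof.
move=> mf f0 If; apply: approximable_limit => // e e0.
have mfE : measurable_fun [set: X] (EFin \o f) by exact/measurable_EFinP.
pose g := nnsfun_approx measurableT mfE.
have cvg_g x : EFin \o g ^~ x @ \oo --> (EFin \o f) x.
  by apply: cvg_nnsfun_approx => // y _; rewrite lee_fin.
have gf n x : (g n x <= f x)%R.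
  rewrite -lee_fin -[leRHS](cvg_lim _ (cvg_g x))//; apply: lime_ge.
    by apply/cvg_ex; eexists; exact: cvg_g.
  by exists n => // m nm /=; rewrite lee_fin; exact/lefP/nd_nnsfun_approx.
have sf0 x : 0 <= (s x * f x)%:E by rewrite lee_fin mulr_ge0.
have sg0 n x : [set: X] x -> 0 <= (s x * g n x)%:E.
  by move=> _; rewrite lee_fin mulr_ge0.
have msg n : measurable_fun [set: X] (fun x => (s x * g n x)%:E).
  by apply/measurable_EFinP; exact: measurable_funM.
have msf : measurable_fun [set: X] (fun x => (s x * f x)%:E).
  by apply/measurable_EFinP; exact: measurable_funM.
have lim x : (s x * g n x)%:E @[n --> \oo] --> (s x * f x)%:E.
  have /fine_cvgP[_ H] := cvg_g x; apply: cvg_EFin; first exact: nearW.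
  by apply: cvgMr; exact: H.
have Ifin : \int[mu]_x (s x * f x)%:E \is a fin_num.
  by rewrite ge0_fin_numE//; exact: integral_ge0.
have cv : \int[mu]_x (s x * g n x)%:E @[n --> \oo] --> \int[mu]_x (s x * f x)%:E.
  have -> : \int[mu]_x (s x * f x)%:E = \int[mu]_x limn (fun n => (s x * g n x)%:E).
    by apply: eq_integral => x _; apply/esym; apply: cvg_lim.
  apply: cvg_monotone_convergence => // x _ i j ij.
  rewrite lee_fin ler_wpM2l//; exact/lefP/nd_nnsfun_approx.
have [n Hn] : exists n, \int[mu]_x (s x * f x)%:E <= \int[mu]_x (s x * g n x)%:E + e%:E.
  have /fine_cvgP[[m _ Hm]] : \int[mu]_x (s x * g n x)%:E @[n --> \oo] -->
      (fine (\int[mu]_x (s x * f x)%:E))%:E by rewrite fineK.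
  move/cvgrPdist_le => /(_ _ e0)[k _ Hk].
  have := Hk (maxn m k) (leq_maxr _ _); have := Hm (maxn m k) (leq_maxl _ _).
  rewrite /= => gfin H; exists (maxn m k).
  rewrite -(fineK Ifin) -(fineK gfin) -EFinD lee_fin addrC -lerBlDr.
  by apply: le_trans H; exact: ler_norm.
exists (g n); first exact: approximable_nnsfun.
have gfin : \int[mu]_x (s x * g n x)%:E \is a fin_num.
  rewrite ge0_fin_numE; last by apply: integral_ge0 => x; exact: sg0.
  apply: le_lt_trans If; apply: ge0_le_integral => //.
    by move=> x _; rewrite lee_fin mulr_ge0.
  by move=> x _; rewrite lee_fin ler_wpM2l.
have d0 x : [set: X] x -> 0 <= (s x * `|f x - g n x|)%:E.
  by move=> _; rewrite lee_fin mulr_ge0.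
have md : measurable_fun [set: X] (fun x => (s x * `|f x - g n x|)%:E).
  exact: measurable_distance.
rewrite -(leeD2lE _ _ gfin) -ge0_integralD//; last by move=> x; exact: sg0.
apply: le_trans Hn; rewrite le_eqVlt; apply/orP; left; apply/eqP.
apply: eq_integral => x _; rewrite -EFinD ger0_norm ?subr_ge0//; congr EFin.
by rewrite mulrBr addrC subrK.
Qed.

Lemma Cc_dense (f : X -> R) : measurable_fun [set: X] f ->
  \int[mu]_x (s x * `|f x|)%:E < +oo -> approximable f.
Proof.
move=> mf If; pose f1 x := Num.max (f x) 0%R; pose f2 x := Num.max (- f x)%R 0%R.
have mf1 : measurable_fun [set: X] f1 by exact: measurable_maxr.
have mf2 : measurable_fun [set: X] f2 by apply: measurable_maxr => //; exact: measurableT_comp.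
have -> : f = fun x => (f1 x + (-1) * f2 x)%R.
  by apply/funext => x; rewrite /f1 /f2; have [h1|h1] := leP (f x) 0%R; have [h2|h2] := leP (- f x)%R 0%R; lra.
have mabs : measurable_fun [set: X] (fun x => (s x * `|f x|)%:E).
  by apply/measurable_EFinP; apply: measurable_funM => //; exact: measurableT_comp.
have part (k : X -> R) : measurable_fun [set: X] k -> (forall x, 0 <= k x <= `|f x|)%R ->
    approximable k.
  move=> mk k0; apply: approximable_ge0 => //; first by move=> x; have /andP[] := k0 x.
  apply: le_lt_trans If; apply: ge0_le_integral => //.
  - by move=> x _; rewrite lee_fin mulr_ge0//; have /andP[] := k0 x.
  - by apply/measurable_EFinP; exact: measurable_funM.
  - by move=> x _; rewrite lee_fin ler_wpM2l//; have /andP[] := k0 x.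
apply: approximableD; first apply: part => // x.
  by rewrite le_max lexx orbT/= ge_max ler_norm normr_ge0.
apply: approximableZ; apply: part => // x.
by rewrite le_max lexx orbT/= ge_max normr_ge0 andbT -normrN ler_norm.
Qed.

End density_of_Cc.

(** * Almost everywhere convergence and the equivalences *)

Section almost_everywhere_convergence.
Context d (R : realType) (X : borelMetricType d R).
Variable mu : {measure set X -> \bar R}.
Hypothesis hX : doubling_space mu.
Variables (T : \bar R) (phi : R -> X -> X -> R).
Hypothesis hphi : heat_kernel mu phi T.
Hypothesis A1 : initial_condition mu phi.
Hypothesis A2 : comparison_condition phi T.
Variables (t0 : R) (x0 : X).
Hypothesis t0T : 0 < t0%:E < T.
Local Notation psi := (phi t0 x0).
Variables (c : nat -> X) (rho : nat -> R) (C : R).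
Hypothesis rho0 : forall n, (0 < rho n)%R.
Hypothesis C1 : (1 <= C)%R.
Hypothesis hC : forall (x : X) (r : R), (0 < r)%R ->
  mu (ball x (4 * r)%R) <= C%:E * mu (ball x r).

Local Notation F := (refprod phi t0 x0).
Local Notation control := (control mu phi t0 x0 c rho).
Local Notation q := (truncated_heat phi t0 x0).

(** For a fixed level the bad set lies in L1 n or L2 n for every n, and their union has [q]-mass
    O(1/n), so its own [q]-mass is 0; positivity of [q] makes it mu-null. Uniting the two superlevel
    sets before intersecting over n lets one n serve both conditions. *)
Lemma ae_small_control (k : nat -> X -> R) :
  (forall n, measurable_fun [set: X] (k n)) ->
  (forall n, \int[mu]_y F (k n) y <= (n.+1%:R^-1)%:E) ->
  {ae mu, forall x, forall j : nat, exists n,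
    control (k n) x <= (j.+1%:R^-1)%:E /\ (`|k n x| <= j.+1%:R^-1)%R}.
Proof.
move=> mk Hk; apply/ae_foralln => j; set l : R := (j.+1%:R^-1)%R.
have l0 : (0 < l)%R by rewrite invr_gt0 ltr0Sn.
have q01 := truncated_heat_bounds hX A2 x0 t0T.
have mq := measurable_truncated_heat hphi x0 t0T.
have q_ge0 y : 0 <= (q y)%:E by rewrite lee_fin ltW//; have /andP[] := q01 y.
have mqE : measurable_fun [set: X] (fun y => (q y)%:E) by exact/measurable_EFinP.
pose nu : {measure set X -> \bar R} := density mu q_ge0 mqE.
pose L1 n := [set x | l%:E < control (k n) x].
pose L2 n := [set x | (l < `|k n x|)%R].
have mL1 n : measurable (L1 n).
  have mc : measurable_fun [set: X] (control (k n)).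
    exact: (measurable_control hX A2).
  by have := emeasurable_fun_o_infty measurableT mc l%:E; rewrite setTI.
have mL2 n : measurable (L2 n).
  by apply: measurable_set_ltr => //; exact: measurableT_comp.
pose Z := \bigcap_n (L1 n `|` L2 n).
have mZ : measurable Z by apply: bigcapT_measurable => n; exact: measurableU.
exists Z; split => //; last first.
  move=> x /= nx n _; apply: contrapT => nL; apply: nx; exists n.
  split; rewrite leNgt; apply/negP => H; apply: nL; [left|right]; exact: H.
have C0 : (0 < C)%R := lt_le_trans ltr01 C1.
pose K : R := (2 * (C + 1) / l + l^-1)%R.
have K0 : (0 < K)%R by rewrite addr_gt0 ?invr_gt0 ?divr_gt0 ?mulr_gt0 ?addr_gt0.
(* Chebyshev's inequality, with [q] at most psi. *)
have nuL2 n : nu (L2 n) <= (l^-1)%:E * \int[mu]_y F (k n) y.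
  have F0 y : 0 <= F (k n) y by exact: (refprod_ge0 hX A2).
  have mF : measurable_fun [set: X] (F (k n)) by exact: (measurable_refprod hphi).
  have l'0 : 0 <= (l^-1)%:E by rewrite lee_fin invr_ge0 ltW.
  have nuE : nu (L2 n) = \int[mu]_(x in L2 n) (q x)%:E by [].
  rewrite -ge0_integralZl// nuE [leLHS]integral_mkcond.
  apply: ge0_le_integral => //.
  - by move=> x _; exact: erestrict_ge0.
  - by apply/(measurable_restrictT _ _).1 => //; exact: measurable_funTS.
  - exact: measurable_funeM.
  move=> x _; rewrite patchE; have [Lx|nL] := pselect (L2 n x); last first.
    by rewrite memNset// mule_ge0.
  rewrite mem_set// /refprod -EFinM lee_fin ler_pdivlMl//.
  apply: (@le_trans _ _ (l * psi x)%R).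
    by rewrite ler_pM2l// ge_min lexx orbT.
  rewrite mulrC ler_wpM2l ?(ltW Lx)//.
  by rewrite ltW// (heat_slice_gt0 hX A2).
have nuZ n : nu Z <= (K / n.+1%:R)%:E.
  apply: (@le_trans _ _ (nu (L1 n `|` L2 n))).
    apply: le_measure; rewrite ?inE//; first exact: measurableU.
    by move=> x; apply.
  apply: le_trans (measureU2 nu (mL1 n) (mL2 n)) _.
  apply: (@le_trans _ _ (K%:E * \int[mu]_y F (k n) y)).
    rewrite /K EFinD ge0_muleDl ?lee_fin ?invr_ge0 ?(ltW l0)//; last first.
      by rewrite divr_ge0 ?mulr_ge0 ?addr_ge0// ltW.
    apply: leeD; last exact: nuL2.
    exact: (weak_type_control hX hphi A2 x0 t0T c rho0 C1 hC (mk n) l0).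
  apply: le_trans (lee_wpmul2l _ (Hk n)) _; first by rewrite lee_fin ltW.
  by rewrite -EFinM.
have nuZ0 : nu Z = 0.
  apply/eqP; rewrite eq_le measure_ge0 andbT; apply/lee_addgt0Pr => e e0; rewrite add0e.
  apply: le_trans (nuZ (Num.truncn (K / e))) _.
  rewrite lee_fin ler_pdivrMr ?ltr0Sn// mulrC -ler_pdivrMr//.
  exact/ltW/truncnS_gt.
have mqZ : measurable_fun Z (fun y => (q y)%:E) by exact: measurable_funTS.
have /(ae_eq_integral_abs mu mZ mqZ)[N [mN N0 sub]] : \int[mu]_(x in Z) `|(q x)%:E| = 0.
  have nuE : nu Z = \int[mu]_(x in Z) (q x)%:E by [].
  by rewrite -[RHS]nuZ0 nuE; apply: eq_integral => x _; rewrite gee0_abs.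
apply/eqP; rewrite -measure_le0 -N0; apply: le_measure; rewrite ?inE// => y Zy.
apply: sub => /(_ Zy) /eqP; rewrite eqe gt_eqF//.
by have /andP[] := q01 y.
Qed.

Variables (r W : R) (x : X).
Hypothesis rT : 0 < r%:E < T.
Hypothesis W0 : (0 <= W)%R.
Hypothesis HW : forall f, measurable_fun [set: X] f ->
  local_heat_maximal mu phi r f x <= W%:E * control f x.

(** The maximal function is +oo as soon as one integral diverges, so its finiteness yields absolute
    convergence as well as the bound. *)
Lemma local_heat_maximal_fin (f : X -> R) : measurable_fun [set: X] f ->
  control f x < +oo -> forall t : R, (0 < t < r)%R ->
  heat_finite mu phi t f x /\ `|heat_op mu phi t f x| <= W%:E * control f x.
Proof.
move=> mf cf t tr.
have Hlt : local_heat_maximal mu phi r f x < +oo.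
  apply: le_lt_trans (HW mf) _; apply: lte_mul_pinfty => //.
have := HW mf; move: Hlt; rewrite /local_heat_maximal; case: asboolP => // H _ H2.
split; first exact: H.
by apply: le_trans H2; apply: ereal_sup_ubound; exists t.
Qed.

(** Write f = h + (f - h): the term of h converges by (A1), the heat operator of f - h is at most W
    / (j+1) for all small times, and |f - h| is at most 1 / (j+1) at x. As x is fixed before j
    grows, [W] may depend on x. *)
Lemma heat_op_cvg (f : X -> R) : measurable_fun [set: X] f ->
  (forall j : nat, exists2 h, Cc h &
     control (fun y => f y - h y)%R x <= (j.+1%:R^-1)%:E /\
     (`|f x - h x| <= j.+1%:R^-1)%R) ->
  heat_op mu phi t f x @[t --> 0%R^'+] --> (f x)%:E.
Proof.
move=> mf Hf.
have r0 : (0 < r)%R by have /andP[] := rT.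
have key (j : nat) (e : R) : (0 < e)%R -> \forall t \near 0%R^'+,
    heat_op mu phi t f x \is a fin_num /\
    (`|f x - fine (heat_op mu phi t f x)| <= e + (W + 1) / j.+1%:R)%R.
  move=> e0; have [h ch [cx fx]] := Hf j.
  have mh := Cc_measurable ch.
  pose k y := (f y - h y)%R.
  have mk : measurable_fun [set: X] k by exact: measurable_funB.
  have kfin : control k x < +oo by apply: le_lt_trans cx (ltry _).
  have /fine_cvgP[hfin /cvgrPdist_le /(_ _ e0) hcv] := @A1 h ch x.
  near=> t.
  have tr : (0 < t < r)%R.
    by apply/andP; split; near: t; [exact: nbhs_right_gt|exact: nbhs_right_lt].
  have tT : 0 < t%:E < T.
    have /andP[t00 t1] := tr; rewrite lte_fin t00/=.
    by have /andP[_] := rT; apply: lt_trans; rewrite lte_fin.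
  have [kint kb] := local_heat_maximal_fin mk kfin tr.
  have hf : heat_op mu phi t h x \is a fin_num by near: t.
  have hd : (`|h x - fine (heat_op mu phi t h x)| <= e)%R by near: t.
  have mphi := measurable_heat_slice hphi x tT.
  (* An extended integral with a real value converges absolutely. *)
  have hint : heat_finite mu phi t h x.
    have mph : measurable_fun [set: X] (fun y => phi t x y * h y)%R.
      exact: measurable_funM.
    apply/integrableP; split; first exact/measurable_EFinP.
    by rewrite (integral_fin_num_abs mu measurableT mph).
  have fE : heat_op mu phi t f x = heat_op mu phi t h x + heat_op mu phi t k x.
    rewrite /heat_op -integralD//; apply: eq_integral => y _.
    by rewrite -EFinD -mulrDr /k addrC subrK.
  have kf : heat_op mu phi t k x \is a fin_num by exact: integrable_fin_num.
  split; first by rewrite fE fin_numD hf.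
  rewrite fE fineD//.
  have kb' : (`|fine (heat_op mu phi t k x)| <= W / j.+1%:R)%R.
    rewrite -lee_fin -abse_EFin fineK//; apply: le_trans kb _.
    by rewrite EFinM; apply: lee_wpmul2l => //; rewrite lee_fin.
  have -> : (f x - (fine (heat_op mu phi t h x) + fine (heat_op mu phi t k x)) =
    (h x - fine (heat_op mu phi t h x)) + ((f x - h x) - fine (heat_op mu phi t k x)))%R by ring.
  apply: le_trans (ler_normD _ _) _; apply: lerD => //.
  apply: le_trans (ler_normB _ _) _.
  by rewrite mulrDl mul1r addrC; exact: lerD.
apply/fine_cvgP; split.
  by near=> t; have [] : _ /\ _ := near (key 0%N 1%R ltr01) t _.
apply/cvgrPdist_le => e e0.
have e20 : (0 < e / 2)%R by rewrite divr_gt0.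
pose j := Num.truncn ((W + 1) / (e / 2))%R.
near=> t.
have [] : heat_op mu phi t f x \is a fin_num /\
    (`|f x - fine (heat_op mu phi t f x)| <= e / 2 + (W + 1) / j.+1%:R)%R.
  by near: t; exact: key.
move=> _ /le_trans; apply; rewrite [leRHS]splitr lerD2l.
rewrite ler_pdivrMr ?ltr0Sn// mulrC -ler_pdivrMr//.
exact/ltW/truncnS_gt.
Unshelve. all: by end_near. Qed.

End almost_everywhere_convergence.

(** * The implications between the four statements *)

Section equivalences.
Context d (R : realType) (X : borelMetricType d R).
Variable mu : {measure set X -> \bar R}.
Hypothesis hX : doubling_space mu.
Variables (T : \bar R) (phi : R -> X -> X -> R).
Hypothesis hphi : heat_kernel mu phi T.
Hypothesis A2 : comparison_condition phi T.
Variable (v : X -> R).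
Hypothesis hv : weight mu v.
Variable p : R.
Hypothesis p1 : (1 <= p)%R.

Let mv : measurable_fun [set: X] v. Proof. by have [] := hv. Qed.
Let v0 x : (0 < v x)%R. Proof. by have [] := hv. Qed.
Let p0 : (0 < p)%R. Proof. exact: lt_le_trans p1. Qed.

(** The point where the maximal function is finite depends on f, whereas one point must serve all f:
    (A2) transports finiteness to [point], at the price of a factor eta in time. The maximal
    function only sees times below r, hence r / 2. *)
Lemma heat_finite_of_maximal (r : R) (u : X -> R) : 0 < r%:E < T -> weight mu u ->
  ((1 < p)%R -> maximal_strong_type mu phi p v u r) ->
  (p = 1%R -> maximal_weak_type mu phi v u r) ->
  exists2 s : R, 0 < s%:E < T & exists x : X,
    forall f : X -> R, wLfun mu v p f -> heat_finite mu phi s f x.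
Proof.
move=> /andP[r0 rT] hu strong weak; rewrite lte_fin in r0.
have [[eta /andP[eta0 eta1] Heta] _] := A2.
have r20 : (0 < r / 2)%R by rewrite divr_gt0.
have r2r : (r / 2 < r)%R by rewrite ltr_pdivrMr// ltr_pMr// ltr1n.
have r2T : 0 < (r / 2)%:E < T.
  by rewrite lte_fin r20/=; apply: lt_trans rT; rewrite lte_fin.
have sT : 0 < (eta * (r / 2))%:E < T.
  rewrite lte_fin mulr_gt0//=; apply: le_lt_trans (_ : (r / 2)%:E < T).
    by rewrite lee_fin ler_piMl// ltW.
  by have /andP[] := r2T.
exists (eta * (r / 2))%R => //; exists point => f ff.
have [x Hx] := maximal_finite_somewhere hX p1 hu ff strong weak.
have fin : heat_finite mu phi (r / 2)%R f x.
  move: Hx; rewrite /local_heat_maximal; case: asboolP => // H _.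
  by apply: H; rewrite r20.
have [K HK] := Heta _ r2T point x.
have [mf _] := ff.
exact: (heat_finite_comparison hphi sT r2T mf HK fin).
Qed.

Lemma weight_class_of_heat_finite (r : R) (x : X) : 0 < r%:E < T ->
  (forall f : X -> R, wLfun mu v p f -> heat_finite mu phi r f x) ->
  weight_class mu phi T p v.
Proof.
move=> rT H; exists r => //; exists x.
have mg := measurable_heat_slice hphi x rT.
have g0 y := heat_slice_ge0 hphi x y rT.
have Hfin (f : X -> R) : measurable_fun [set: X] f -> (forall y, (0 <= f y)%R) ->
    \int[mu]_y (f y `^ p * v y)%:E < +oo -> \int[mu]_y (phi r x y * f y)%:E < +oo.
  move=> mf f0 fin.
  have ff : wLfun mu v p f.
    split => //; apply: poweR_lty; apply: le_lt_trans fin.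
    rewrite le_eqVlt; apply/orP; left; apply/eqP; apply: eq_integral => y _ /=.
    by rewrite ger0_norm.
  have /integrableP[_] := H f ff; apply: le_lt_trans.
  rewrite le_eqVlt; apply/orP; left; apply/eqP; apply: eq_integral => y _ /=.
  by rewrite ger0_norm// mulr_ge0.
have [K K0 HK] := landau_bound mv v0 mg g0 p1 Hfin.
exact: (dual_norm_finite hX mv v0 mg g0 p1 K0 HK).
Qed.

Section weight_class.
Variables (t0 : R) (x0 : X).
Hypothesis t0T : 0 < t0%:E < T.
Local Notation psi := (phi t0 x0).
Hypothesis vD : Lnorm mu (hoelder_conjugate p%:E)
  (fun y => (v y `^ (- p^-1) * psi y)%:E) < +oo.

Let mpsi : measurable_fun [set: X] psi. Proof. exact: (measurable_heat_slice hphi). Qed.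
Let psi0 y : (0 < psi y)%R. Proof. exact: (heat_slice_gt0 hX A2). Qed.
Let psi_ge0 y : (0 <= psi y)%R. Proof. exact: ltW. Qed.

Lemma refprod_integral_bound : exists2 K : R, (0 <= K)%R & forall f : X -> R,
  measurable_fun [set: X] f ->
  \int[mu]_y refprod phi t0 x0 f y <= K%:E * wLnorm mu v p (EFin \o f).
Proof. exact: (hoelder_weight mv v0 mpsi psi_ge0 p1 (doubling_setT_gt0 hX) vD). Qed.

Lemma refprod_integral_fin (f : X -> R) : wLfun mu v p f ->
  \int[mu]_y refprod phi t0 x0 f y < +oo.
Proof.
move=> [mf ff]; have [K K0 HK] := refprod_integral_bound.
by apply: le_lt_trans (HK f mf) _; apply: lte_mul_pinfty.
Qed.

(** The time in the statement serves finiteness only, and is eta t0 because (A2) compares there with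
    psi. Convergence uses the separate time of the pointwise bound. *)
Lemma convergence_of_weight_class : initial_condition mu phi ->
  maximal_condition mu phi T ->
  exists2 r : R, 0 < r%:E < T & forall f : X -> R, wLfun mu v p f ->
    (forall x, heat_finite mu phi r f x) /\
    {ae mu, forall x, heat_op mu phi t f x @[t --> 0%R^'+] --> (f x)%:E}.
Proof.
move=> A1 A3; have [[eta /andP[eta0 eta1] Heta] _] := A2.
have /andP[t00 t0T'] := t0T; rewrite lte_fin in t00.
have etaT : 0 < (eta * t0)%:E < T.
  rewrite lte_fin mulr_gt0//=; apply: le_lt_trans t0T'.
  by rewrite lee_fin ler_piMl// ltW.
exists (eta * t0)%R => // f ff; have [mf _] := ff.
have Ffin := refprod_integral_fin ff.
split.
  move=> x; have [K HK] := Heta _ t0T x x0.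
  apply: (heat_finite_comparison hphi etaT t0T mf HK).
  apply/integrableP; split.
    by apply/measurable_EFinP; exact: measurable_funM.
  apply: le_lt_trans Ffin; rewrite le_eqVlt; apply/orP; left; apply/eqP.
  by apply: eq_integral => y _ /=; rewrite normrM ger0_norm.
have [c [rho [rho0 cover]]] := countable_balls hX.
have [C C1 hC] := doubling_times4 hX.
have [r [e [w [rT _ w1 HH]]]] := maximal_le_control hX hphi A2 x0 t0T rho0 C1 hC cover A3.
have psi_int : \int[mu]_y (psi y)%:E < +oo.
  by rewrite (heat_kernel_mass hphi t0T) ltry.
(* Approximation takes place in L^1(psi mu), the norm in which [control] is estimated. *)
have [_ dense] := Cc_dense hX mpsi psi_ge0 psi_int mf Ffin.
have /choice[h Hh] : forall n : nat, exists h : X -> R, Cc h /\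
    \int[mu]_y (psi y * `|f y - h y|)%:E <= (n.+1%:R^-1)%:E.
  move=> n; have [|h ch Hh] := dense (n.+1%:R^-1)%R; first by rewrite invr_gt0 ltr0Sn.
  by exists h.
pose k n y := (f y - h n y)%R.
have mk n : measurable_fun [set: X] (k n).
  by apply: measurable_funB => //; apply: Cc_measurable; have [] := Hh n.
have Hk n : \int[mu]_y refprod phi t0 x0 (k n) y <= (n.+1%:R^-1)%:E.
  by have [] := Hh n.
have := ae_small_control hX hphi A2 t0T c rho0 C1 hC mk Hk.
apply: filterS => x good.
have W0 : (0 <= w (e x))%R by rewrite (le_trans ler01).
apply: (heat_op_cvg hphi A1 rT W0 (fun g mg => HH g mg x)) => // j.
have [n [H1 H2]] := good j.
by exists (h n) => //; have [] := Hh n.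
Qed.

Lemma maximal_of_weight_class : maximal_condition mu phi T ->
  exists2 r : R, 0 < r%:E < T & exists2 u : X -> R, weight mu u &
    ((1 < p)%R -> maximal_strong_type mu phi p v u r) /\
    (p = 1%R -> maximal_weak_type mu phi v u r).
Proof.
move=> A3.
have [c [rho [rho0 cover]]] := countable_balls hX.
have [C C1 hC] := doubling_times4 hX.
have [r [e [w [rT me w1 HH]]]] := maximal_le_control hX hphi A2 x0 t0T rho0 C1 hC cover A3.
have [K K0 HK] := refprod_integral_bound.
have r0 : (0 < r)%R by have /andP[] := rT.
have H0 f x : 0 <= local_heat_maximal mu phi r f x.
  rewrite /local_heat_maximal; case: asboolP => _; last by rewrite leey.
  apply: le_trans (abse_ge0 _) (ereal_sup_ubound _); exists (r / 2)%R => //=.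
  by rewrite divr_gt0//= ltr_pdivrMr// ltr_pMr// ltr1n.
exists r => //; have [p1'|pE] := ltP 1%R p; last first.
  have {}pE : p = 1%R by apply/eqP; rewrite eq_le pE.
  have [u hu weak] := weak_type_weight hX hphi A2 x0 t0T c rho0 C1 hC me w1.
  exists u => //; split => [//|_].
  exists (2 * (C + 1) * K)%R => f [mf ff].
  have C0 : (0 <= 2 * (C + 1))%R by rewrite mulr_ge0// addr_ge0// (le_trans ler01).
  have [meas_u u0 _] := hu.
  apply: ge_ereal_sup => _ [l /= l0 <-].
  apply: (@le_trans _ _ ((2 * (C + 1))%:E * \int[mu]_y refprod phi t0 x0 f y)).
    apply: le_trans (weak f mf l l0); apply: lee_wpmul2l; first by rewrite lee_fin ltW.
    rewrite [leLHS]integral_mkcond [leRHS]integral_mkcond.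
    (* The superlevel set of the maximal function need not be measurable, so the restricted
       integrands are compared pointwise. *)
    apply: le_ge0_integral_pointwise => x; first by apply: erestrict_ge0 => y _; rewrite lee_fin ltW.
    rewrite !patchE; case: ifPn => H; last first.
      by case: ifPn => // _; rewrite lee_fin ltW.
    rewrite ifT//; move: H; rewrite !inE /= gee0_abs// => H.
    exact: lt_le_trans (HH f mf x).
  rewrite (EFinM _ K) -muleA; apply: lee_wpmul2l; first by rewrite lee_fin.
  by rewrite -pE; exact: HK.
pose tau y := ((v y `^ (- p^-1) * psi y) `^ (p / (p - 1)))%R.
have mvp (s : R) : measurable_fun [set: X] (fun x => v x `^ s)%R.
  exact: (measurableT_comp (measurable_powR _)).
have mtau : measurable_fun [set: X] tau.
  apply: (measurableT_comp (measurable_powR _)); exact: measurable_funM.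
have tau0 y : (0 < tau y)%R by rewrite powR_gt0// mulr_gt0 ?powR_gt0.
have itau : \int[mu]_y (tau y)%:E < +oo.
  exact: (dual_weight_integrable psi_ge0 p1 p1' vD).
have [u hu [M M0 strong]] :=
  strong_type_weight hX hphi A2 x0 t0T c rho0 C1 hC me w1 p1' mtau tau0 itau.
exists u => //; split => [_|pE]; last by rewrite pE ltxx in p1'.
have [meas_u u0 _] := hu.
(* The summand 1 pays for the integral of (psi |f| / tau)^p tau, and K^p for the power of int psi
   |f|. *)
pose D := (M * (1 + K `^ p))%R.
have D0 : (0 <= D)%R by rewrite mulr_ge0// addr_ge0// powR_ge0.
exists (D `^ p^-1)%R => f [mf ff]; rewrite /wLnorm.
set I := \int[mu]_x (`|(EFin \o f) x| `^ p * (v x)%:E).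
have I0 : 0 <= I by apply: integral_ge0 => x _; rewrite mule_ge0 ?poweR_ge0// lee_fin ltW.
rewrite -poweR_EFin -poweRM// ?lee_fin//; apply: ge0_le_poweR; first by rewrite invr_ge0 ltW.
  by apply: integral_ge0 => x _; rewrite mule_ge0 ?poweR_ge0// lee_fin ltW.
apply: le_trans (_ : \int[mu]_x (((w (e x))%:E * control mu phi t0 x0 c rho f x) `^ p * (u x)%:E) <= _).
  apply: le_ge0_integral_pointwise => x; first by rewrite mule_ge0 ?poweR_ge0// lee_fin ltW.
  apply: lee_wpmul2r; first by rewrite lee_fin ltW.
  by apply: ge0_le_poweR; [exact: ltW|exact: abse_ge0|rewrite gee0_abs//; exact: HH].
apply: le_trans (strong f mf) _.
rewrite /D EFinM -muleA; apply: lee_wpmul2l; first by rewrite lee_fin.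
rewrite EFinD ge0_muleDl ?lee_fin ?powR_ge0// mul1e; apply: leeD.
  rewrite le_eqVlt; apply/orP; left; apply/eqP; apply: eq_integral => x _ /=.
  by rewrite (powR_dual_identity p1' (v0 x) (psi0 x) (normr_ge0 (f x))) EFinM.
have -> : (K `^ p)%:E * I = (K%:E * wLnorm mu v p (EFin \o f)) `^ p.
  rewrite poweRM ?lee_fin// ?poweR_ge0// poweR_EFin /wLnorm -poweRrM mulVf ?gt_eqF//.
  by rewrite poweRe1.
apply: ge0_le_poweR; [exact: ltW| |exact: HK].
by apply: integral_ge0 => y _; exact: (refprod_ge0 hX A2).
Qed.

End weight_class.
End equivalences.

Theorem theorem1p3 (d : measure_display) (R : realType)
    (X : borelMetricType d R) (mu : {measure set X -> \bar R})
    (hX : doubling_space mu)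
    (T : \bar R) (hT : 0 < T)
    (phi : R -> X -> X -> R) (hphi : heat_kernel mu phi T)
    (hinv : inv_locally_bounded phi T)
    (A1 : initial_condition mu phi)
    (A2 : comparison_condition phi T)
    (A3 : maximal_condition mu phi T)
    (v : X -> R) (hv : weight mu v)
    (p : R) (hp : (1 <= p)%R) :
  [<-> (* (1) *)
       exists2 r : R, 0 < r%:E < T & exists2 u : X -> R, weight mu u &
         ((1 < p)%R -> maximal_strong_type mu phi p v u r) /\
         (p = 1%R -> maximal_weak_type mu phi v u r);
       (* (2) *)
       exists2 r : R, 0 < r%:E < T & forall f : X -> R, wLfun mu v p f ->
         (forall x, heat_finite mu phi r f x) /\
         {ae mu, forall x,
           heat_op mu phi t f x @[t --> 0%R^'+] --> (f x)%:E};
       (* (3) *)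
       exists2 r : R, 0 < r%:E < T & exists x : X,
         forall f : X -> R, wLfun mu v p f -> heat_finite mu phi r f x;
       (* (4) *)
       weight_class mu phi T p v].
Proof.
tfae.
(* Statement (2) is reached from (1) through (3) and (4). *)
- move=> [r rT [u hu [strong weak]]].
  have [s sT [x Hx]] := heat_finite_of_maximal hX hphi A2 hp rT hu strong weak.
  have [t0 t0T [x0 vD]] := weight_class_of_heat_finite hX hphi hv hp sT Hx.
  exact: (convergence_of_weight_class hX hphi A2 hv hp t0T vD A1 A3).
- by move=> [r rT H]; exists r => //; exists point => f /H[].
- by move=> [r rT [x Hx]]; exact: (weight_class_of_heat_finite hX hphi hv hp rT Hx).
- move=> [t0 t0T [x0 vD]].
  exact: (maximal_of_weight_class hX hphi A2 hv hp t0T vD A3).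
Qed.
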